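(* Let $h:\mathbb{D}\to\mathbb{C}$ be non-constant and holomorphic and let $\sigma\in\partial\mathbb{D}$. Then $h$ is starlike at infinity with respect to $\sigma$ if and only if $$\operatorname{Im}\big[\overline{\sigma}(\sigma-z)^2h'(z)\big]\ge 0\qquad\text{for all } z\in\mathbb{D}.$$ Moreover, when this inequality holds for all $z\in\mathbb{D}$, equality holds at some (and hence at every) $z\in\mathbb{D}$ if and only if there exist $a\in\mathbb{R}\setminus\{0\}$ and $c\in\mathbb{C}$ such that $$h(z)=a\,\frac{\sigma+z}{\sigma-z}+c,\qquad z\in\mathbb{D}.$$
   Context: $\mathbb{D}=\{z\in\mathbb{C}:|z|<1\}$. A domain $\Omega\subset\mathbb{C}$ is starlike at infinity if $\Omega+it\subseteq\Omega$ for all $t\ge0$. A map $h:\mathbb{D}\to\mathbb{C}$ is starlike at infinity with respect to $\sigma\in\partial\mathbb{D}$ if $h$ is univalent (holomorphic and injective), $\limsup_{z\to\sigma}\operatorname{Im}h(z)=+\infty$ (with $z\in\mathbb{D}$), and $h(\mathbb{D})$ is starlike at infinity. *)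

(* Defs.v *)
From Stdlib Require Import Reals.
From Coquelicot Require Import Coquelicot.

Local Open Scope R_scope.

Definition unit_disk (z : C) : Prop := Cmod z < 1.

(* A map D -> C is represented by a total function C -> C, of which only the
   values on D are ever used. *)
Definition holomorphic_on (D : C -> Prop) (f : C -> C) : Prop :=
  forall z : C, D z -> ex_derive (K := C_AbsRing) (V := C_NormedModule) f z.

Definition injective_on (D : C -> Prop) (f : C -> C) : Prop :=
  forall z w : C, D z -> D w -> f z = f w -> z = w.

Definition univalent_on (D : C -> Prop) (f : C -> C) : Prop :=
  holomorphic_on D f /\ injective_on D f.

Definition constant_on (D : C -> Prop) (f : C -> C) : Prop :=
  exists c : C, forall z : C, D z -> f z = c.

Definition image (f : C -> C) (D : C -> Prop) : C -> Prop :=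
  fun w => exists z : C, D z /\ f z = w.

(* Connectedness: separation is tested with open sets of C, i.e. the relative
   topology of Omega. *)
Definition is_domain (Omega : C -> Prop) : Prop :=
  (exists w : C, Omega w) /\
  open Omega /\
  (forall U V : C -> Prop, open U -> open V ->
     (forall w, Omega w -> U w \/ V w) ->
     (exists w, Omega w /\ U w) -> (exists w, Omega w /\ V w) ->
     exists w, Omega w /\ U w /\ V w).

Definition starlike_at_infinity (Omega : C -> Prop) : Prop :=
  is_domain Omega /\
  forall t : R, 0 <= t -> forall w : C, Omega w -> Omega (w + Ci * RtoC t)%C.

(* limsup of u at s along D: the infimum over r > 0 of the supremum of u over
   the points of D at distance less than r from s. *)
Definition LimSup_within (D : C -> Prop) (u : C -> R) (s : C) : Rbar :=
  Rbar_glb (fun l : Rbar => exists r : posreal,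
    l = Lub_Rbar (fun y : R =>
          exists z : C, D z /\ Cmod (z - s)%C < r /\ y = u z)).

Definition starlike_at_infinity_wrt (h : C -> C) (sigma : C) : Prop :=
  univalent_on unit_disk h /\
  LimSup_within unit_disk (fun z => Im (h z)) sigma = p_infty /\
  starlike_at_infinity (image h unit_disk).

(* Main.v *)
Require Import Defs.
From Stdlib Require Import Reals Lra Lia ClassicalEpsilon.
From Coquelicot Require Import Coquelicot.

Local Open Scope R_scope.

(** The map w = (sigma + z) / (sigma - z) carries the disk onto the right
    half-plane Re w > 0 and sigma to infinity. Writing h (z) = g (w), the
    chain rule turns the expression conj sigma * (sigma - z)^2 * h' (z) into
    2 * g' (w). So the theorem concerns a holomorphic g on the half-plane: g is
    injective, its image is stable under upward translations, and Im g takes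
    arbitrarily large values arbitrarily far out, if and only if Im g' >= 0;
    and Im g' vanishes somewhere only for g (w) = a * w + c with a real.

    Both implications rest on one inequality ([reflection]). Let g be injective
    with an image Omega stable under upward translations. Reflection in a
    horizontal line sends the part of Omega below the line into Omega.
    Comparing the Green function of Omega with its reflection, by the maximum
    principle below the line, shows that a point a of the half-plane moves
    closer to b, in the hyperbolic metric, when g (a) is replaced by its mirror
    image in a line lying above g (a) and below g (b).

    If Im g is large at points b far out, then letting b tend to infinity in
    this inequality turns hyperbolic distance to b into a horofunction of
    infinity: the point a' over g (a) + i s satisfies Re a' >= Re a
    ([lift_moves_right]). The derivative of this statement at s = 0 is
    Re (i / g') >= 0, that is Im g' >= 0. Here g' does not vanish
    ([injective_derivative_nonzero]), so that g has a holomorphic inverse.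

    Conversely let Im g' > 0. Then g is injective, since its difference
    quotients have positive imaginary part, and lifting a vertical ray through
    g moves the point to the right. The lifted path has to be defined for all
    times. It is when Im g' is bounded below, hence for g (w) + i eps w; and for
    such functions [reflection_le], applied to a, b, a' equally spaced in time
    along an orbit, shows that successive steps of equal duration of an orbit have
    non-increasing hyperbolic length. This bounds orbits independently of eps,
    and compactness gives the result for g itself ([positive_upward]).

    When Im g' >= 0 vanishes at c, the function Im g is non-decreasing along
    horizontal lines, while Im g' (c) is a weighted average over circles about c
    of its increments between mirror points; so these increments vanish and
    Im g' = 0 on a ball, then, spreading out, everywhere
    ([critical_everywhere]). All difference quotients are then real, which
    forces g to be affine.

    The complex analysis required is developed from the mean value property,
    which follows from the Goursat theorem in logarithmic polar coordinates,
    where an annulus is a rectangle. *)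

(** * Continuity and complex differentiability *)

Definition Ccont (f : C -> C) (z : C) : Prop :=
  forall eps, 0 < eps -> exists del, 0 < del /\
    forall w : C, Cmod (w - z) < del -> Cmod (f w - f z) < eps.

(** Caratheodory's formulation of f' (z) = l. The rules for sums, products,
    composites and inverses become identities between the continuous factors q. *)
Definition Cder (f : C -> C) (z l : C) : Prop :=
  exists q : C -> C, Ccont q z /\ q z = l /\
    forall w : C, f w = (f z + q w * (w - z))%C.

Lemma Cmod_sub_sym (z w : C) : Cmod (z - w) = Cmod (w - z).
Proof. rewrite <- Cmod_opp. f_equal. ring. Qed.

Lemma Cmod_sub_diag (z : C) : Cmod (z - z) = 0.
Proof. rewrite <- Cmod_0. f_equal. ring. Qed.

Lemma Cmod_tri3 (a b c : C) : Cmod (a - c) <= Cmod (a - b) + Cmod (b - c).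
Proof.
  replace (a - c)%C with ((a - b) + (b - c))%C by ring. apply Cmod_triangle.
Qed.

Lemma Cmod_tri_inv (a b : C) : Cmod a - Cmod b <= Cmod (a - b).
Proof.
  assert (H := Cmod_triangle (a - b) b).
  replace (a - b + b)%C with a in H by ring. lra.
Qed.

Lemma im_le_Cmod (z : C) : Rabs (Im z) <= Cmod z.
Proof. eapply Rle_trans; [|apply Rmax_Cmod]. apply Rmax_r. Qed.

Lemma Cmod_le_ReIm (z : C) : Cmod z <= Rabs (Re z) + Rabs (Im z).
Proof.
  assert (0 <= Rabs (Re z)) by apply Rabs_pos.
  assert (0 <= Rabs (Im z)) by apply Rabs_pos.
  assert (H1 := Cmod_ge_0 z).
  assert (H2 := Cmod2_alt z).
  rewrite <- (pow2_abs (Re z)), <- (pow2_abs (Im z)) in H2. nra.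
Qed.

Lemma Ceq_ReIm (z w : C) : Re z = Re w -> Im z = Im w -> z = w.
Proof. intros; apply injective_projections; assumption. Qed.

Lemma Cmod_eq0_sub (z w : C) : Cmod (z - w) = 0 -> z = w.
Proof.
  intros H. apply Cmod_eq_0 in H. replace z with ((z - w) + w)%C by ring.
  rewrite H. ring.
Qed.

Lemma Cmod_sub_pos (z w : C) : z <> w -> 0 < Cmod (z - w).
Proof. intros H. apply Cmod_gt_0. now apply Cminus_eq_contra. Qed.

Lemma Ccont_const (c z : C) : Ccont (fun _ => c) z.
Proof.
  intros e He. exists 1. split; [lra|]. intros. rewrite Cmod_sub_diag. lra.
Qed.

Lemma Ccont_id (z : C) : Ccont (fun w => w) z.
Proof. intros e He. exists e. split; auto. Qed.

Lemma Ccont_plus f g z : Ccont f z -> Ccont g z -> Ccont (fun w => f w + g w)%C z.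
Proof.
  intros Hf Hg e He.
  destruct (Hf (e/2)) as [d1 [Hd1 H1]]; [lra|].
  destruct (Hg (e/2)) as [d2 [Hd2 H2]]; [lra|].
  exists (Rmin d1 d2). split; [now apply Rmin_pos|].
  intros w Hw.
  specialize (H1 w (Rlt_le_trans _ _ _ Hw (Rmin_l _ _))).
  specialize (H2 w (Rlt_le_trans _ _ _ Hw (Rmin_r _ _))).
  replace (f w + g w - (f z + g z))%C with ((f w - f z) + (g w - g z))%C by ring.
  eapply Rle_lt_trans; [apply Cmod_triangle|]. lra.
Qed.

Lemma Ccont_comp f g z : Ccont f z -> Ccont g (f z) -> Ccont (fun w => g (f w)) z.
Proof.
  intros Hf Hg e He.
  destruct (Hg e He) as [d1 [Hd1 H1]].
  destruct (Hf d1 Hd1) as [d2 [Hd2 H2]].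
  exists d2; split; auto.
Qed.

Lemma Ccont_bound f z : Ccont f z -> exists del M, 0 < del /\ 0 < M /\
  forall w, Cmod (w - z) < del -> Cmod (f w) <= M.
Proof.
  intros Hf. destruct (Hf 1) as [d [Hd H]]; [lra|].
  exists d, (Cmod (f z) + 1). assert (H0 := Cmod_ge_0 (f z)).
  repeat split; try lra.
  intros w Hw. specialize (H w Hw). assert (H3 := Cmod_tri_inv (f w) (f z)). lra.
Qed.

Lemma Ccont_mult f g z : Ccont f z -> Ccont g z -> Ccont (fun w => f w * g w)%C z.
Proof.
  intros Hf Hg e He.
  destruct (Ccont_bound f z Hf) as [d0 [M [Hd0 [HM H0]]]].
  assert (Hz := Cmod_ge_0 (g z)).
  destruct (Hf (e / 2 / (Cmod (g z) + 1))) as [d1 [Hd1 H1]].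
  { apply Rdiv_lt_0_compat; lra. }
  destruct (Hg (e / 2 / M)) as [d2 [Hd2 H2]].
  { apply Rdiv_lt_0_compat; lra. }
  exists (Rmin d0 (Rmin d1 d2)). split; [repeat apply Rmin_pos; auto|].
  intros w Hw.
  assert (Hw0 := Rlt_le_trans _ _ _ Hw (Rmin_l _ _)).
  assert (Hw' := Rlt_le_trans _ _ _ Hw (Rmin_r _ _)).
  specialize (H0 w Hw0).
  specialize (H1 w (Rlt_le_trans _ _ _ Hw' (Rmin_l _ _))).
  specialize (H2 w (Rlt_le_trans _ _ _ Hw' (Rmin_r _ _))).
  replace (f w * g w - f z * g z)%C
    with (f w * (g w - g z) + (f w - f z) * g z)%C by ring.
  eapply Rle_lt_trans; [apply Cmod_triangle|]. rewrite !Cmod_mult.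
  assert (Hp := Cmod_ge_0 (g w - g z)).
  assert (Cmod (f w) * Cmod (g w - g z) <= e / 2).
  { apply Rle_trans with (M * (e / 2 / M)).
    - apply Rmult_le_compat; auto using Cmod_ge_0; lra.
    - right; field; lra. }
  assert (Cmod (f w - f z) * Cmod (g z) < e / 2).
  { assert (Hq := Cmod_ge_0 (f w - f z)).
    apply Rle_lt_trans with (Cmod (f w - f z) * (Cmod (g z) + 1)).
    - apply Rmult_le_compat_l; lra.
    - replace (e / 2) with (e / 2 / (Cmod (g z) + 1) * (Cmod (g z) + 1)) by (field; lra).
      apply Rmult_lt_compat_r; lra. }
  lra.
Qed.

Lemma Ccont_inv f z : Ccont f z -> f z <> 0%C -> Ccont (fun w => / f w)%C z.
Proof.
  intros Hf Hz e He.
  assert (Hm : 0 < Cmod (f z)) by now apply Cmod_gt_0.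
  destruct (Hf (Rmin (Cmod (f z) / 2) (e * (Cmod (f z) * Cmod (f z)) / 2)))
    as [d [Hd H]].
  { apply Rmin_pos; [lra|]. assert (0 < Cmod (f z) * Cmod (f z)) by nra. nra. }
  exists d. split; [exact Hd|]. intros w Hw. specialize (H w Hw).
  assert (Ha := Rlt_le_trans _ _ _ H (Rmin_l _ _)).
  assert (Hb := Rlt_le_trans _ _ _ H (Rmin_r _ _)).
  assert (Hc := Cmod_tri_inv (f z) (f w)). rewrite Cmod_sub_sym in Hc.
  assert (Hw0 : f w <> 0%C) by (apply Cmod_gt_0; lra).
  replace (/ f w - / f z)%C with ((f z - f w) / (f w * f z))%C by (field; auto).
  rewrite Cmod_div by (now apply Cmult_neq_0).
  rewrite Cmod_mult, Cmod_sub_sym.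
  apply Rlt_div_l; [nra|].
  eapply Rlt_le_trans; [exact Hb|].
  assert (Cmod (f z) * Cmod (f z) / 2 <= Cmod (f w) * Cmod (f z)) by nra.
  nra.
Qed.

Lemma Ccont_conj z : Ccont Cconj z.
Proof.
  intros e He. exists e. split; auto. intros w Hw.
  now rewrite <- Cminus_conj, Cmod_conj.
Qed.

Lemma Ccont_ext_loc f g z del : 0 < del ->
  (forall w, Cmod (w - z) < del -> f w = g w) -> Ccont f z -> Ccont g z.
Proof.
  intros Hd He Hf e H. destruct (Hf e H) as [d [Hd' Hd'']].
  exists (Rmin del d). split; [now apply Rmin_pos|]. intros w Hw.
  rewrite <- !He.
  - apply Hd''. eapply Rlt_le_trans; [exact Hw|apply Rmin_r].
  - rewrite Cmod_sub_diag; lra.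
  - eapply Rlt_le_trans; [exact Hw|apply Rmin_l].
Qed.

Lemma Cder_cont f z l : Cder f z l -> Ccont f z.
Proof.
  intros [q [Hq [_ H]]].
  apply (Ccont_ext_loc (fun w => f z + q w * (w + - z))%C f z 1); [lra| |].
  - intros w _. symmetry. apply H.
  - apply Ccont_plus; [apply Ccont_const|].
    apply Ccont_mult; [exact Hq|]. apply Ccont_plus; [apply Ccont_id|apply Ccont_const].
Qed.

(** Shows that the derivative depends only on the values near z, and is the
    form in which the derivative of normed modules is stated. *)
Lemma Cder_eps f z l : Cder f z l <->
  forall eps, 0 < eps -> exists del, 0 < del /\ forall w : C, Cmod (w - z) < del ->
    Cmod (f w - f z - l * (w - z)) <= eps * Cmod (w - z).
Proof.
  split.
  - intros [q [Hq [Hl H]]] e He.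
    destruct (Hq e He) as [d [Hd H1]]. exists d; split; auto.
    intros w Hw. rewrite (H w).
    replace (f z + q w * (w - z) - f z - l * (w - z))%C
      with ((q w - q z) * (w - z))%C by (rewrite Hl; ring).
    rewrite Cmod_mult. apply Rmult_le_compat_r; [apply Cmod_ge_0|].
    left; auto.
  - intros H.
    exists (fun w => match Ceq_dec w z with left _ => l
                     | right _ => ((f w - f z) / (w - z))%C end).
    split; [|split].
    + intros e He. destruct (H (e/2)) as [d [Hd H1]]; [lra|].
      exists d; split; auto. intros w Hw.
      destruct (Ceq_dec z z) as [_|n]; [|now destruct n].
      destruct (Ceq_dec w z) as [->|n].
      * rewrite Cmod_sub_diag; lra.
      * assert (n' := Cminus_eq_contra _ _ n).
        replace ((f w - f z) / (w - z) - l)%C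
          with ((f w - f z - l * (w - z)) / (w - z))%C by (field; auto).
        rewrite Cmod_div by auto.
        assert (0 < Cmod (w - z)) by now apply Cmod_gt_0.
        apply Rlt_div_l; auto. specialize (H1 w Hw). nra.
    + destruct (Ceq_dec z z) as [_|n]; [reflexivity|now destruct n].
    + intros w. destruct (Ceq_dec w z) as [->|n]; [ring|].
      field. now apply Cminus_eq_contra.
Qed.

Lemma Cder_ext_loc f g z l del : 0 < del ->
  (forall w, Cmod (w - z) < del -> f w = g w) -> Cder f z l -> Cder g z l.
Proof.
  intros Hd He Hf. apply Cder_eps. intros e H.
  destruct (proj1 (Cder_eps f z l) Hf e H) as [d [Hd' H']].
  exists (Rmin del d). split; [now apply Rmin_pos|]. intros w Hw.
  rewrite <- !He.
  - apply H'. eapply Rlt_le_trans; [exact Hw|apply Rmin_r].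
  - rewrite Cmod_sub_diag; lra.
  - eapply Rlt_le_trans; [exact Hw|apply Rmin_l].
Qed.

Lemma Cder_const (c z : C) : Cder (fun _ => c) z 0.
Proof.
  exists (fun _ => 0%C). split; [apply Ccont_const|split; [reflexivity|]].
  intros; ring.
Qed.

Lemma Cder_id (z : C) : Cder (fun w => w) z 1.
Proof.
  exists (fun _ => 1%C). split; [apply Ccont_const|split; [reflexivity|]].
  intros; ring.
Qed.

Lemma Cder_plus f g z l m : Cder f z l -> Cder g z m ->
  Cder (fun w => f w + g w)%C z (l + m).
Proof.
  intros [q [Hq [<- H]]] [p [Hp [<- K]]].
  exists (fun w => q w + p w)%C.
  split; [now apply Ccont_plus|split; [reflexivity|]].
  intros w. rewrite (H w), (K w). ring.
Qed.

Lemma Cder_mult f g z l m : Cder f z l -> Cder g z m ->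
  Cder (fun w => f w * g w)%C z (l * g z + f z * m).
Proof.
  intros Hf Hg. assert (Cg := Cder_cont _ _ _ Hg).
  destruct Hf as [q [Hq [<- H]]]. destruct Hg as [p [Hp [<- K]]].
  exists (fun w => q w * g w + f z * p w)%C.
  split; [|split; [reflexivity|]].
  - apply Ccont_plus; apply Ccont_mult; auto using Ccont_const.
  - intros w. rewrite (H w). rewrite (K w). ring.
Qed.

Lemma Cder_scal c f z l : Cder f z l -> Cder (fun w => c * f w)%C z (c * l).
Proof.
  intros H. replace (c * l)%C with (0 * f z + c * l)%C by ring.
  apply (Cder_mult (fun _ => c)); [apply Cder_const|exact H].
Qed.

Lemma Cder_comp f g z l m : Cder f z l -> Cder g (f z) m ->
  Cder (fun w => g (f w)) z (m * l).
Proof.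
  intros Hf. assert (Cf := Cder_cont _ _ _ Hf). revert Hf.
  intros [q [Hq [<- H]]] [p [Hp [<- K]]].
  exists (fun w => p (f w) * q w)%C. split; [|split; [reflexivity|]].
  - apply Ccont_mult; [|exact Hq]. now apply (Ccont_comp f p).
  - intros w. rewrite (K (f w)). rewrite (H w) at 2. ring.
Qed.

Lemma Cder_inv f z l : Cder f z l -> f z <> 0%C ->
  Cder (fun w => / f w)%C z (- l / (f z * f z)).
Proof.
  intros Hf Hz.
  assert (Cf := Cder_cont _ _ _ Hf).
  destruct (Cf (Cmod (f z))) as [d [Hd Hd']]; [now apply Cmod_gt_0|].
  assert (Hnz : forall w, Cmod (w - z) < d -> f w <> 0%C).
  { intros w Hw E. specialize (Hd' w Hw). rewrite E in Hd'.
    replace (0 - f z)%C with (- f z)%C in Hd' by ring. rewrite Cmod_opp in Hd'. lra. }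
  destruct Hf as [q [Hq [<- H]]].
  set (k := fun w => (/ f z + (- q w / (f w * f z)) * (w - z))%C).
  apply (Cder_ext_loc k _ z _ d Hd).
  - intros w Hw. unfold k. rewrite (H w) at 1.
    assert (Hw' := Hnz w Hw). rewrite (H w) in Hw'. rewrite (H w). field. auto.
  - exists (fun w => (- q w / (f w * f z))%C). split; [|split; [reflexivity|]].
    + unfold Cdiv. apply Ccont_mult.
      * apply (Ccont_ext_loc (fun w => (- (1)) * q w)%C _ z 1); [lra|intros; ring|].
        apply Ccont_mult; [apply Ccont_const|exact Hq].
      * apply Ccont_inv; [|now apply Cmult_neq_0].
        apply Ccont_mult; [exact Cf|apply Ccont_const].
    + intros w. unfold k. ring.
Qed.

Lemma is_derive_Cder f z l :
  is_derive (K := C_AbsRing) (V := C_NormedModule) f z l <-> Cder f z l.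
Proof.
  rewrite Cder_eps. split.
  - intros [_ H] e He.
    destruct (H z (fun P HP => HP) (mkposreal e He)) as [d Hd].
    exists d; split; [apply cond_pos|]. intros w Hw.
    assert (B : ball (M := AbsRing_UniformSpace C_AbsRing) z d w) by exact Hw.
    specialize (Hd w B). simpl in Hd.
    change (Cmod (f w - f z - (w - z) * l) <= e * Cmod (w - z)) in Hd.
    now rewrite (Cmult_comm l).
  - intros H. split; [apply is_linear_scal_l|].
    intros x Hx.
    apply (is_filter_lim_locally_unique (V := AbsRing_NormedModule C_AbsRing)) in Hx.
    subst x.
    intros e. destruct (H e (cond_pos e)) as [d [Hd H']].
    exists (mkposreal d Hd). intros w Hw.
    specialize (H' w Hw). rewrite (Cmult_comm l) in H'. exact H'.
Qed.

Lemma ex_derive_Cder f z : ex_derive (K := C_AbsRing) (V := C_NormedModule) f z ->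
  Cder f z (C_derive f z).
Proof.
  intros [l H]. rewrite (is_C_derive_unique f z l H). now apply is_derive_Cder.
Qed.

(** The factor k of g at psi q is composed with psi and inverted; the
    continuity of psi is what makes the result continuous at q. *)
Lemma Cder_inverse g psi q l del : 0 < del ->
  (forall w, Cmod (w - q) < del -> g (psi w) = w) ->
  Ccont psi q -> Cder g (psi q) l -> l <> 0%C -> Cder psi q (/ l).
Proof.
  intros Hdel Hg Hpsi [k [Hk [<- H]]] Hl.
  assert (Ck : Ccont (fun w => k (psi w)) q) by now apply (Ccont_comp psi k).
  destruct (Ck (Cmod (k (psi q)))) as [d [Hd Hd']]; [now apply Cmod_gt_0|].
  apply (Cder_ext_loc (fun w => psi q + (/ k (psi w)) * (w - q))%C _ q _ (Rmin d del)).
  - now apply Rmin_pos.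
  - intros w Hw.
    assert (Hnz : k (psi w) <> 0%C).
    { intros E. specialize (Hd' w (Rlt_le_trans _ _ _ Hw (Rmin_l _ _))).
      simpl in Hd'. rewrite E in Hd'.
      replace (0 - k (psi q))%C with (- k (psi q))%C in Hd' by ring.
      rewrite Cmod_opp in Hd'. lra. }
    assert (A := H (psi w)).
    rewrite !Hg in A.
    + rewrite A at 2. field. exact Hnz.
    + rewrite Cmod_sub_diag; lra.
    + eapply Rlt_le_trans; [exact Hw|apply Rmin_r].
  - exists (fun w => / k (psi w))%C. split; [|split; [reflexivity|]].
    + now apply (Ccont_inv (fun w => k (psi w))).
    + intros w. ring.
Qed.

(** Conjugating before and after keeps holomorphy: this is how reflections
    enter. *)
Lemma Cder_conj_conj f z l : Cder f (Cconj z) l ->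
  Cder (fun w => Cconj (f (Cconj w))) z (Cconj l).
Proof.
  intros [q [Hq [<- H]]].
  exists (fun w => Cconj (q (Cconj w))). split; [|split; [reflexivity|]].
  - apply (Ccont_comp (fun w => q (Cconj w)) Cconj); [|apply Ccont_conj].
    now apply (Ccont_comp Cconj q); [apply Ccont_conj|].
  - intros w. rewrite (H (Cconj w)).
    rewrite Cplus_conj, Cmult_conj, Cminus_conj, !Cconj_conj. reflexivity.
Qed.

(** * Bisection, extrema on compact sets, and the Goursat theorem *)

(** Nested intervals of length L / 2^n, given by their left end points. *)
Lemma nested_point (x : nat -> R) (L : R) : 0 <= L ->
  (forall n, x n <= x (S n)) ->
  (forall n, x (S n) + L / 2 ^ S n <= x n + L / 2 ^ n) ->
  exists u, forall n, x n <= u <= x n + L / 2 ^ n.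
Proof.
  intros HL H1 H2.
  assert (P2 : forall n, 0 <= L / 2 ^ n).
  { intros n. apply Rdiv_le_0_compat; [exact HL|apply pow_lt; lra]. }
  assert (M1 : forall n k, x n <= x (n + k)%nat).
  { intros n k; induction k; [rewrite Nat.add_0_r; lra|].
    rewrite Nat.add_succ_r. specialize (H1 (n+k)%nat). lra. }
  assert (M2 : forall n k, x (n + k)%nat + L / 2 ^ (n + k) <= x n + L / 2 ^ n).
  { intros n k; induction k; [rewrite Nat.add_0_r; lra|].
    rewrite Nat.add_succ_r. specialize (H2 (n+k)%nat). lra. }
  assert (UB : forall n k, x k <= x n + L / 2 ^ n).
  { intros n k. destruct (Nat.le_ge_cases n k) as [h|h].
    - replace k with (n + (k - n))%nat by lia.
      specialize (M2 n (k - n)%nat). specialize (P2 (n + (k-n))%nat). lra.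
    - specialize (M1 k (n - k)%nat). replace (k + (n - k))%nat with n in M1 by lia.
      specialize (P2 n). lra. }
  destruct (completeness (fun r => exists n, r = x n)) as [u [Hu1 Hu2]].
  - exists (x 0%nat + L / 2 ^ 0). intros r [n ->]. apply UB.
  - exists (x 0%nat), 0%nat. reflexivity.
  - exists u. intros n. split.
    + apply Hu1. now exists n.
    + apply Hu2. intros r [k ->]. apply UB.
Qed.

Lemma pow2_small (L del : R) : 0 < del -> exists n, L / 2 ^ n < del.
Proof.
  intros Hd. destruct (Pow_x_infinity 2) with (b := Rabs L / del + 1) as [n Hn].
  { rewrite Rabs_pos_eq; lra. }
  exists n. specialize (Hn n (le_n n)).
  assert (Hp : 0 < 2 ^ n) by (apply pow_lt; lra).
  rewrite Rabs_pos_eq in Hn by lra.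
  apply Rlt_div_l; [lra|].
  assert (HL := Rle_abs L).
  assert (Rabs L / del < 2 ^ n) by lra.
  apply Rlt_div_l in H; lra.
Qed.

(** If P failed for the whole box it would fail for one of its quarters, and so
    on; the boxes obtained shrink to a point (u, v), near which P holds. All
    boxes met have sides L / 2^n and M / 2^n: their constant shape is what makes
    squared perimeter comparable with area in the Goursat theorem. *)
Lemma box_induction (P : R -> R -> R -> R -> Prop) (a c L M : R) :
  0 < L -> 0 < M ->
  (forall x y l m, 0 < l -> 0 < m ->
     a <= x -> x + l <= a + L -> c <= y -> y + m <= c + M ->
     P x y (l/2) (m/2) -> P (x + l/2) y (l/2) (m/2) ->
     P x (y + m/2) (l/2) (m/2) -> P (x + l/2) (y + m/2) (l/2) (m/2) ->
     P x y l m) ->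
  (forall u v, a <= u <= a + L -> c <= v <= c + M -> exists del, 0 < del /\
     forall x y n, a <= x -> x + L / 2 ^ n <= a + L -> c <= y -> y + M / 2 ^ n <= c + M ->
       x <= u <= x + L / 2 ^ n -> y <= v <= y + M / 2 ^ n ->
       L / 2 ^ n < del -> M / 2 ^ n < del -> P x y (L / 2 ^ n) (M / 2 ^ n)) ->
  P a c L M.
Proof.
  intros HL HM Hsplit Hloc. apply NNPP. intros Hbad.
  set (bad := fun (n : nat) (p : R * R) =>
    (a <= fst p /\ fst p + L / 2 ^ n <= a + L /\
     c <= snd p /\ snd p + M / 2 ^ n <= c + M) /\
    ~ P (fst p) (snd p) (L / 2 ^ n) (M / 2 ^ n)).
  assert (Hp : forall n, 0 < 2 ^ n) by (intro; apply pow_lt; lra).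
  assert (Hh : forall A n, A / 2 ^ S n = A / 2 ^ n / 2).
  { intros A n. simpl. field. specialize (Hp n). lra. }
  assert (step : forall n p, bad n p -> exists p', bad (S n) p' /\
     fst p <= fst p' /\ fst p' + L / 2 ^ S n <= fst p + L / 2 ^ n /\
     snd p <= snd p' /\ snd p' + M / 2 ^ S n <= snd p + M / 2 ^ n).
  { intros n [x y] [[B1 [B2 [B3 B4]]] B5]. simpl fst in *. simpl snd in *.
    assert (Hl : 0 < L / 2 ^ n) by (apply Rdiv_lt_0_compat; auto).
    assert (Hm : 0 < M / 2 ^ n) by (apply Rdiv_lt_0_compat; auto).
    apply NNPP. intros N. apply B5.
    assert (Q : forall x' y', (x' = x \/ x' = x + L / 2 ^ n / 2) ->
       (y' = y \/ y' = y + M / 2 ^ n / 2) -> P x' y' (L / 2 ^ n / 2) (M / 2 ^ n / 2)).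
    { intros x' y' Hx Hy. apply NNPP. intros N'. apply N. exists (x', y').
      unfold bad. rewrite !Hh. simpl fst; simpl snd.
      repeat split; try exact N'; destruct Hx; destruct Hy; subst; lra. }
    apply Hsplit; auto. }
  assert (start : bad 0%nat (a, c)).
  { unfold bad; simpl fst; simpl snd. simpl pow. rewrite !Rdiv_1_r.
    repeat split; try lra. exact Hbad. }
  set (next := fun n (s : {p | bad n p}) =>
    let H := constructive_indefinite_description _ (step n (proj1_sig s) (proj2_sig s)) in
    exist (bad (S n)) (proj1_sig H) (proj1 (proj2_sig H))).
  set (sq := fix sq n : {p | bad n p} :=
    match n with O => exist _ _ start | S k => next k (sq k) end).
  set (X := fun n => fst (proj1_sig (sq n))).
  set (Y := fun n => snd (proj1_sig (sq n))).
  assert (Hst : forall n, X n <= X (S n) /\ X (S n) + L / 2 ^ S n <= X n + L / 2 ^ n /\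
     Y n <= Y (S n) /\ Y (S n) + M / 2 ^ S n <= Y n + M / 2 ^ n).
  { intros n. unfold X, Y. cbn [sq]. unfold next. cbn zeta. cbn [proj1_sig].
    destruct (constructive_indefinite_description _ _) as [p [Hb1 Hb2]].
    cbn [proj1_sig]. exact Hb2. }
  destruct (nested_point X L) as [u Hu]; [lra|apply Hst|apply Hst|].
  destruct (nested_point Y M) as [v Hv]; [lra|apply Hst|apply Hst|].
  assert (Hb0 : forall n, bad n (X n, Y n)).
  { intros n. unfold X, Y. rewrite <- surjective_pairing. exact (proj2_sig (sq n)). }
  destruct (Hloc u v) as [del [Hd H]].
  { specialize (Hu 0%nat). simpl in Hu. destruct (Hb0 0%nat) as [Hb _].
    simpl in Hb. lra. }
  { specialize (Hv 0%nat). simpl in Hv. destruct (Hb0 0%nat) as [Hb _].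
    simpl in Hb. lra. }
  destruct (pow2_small (L + M) del Hd) as [n Hn].
  assert (El : (L + M) / 2 ^ n = L / 2 ^ n + M / 2 ^ n) by (unfold Rdiv; ring).
  assert (Hl : 0 < L / 2 ^ n) by (apply Rdiv_lt_0_compat; auto).
  assert (Hm : 0 < M / 2 ^ n) by (apply Rdiv_lt_0_compat; auto).
  destruct (Hb0 n) as [Hb Hb']. simpl fst in *. simpl snd in *.
  apply Hb'. apply H; auto; lra.
Qed.

(** Compactness of a closed bounded set S, in the form of an induction: the
    sets A with Q A form an ideal which contains a neighbourhood in S of each
    point of S, hence S. *)
Lemma compact_induction (S : C -> Prop) (Q : (C -> Prop) -> Prop) (B : R) :
  (forall w, S w -> Cmod w <= B) ->
  (forall w, ~ S w -> exists del, 0 < del /\ forall w', Cmod (w' - w) < del -> ~ S w') ->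
  (forall A A' : C -> Prop, (forall w, A w -> A' w) -> Q A' -> Q A) ->
  (forall A A' : C -> Prop, Q A -> Q A' -> Q (fun w => A w \/ A' w)) ->
  Q (fun _ => False) ->
  (forall w, S w -> exists del, 0 < del /\ Q (fun w' => S w' /\ Cmod (w' - w) < del)) ->
  Q S.
Proof.
  intros HB Hcl Hmono Hun Hemp Hloc.
  set (b := Rabs B + 1).
  assert (Hb : 0 < b) by (unfold b; assert (A := Rabs_pos B); lra).
  set (box := fun x y l m (w : C) => S w /\ x <= Re w <= x + l /\ y <= Im w <= y + m).
  apply (Hmono _ (box (-b) (-b) (2*b) (2*b))).
  { intros w Hw. split; [exact Hw|].
    specialize (HB w Hw). assert (A := Rle_abs B).
    assert (A1 := re_le_Cmod w). assert (A2 := im_le_Cmod w).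
    assert (A3 : Rabs (Re w) <= b) by (unfold b; lra).
    assert (A4 : Rabs (Im w) <= b) by (unfold b; lra).
    apply Rabs_le_between in A3. apply Rabs_le_between in A4. lra. }
  apply (box_induction (fun x y l m => Q (box x y l m))); try lra.
  - intros x y l m Hl Hm _ _ _ _ H1 H2 H3 H4.
    apply (Hmono _ _) with (2 := Hun _ _ (Hun _ _ H1 H2) (Hun _ _ H3 H4)).
    intros w [Hw [Hx Hy]]. unfold box.
    destruct (Rle_dec (Re w) (x + l/2)); destruct (Rle_dec (Im w) (y + m/2)).
    + left; left. repeat split; auto; lra.
    + right; left. repeat split; auto; lra.
    + left; right. repeat split; auto; lra.
    + right; right. repeat split; auto; lra.
  - intros u v Hu Hv.
    assert (near : forall del x y n, 0 < del ->
      x <= u <= x + 2 * b / 2 ^ n -> y <= v <= y + 2 * b / 2 ^ n ->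
      2 * b / 2 ^ n < del / 2 ->
      forall w : C, x <= Re w <= x + 2 * b / 2 ^ n -> y <= Im w <= y + 2 * b / 2 ^ n ->
      Cmod (w - (u, v)) < del).
    { intros del x y n Hd Hx Hy Hn w Hwx Hwy.
      eapply Rle_lt_trans; [apply Cmod_le_ReIm|].
      assert (Rabs (Re (w - (u, v))) < del / 2).
      { apply Rabs_lt_between. unfold Re in *. simpl. lra. }
      assert (Rabs (Im (w - (u, v))) < del / 2).
      { apply Rabs_lt_between. unfold Im in *. simpl. lra. }
      lra. }
    destruct (classic (S (u, v))) as [Huv|Huv].
    + destruct (Hloc _ Huv) as [del [Hd Hq]].
      exists (del / 2). split; [lra|]. intros x y n _ _ _ _ Hx Hy Hn _.
      eapply Hmono; [|exact Hq]. intros w [Hw [Hwx Hwy]]. split; [exact Hw|].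
      eapply near; eauto.
    + destruct (Hcl _ Huv) as [del [Hd Hq]].
      exists (del / 2). split; [lra|]. intros x y n _ _ _ _ Hx Hy Hn _.
      eapply Hmono; [|exact Hemp]. intros w [Hw [Hwx Hwy]].
      apply (Hq w); [|exact Hw]. eapply near; eauto.
Qed.

(** Compactness is used twice: the sets on which f is bounded form an ideal,
    and if the supremum m were not attained, so would the sets on which f stays
    below some K < m. *)
Lemma usc_attains_max (S : C -> Prop) (f : C -> R) (B : R) :
  (exists w, S w) ->
  (forall w, S w -> Cmod w <= B) ->
  (forall w, ~ S w -> exists del, 0 < del /\ forall w', Cmod (w' - w) < del -> ~ S w') ->
  (forall w M, S w -> f w < M ->
     exists del, 0 < del /\ forall w', S w' -> Cmod (w' - w) < del -> f w' < M) ->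
  exists c, S c /\ forall w, S w -> f w <= f c.
Proof.
  intros [w0 Hw0] HB Hcl Hf.
  assert (Hbd : exists K, forall w, S w -> f w <= K).
  { apply (compact_induction S (fun A => exists K, forall w, A w -> f w <= K) B); auto.
    - intros A A' HA [K HK]. exists K. auto.
    - intros A A' [K HK] [K' HK']. exists (Rmax K K').
      intros w [h|h]; [eapply Rle_trans; [now apply HK|apply Rmax_l]
                      |eapply Rle_trans; [now apply HK'|apply Rmax_r]].
    - exists 0. intros w [].
    - intros w Hw. destruct (Hf w (f w + 1) Hw) as [d [Hd H]]; [lra|].
      exists d; split; auto. exists (f w + 1). intros w' [h1 h2]. left; auto. }
  destruct (completeness (fun r => exists w, S w /\ r = f w)) as [m [Hm1 Hm2]].
  { destruct Hbd as [K HK]. exists K. intros r [w [Hw ->]]. auto. }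
  { exists (f w0), w0. auto. }
  apply NNPP. intros N.
  assert (Hlt : forall w, S w -> f w < m).
  { intros w Hw. destruct (Rlt_le_dec (f w) m) as [h|h]; [exact h|].
    exfalso. apply N. exists w. split; auto. intros w' Hw'.
    eapply Rle_trans; [|exact h]. apply Hm1. now exists w'. }
  assert (H : exists K, K < m /\ forall w, S w -> f w <= K).
  { apply (compact_induction S (fun A => exists K, K < m /\ forall w, A w -> f w <= K) B); auto.
    - intros A A' HA [K [HK' HK]]. exists K. auto.
    - intros A A' [K [h1 HK]] [K' [h2 HK']]. exists (Rmax K K').
      split; [now apply Rmax_lub_lt|].
      intros w [h|h]; [eapply Rle_trans; [now apply HK|apply Rmax_l]
                      |eapply Rle_trans; [now apply HK'|apply Rmax_r]].
    - exists (m - 1). split; [lra|]. intros w [].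
    - intros w Hw. specialize (Hlt w Hw).
      destruct (Hf w ((f w + m) / 2) Hw) as [d [Hd H]]; [lra|].
      exists d; split; auto. exists ((f w + m) / 2). split; [lra|].
      intros w' [h1 h2]. left; auto. }
  destruct H as [K [HK H]].
  assert (m <= K) by (apply Hm2; intros r [w [Hw ->]]; auto). lra.
Qed.

(** Total differentiability with gradient (p, q): what a complex derivative at
    one point provides. *)
Definition Rdiff2 (F : R -> R -> R) (x y p q : R) : Prop :=
  forall eps, 0 < eps -> exists del, 0 < del /\ forall h k, Rabs h < del -> Rabs k < del ->
    Rabs (F (x + h) (y + k) - F x y - p * h - q * k) <= eps * (Rabs h + Rabs k).

Lemma Rdiff2_cont1 F x y p q : Rdiff2 F x y p q -> continuous (fun t => F t y) x.
Proof.
  intros H. apply continuity_pt_filterlim.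
  intros e He. destruct (H 1) as [d [Hd Hd']]; [lra|].
  assert (Hq : 0 < 1 + Rabs p) by (assert (A := Rabs_pos p); lra).
  exists (Rmin d (e / (1 + Rabs p))). split.
  { apply Rmin_pos; [lra|now apply Rdiv_lt_0_compat]. }
  assert (G : forall t : R, Rabs (t - x) < Rmin d (e / (1 + Rabs p)) ->
    Rabs (F t y - F x y) < e); [|intros t [_ Ht]; exact (G t Ht)].
  intros t Ht.
  assert (H1 := Rlt_le_trans _ _ _ Ht (Rmin_l _ _)).
  assert (H2 := Rlt_le_trans _ _ _ Ht (Rmin_r _ _)).
  specialize (Hd' (t - x) 0 H1). rewrite Rabs_R0 in Hd'. specialize (Hd' Hd).
  replace (x + (t - x)) with t in Hd' by ring. rewrite Rplus_0_r in Hd'.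
  apply Rlt_div_r in H2; [|exact Hq].
  assert (A := Rabs_triang (F t y - F x y - p * (t - x) - q * 0) (p * (t - x))).
  replace (F t y - F x y - p * (t - x) - q * 0 + p * (t - x)) with (F t y - F x y) in A by ring.
  rewrite (Rabs_mult p) in A. nra.
Qed.

Lemma Rdiff2_swap F x y p q : Rdiff2 F x y p q -> Rdiff2 (fun a b => F b a) y x q p.
Proof.
  intros H e He. destruct (H e He) as [d [Hd Hd']]. exists d; split; auto.
  intros h k Hh Hk. specialize (Hd' k h Hk Hh).
  replace (F (x + k) (y + h) - F x y - q * h - p * k)
    with (F (x + k) (y + h) - F x y - p * k - q * h) by ring.
  lra.
Qed.

(** The integral of P dx + Q dy along the boundary of the rectangle with lower
    left corner (x, y) and sides l and m, counterclockwise. *)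
Definition boundary_form (P Q : R -> R -> R) (x y l m : R) : R :=
  RInt (fun t => P t y) x (x + l) + RInt (fun s => Q (x + l) s) y (y + m)
  - RInt (fun t => P t (y + m)) x (x + l) - RInt (fun s => Q x s) y (y + m).

Lemma RInt_diff_le (f g : R -> R) (x l k B : R) : 0 < l ->
  ex_RInt f x (x + l) -> ex_RInt g x (x + l) ->
  (forall t, x <= t <= x + l -> Rabs (f t - g t - k) <= B) ->
  Rabs (RInt f x (x + l) - RInt g x (x + l) - k * l) <= l * B.
Proof.
  intros Hl Hf Hg H.
  assert (Hfg : ex_RInt (fun t => f t - g t) x (x + l)) by (now apply (ex_RInt_minus (V := R_NormedModule))).
  assert (E : RInt (fun t => f t - g t - k) x (x + l) = RInt f x (x + l) - RInt g x (x + l) - k * l).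
  { rewrite (RInt_minus (V := R_CompleteNormedModule) (fun t => f t - g t) (fun _ => k));
      [|exact Hfg|apply ex_RInt_const].
    rewrite (RInt_minus (V := R_CompleteNormedModule) f g); auto.
    rewrite RInt_const. unfold minus, plus, opp, scal; simpl; unfold mult; simpl. ring. }
  rewrite <- E.
  replace (l * B) with ((x + l - x) * B) by ring.
  apply abs_RInt_le_const; [lra| |exact H].
  apply (ex_RInt_minus (V := R_NormedModule) (fun t => f t - g t) (fun _ => k));
    [exact Hfg|apply ex_RInt_const].
Qed.

(** Closedness at each point is the equality k of the y-derivative of P and the
    x-derivative of Q. On a small box the form differs from its linear part,
    whose boundary integral is zero, by little compared with the size of the
    box; the boundary integral is then at most eps times the area, a bound
    which passes from four quarters to the whole. *)
Lemma Goursat (P Q : R -> R -> R) (a c L M : R) : 0 < L -> 0 < M ->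
  (forall x y, a <= x <= a + L -> c <= y <= c + M -> exists p q k,
     Rdiff2 P x y p k /\ Rdiff2 Q x y k q) ->
  boundary_form P Q a c L M = 0.
Proof.
  intros HL HM H.
  assert (IP : forall x l y, a <= x -> 0 <= l -> x + l <= a + L -> c <= y <= c + M ->
    ex_RInt (fun t => P t y) x (x + l)).
  { intros x l y Hx Hl Hxl Hy. apply (ex_RInt_continuous (V := R_CompleteNormedModule)).
    intros t. rewrite Rmin_left, Rmax_right by lra. intros Ht.
    destruct (H t y) as [p [q [k [H1 _]]]]; try lra. now apply (Rdiff2_cont1 _ _ _ p k). }
  assert (IQ : forall x y m, c <= y -> 0 <= m -> y + m <= c + M -> a <= x <= a + L ->
    ex_RInt (fun s => Q x s) y (y + m)).
  { intros x y m Hy Hm Hym Hx. apply (ex_RInt_continuous (V := R_CompleteNormedModule)).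
    intros s. rewrite Rmin_left, Rmax_right by lra. intros Hs.
    destruct (H x s) as [p [q [k [_ H1]]]]; try lra.
    now apply (Rdiff2_cont1 (fun s x => Q x s) _ _ q k), Rdiff2_swap. }
  assert (main : forall eps, 0 < eps -> Rabs (boundary_form P Q a c L M) <= eps * L * M).
  { intros eps He.
    apply (box_induction (fun x y l m => Rabs (boundary_form P Q x y l m) <= eps * l * m));
      auto.
    - intros x y l m Hl Hm Hx Hxl Hy Hym H1 H2 H3 H4.
      assert (E : boundary_form P Q x y l m =
        boundary_form P Q x y (l/2) (m/2) + boundary_form P Q (x + l/2) y (l/2) (m/2) +
        boundary_form P Q x (y + m/2) (l/2) (m/2) + boundary_form P Q (x + l/2) (y + m/2) (l/2) (m/2)).
      { unfold boundary_form.
        assert (CP : forall z, c <= z <= c + M -> RInt (fun t => P t z) x (x + l) =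
          RInt (fun t => P t z) x (x + l/2) + RInt (fun t => P t z) (x + l/2) (x + l/2 + l/2)).
        { intros z Hz. replace (x + l) with (x + l/2 + l/2) by lra.
          symmetry. apply (RInt_Chasles (V := R_CompleteNormedModule) (fun t => P t z)); apply IP; lra. }
        assert (CQ : forall z, a <= z <= a + L -> RInt (fun t => Q z t) y (y + m) =
          RInt (fun t => Q z t) y (y + m/2) + RInt (fun t => Q z t) (y + m/2) (y + m/2 + m/2)).
        { intros z Hz. replace (y + m) with (y + m/2 + m/2) by lra.
          symmetry. apply (RInt_Chasles (V := R_CompleteNormedModule) (fun t => Q z t)); apply IQ; lra. }
        rewrite (CP y), (CP (y + m)), (CQ x), (CQ (x + l)) by lra.
        replace (x + l/2 + l/2) with (x + l) by lra.
        replace (y + m/2 + m/2) with (y + m) by lra. ring. }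
      rewrite E.
      eapply Rle_trans; [apply Rabs_triang|].
      assert (A1 := Rabs_triang
        (boundary_form P Q x y (l/2) (m/2) + boundary_form P Q (x + l/2) y (l/2) (m/2))
        (boundary_form P Q x (y + m/2) (l/2) (m/2))).
      assert (A2 := Rabs_triang
        (boundary_form P Q x y (l/2) (m/2)) (boundary_form P Q (x + l/2) y (l/2) (m/2))).
      nra.
    - intros u v Hu Hv. destruct (H u v Hu Hv) as [p [q [k [HP HQ]]]].
      (* the error below is 2 eta (l + m)^2, and (l + m)^2 / (l m) is the same
         for all boxes considered *)
      set (eta := eps * L * M / (2 * (L + M) ^ 2)).
      assert (Hs : 0 < 2 * (L + M) ^ 2) by (assert (0 < L + M) by lra; nra).
      assert (Heta : 0 < eta).
      { apply Rdiv_lt_0_compat; [|exact Hs]. apply Rmult_lt_0_compat; nra. }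
      destruct (HP eta Heta) as [d1 [Hd1 H1]].
      destruct (HQ eta Heta) as [d2 [Hd2 H2]].
      exists (Rmin d1 d2). split; [now apply Rmin_pos|].
      intros x y n Hx Hxl Hy Hym Hxu Hyv Hl Hm.
      assert (Hp : 0 < 2 ^ n) by (apply pow_lt; lra).
      set (l := L / 2 ^ n) in *. set (m := M / 2 ^ n) in *.
      assert (Hl0 : 0 < l) by (apply Rdiv_lt_0_compat; auto).
      assert (Hm0 : 0 < m) by (apply Rdiv_lt_0_compat; auto).
      assert (M1 := Rmin_l d1 d2). assert (M2 := Rmin_r d1 d2).
      assert (EP : forall t s, x <= t <= x + l -> y <= s <= y + m ->
        Rabs (P t s - P u v - p * (t - u) - k * (s - v)) <= eta * (l + m)).
      { intros t s Ht Hs'.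
        assert (B1 : Rabs (t - u) <= l) by (apply Rabs_le_between; lra).
        assert (B2 : Rabs (s - v) <= m) by (apply Rabs_le_between; lra).
        specialize (H1 (t - u) (s - v)).
        replace (u + (t - u)) with t in H1 by ring. replace (v + (s - v)) with s in H1 by ring.
        eapply Rle_trans; [apply H1; lra|]. apply Rmult_le_compat_l; lra. }
      assert (EQ : forall t s, x <= t <= x + l -> y <= s <= y + m ->
        Rabs (Q t s - Q u v - k * (t - u) - q * (s - v)) <= eta * (l + m)).
      { intros t s Ht Hs'.
        assert (B1 : Rabs (t - u) <= l) by (apply Rabs_le_between; lra).
        assert (B2 : Rabs (s - v) <= m) by (apply Rabs_le_between; lra).
        specialize (H2 (t - u) (s - v)).
        replace (u + (t - u)) with t in H2 by ring. replace (v + (s - v)) with s in H2 by ring.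
        eapply Rle_trans; [apply H2; lra|]. apply Rmult_le_compat_l; lra. }
      assert (D1 := RInt_diff_le (fun t => P t y) (fun t => P t (y + m)) x l (- k * m)
        (2 * (eta * (l + m))) Hl0).
      assert (D2 := RInt_diff_le (fun s => Q (x + l) s) (fun s => Q x s) y m (k * l)
        (2 * (eta * (l + m))) Hm0).
      assert (D1' := D1 (IP x l y ltac:(lra) ltac:(lra) ltac:(lra) ltac:(lra))
         (IP x l (y + m) ltac:(lra) ltac:(lra) ltac:(lra) ltac:(lra))).
      assert (D2' := D2 (IQ (x+l) y m ltac:(lra) ltac:(lra) ltac:(lra) ltac:(lra))
         (IQ x y m ltac:(lra) ltac:(lra) ltac:(lra) ltac:(lra))).
      clear D1 D2.
      assert (D1 : Rabs (RInt (fun t => P t y) x (x + l) - RInt (fun t => P t (y + m)) x (x + l)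
        - - k * m * l) <= l * (2 * (eta * (l + m)))).
      { apply D1'. intros t Ht.
        assert (A1 := EP t y Ht ltac:(lra)). assert (A2 := EP t (y + m) Ht ltac:(lra)).
        apply Rabs_le_between in A1. apply Rabs_le_between in A2. apply Rabs_le_between. lra. }
      assert (D2 : Rabs (RInt (fun s => Q (x + l) s) y (y + m) - RInt (fun s => Q x s) y (y + m)
        - k * l * m) <= m * (2 * (eta * (l + m)))).
      { apply D2'. intros t Ht.
        assert (A1 := EQ (x + l) t ltac:(lra) Ht). assert (A2 := EQ x t ltac:(lra) Ht).
        apply Rabs_le_between in A1. apply Rabs_le_between in A2. apply Rabs_le_between. lra. }
      unfold boundary_form.
      apply Rabs_le_between in D1. apply Rabs_le_between in D2.
      assert (Ee : (l + m) * (2 * (eta * (l + m))) = eps * l * m).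
      { unfold eta, l, m. field. repeat split; lra. }
      apply Rabs_le_between. lra. }
  apply Rabs_eq_0.
  apply Rle_antisym; [|apply Rabs_pos].
  apply Rnot_lt_le. intros Hpos.
  assert (Hlm : 0 < L * M) by nra.
  specialize (main (Rabs (boundary_form P Q a c L M) / (2 * (L * M)))).
  assert (Hx : 0 < Rabs (boundary_form P Q a c L M) / (2 * (L * M))) by (apply Rdiv_lt_0_compat; lra).
  specialize (main Hx).
  replace (Rabs (boundary_form P Q a c L M) / (2 * (L * M)) * L * M)
    with (Rabs (boundary_form P Q a c L M) / 2) in main by (field; lra).
  lra.
Qed.

(** * The mean value property and the maximum principle *)

Definition polar (r t : R) : C := (r * cos t, r * sin t).

Definition on_circle (c : C) (r t : R) : C := (c + polar r t)%C.

Definition differentiable_at (f : C -> C) (z : C) : Prop := exists l, Cder f z l.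

Lemma Cmod_polar r t : 0 <= r -> Cmod (polar r t) = r.
Proof.
  intros Hr. unfold polar, Cmod; simpl fst; simpl snd.
  replace ((r * cos t) ^ 2 + (r * sin t) ^ 2) with (r ^ 2).
  - rewrite <- Rsqr_pow2. now apply sqrt_Rsqr.
  - assert (H := sin2_cos2 t). unfold Rsqr in H. nra.
Qed.

Lemma on_circle_dist c r t : 0 <= r -> Cmod (on_circle c r t - c) = r.
Proof.
  intros Hr. unfold on_circle.
  match goal with |- Cmod ?z = _ => replace z with (polar r t) by ring end.
  now apply Cmod_polar.
Qed.

Lemma Rdiff2_prod (f g : R -> R) x y f' g' :
  derivable_pt_lim f x f' -> derivable_pt_lim g y g' ->
  Rdiff2 (fun x y => f x * g y) x y (f' * g y) (f x * g').
Proof.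
  intros Hf Hg e He.
  set (K := Rabs (g y) + Rabs g' + 1 + Rabs (f x) + Rabs f' * (Rabs g' + 1)).
  assert (P1 := Rabs_pos (g y)). assert (P2 := Rabs_pos g').
  assert (P3 := Rabs_pos (f x)). assert (P4 := Rabs_pos f').
  assert (HK : 1 <= K) by (unfold K; nra).
  set (eta := Rmin 1 (e / K)).
  assert (Heta : 0 < eta) by (apply Rmin_pos; [lra|apply Rdiv_lt_0_compat; lra]).
  assert (Heta1 : eta <= 1) by apply Rmin_l.
  assert (HeK : eta * K <= e).
  { apply Rle_trans with (e / K * K); [|right; field; lra].
    apply Rmult_le_compat_r; [lra|apply Rmin_r]. }
  destruct (Hf eta Heta) as [d1 H1]. destruct (Hg eta Heta) as [d2 H2].
  exists (Rmin eta (Rmin d1 d2)). split.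
  { apply Rmin_pos; [exact Heta|apply Rmin_pos; apply cond_pos]. }
  intros h k Hh Hk.
  assert (Hh1 := Rlt_le_trans _ _ _ Hh (Rmin_r _ _)).
  assert (Hh2 := Rlt_le_trans _ _ _ Hh1 (Rmin_l _ _)).
  assert (Hk0 := Rlt_le_trans _ _ _ Hk (Rmin_l _ _)).
  assert (Hk1 := Rlt_le_trans _ _ _ Hk (Rmin_r _ _)).
  assert (Hk2 := Rlt_le_trans _ _ _ Hk1 (Rmin_r _ _)).
  assert (E1 : Rabs (f (x + h) - f x - f' * h) <= eta * Rabs h).
  { destruct (Req_dec h 0) as [->|n].
    - rewrite Rplus_0_r, Rabs_R0. replace (f x - f x - f' * 0) with 0 by ring.
      rewrite Rabs_R0; lra.
    - specialize (H1 h n Hh2).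
      replace (f (x + h) - f x - f' * h) with (((f (x + h) - f x) / h - f') * h) by (field; auto).
      rewrite Rabs_mult. apply Rmult_le_compat_r; [apply Rabs_pos|lra]. }
  assert (E2 : Rabs (g (y + k) - g y - g' * k) <= eta * Rabs k).
  { destruct (Req_dec k 0) as [->|n].
    - rewrite Rplus_0_r, Rabs_R0. replace (g y - g y - g' * 0) with 0 by ring.
      rewrite Rabs_R0; lra.
    - specialize (H2 k n Hk2).
      replace (g (y + k) - g y - g' * k) with (((g (y + k) - g y) / k - g') * k) by (field; auto).
      rewrite Rabs_mult. apply Rmult_le_compat_r; [apply Rabs_pos|lra]. }
  set (e1 := f (x + h) - f x - f' * h) in *.
  set (e2 := g (y + k) - g y - g' * k) in *.
  replace (f (x + h) * g (y + k) - f x * g y - f' * g y * h - f x * g' * k)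
    with (e1 * (g y + (g' * k + e2)) + (f x * e2 + f' * h * (g' * k + e2)))
    by (unfold e1, e2; ring).
  assert (Q1 := Rabs_pos h). assert (Q2 := Rabs_pos k).
  assert (E3 : Rabs (g' * k + e2) <= (Rabs g' + 1) * eta).
  { eapply Rle_trans; [apply Rabs_triang|]. rewrite Rabs_mult. nra. }
  assert (E4 : Rabs (g y + (g' * k + e2)) <= Rabs (g y) + Rabs g' + 1).
  { eapply Rle_trans; [apply Rabs_triang|]. nra. }
  eapply Rle_trans; [apply Rabs_triang|].
  eapply Rle_trans; [apply Rplus_le_compat_l, Rabs_triang|].
  rewrite !Rabs_mult.
  assert (F1 : Rabs e1 * Rabs (g y + (g' * k + e2)) <= eta * Rabs h * (Rabs (g y) + Rabs g' + 1)).
  { apply Rmult_le_compat; auto using Rabs_pos. }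
  assert (F2 : Rabs (f x) * Rabs e2 <= Rabs (f x) * (eta * Rabs k)).
  { apply Rmult_le_compat_l; auto. }
  assert (F3 : Rabs f' * Rabs h * Rabs (g' * k + e2) <= Rabs f' * Rabs h * ((Rabs g' + 1) * eta)).
  { apply Rmult_le_compat_l; auto. nra. }
  apply Rle_trans with (eta * K * (Rabs h + Rabs k)).
  2: apply Rmult_le_compat_r; lra.
  assert (G1 : eta * Rabs h * (Rabs (g y) + Rabs g' + 1) <= eta * (Rabs (g y) + Rabs g' + 1) * (Rabs h + Rabs k)).
  { assert (0 <= eta * (Rabs (g y) + Rabs g' + 1)) by nra. nra. }
  assert (G2 : Rabs (f x) * (eta * Rabs k) <= eta * Rabs (f x) * (Rabs h + Rabs k)).
  { assert (0 <= eta * Rabs (f x)) by nra. nra. }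
  assert (G3 : Rabs f' * Rabs h * ((Rabs g' + 1) * eta) <= eta * (Rabs f' * (Rabs g' + 1)) * (Rabs h + Rabs k)).
  { assert (0 <= eta * (Rabs f' * (Rabs g' + 1))) by (assert (0 <= Rabs f' * (Rabs g' + 1)) by nra; nra). nra. }
  unfold K. lra.
Qed.

(** Only real parts are followed; the imaginary part of f is the real part of
    - i f. *)
Lemma Rdiff2_comp_Re (f : C -> C) (X Y : R -> R -> R) x y (l : C) x1 x2 y1 y2 :
  Rdiff2 X x y x1 x2 -> Rdiff2 Y x y y1 y2 -> Cder f (X x y, Y x y) l ->
  Rdiff2 (fun a b => Re (f (X a b, Y a b))) x y (Re (l * (x1, y1))%C) (Re (l * (x2, y2))%C).
Proof.
  intros HX HY Hf e He.
  rewrite Cder_eps in Hf.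
  assert (Ll := Cmod_ge_0 l).
  set (K := Rabs x1 + Rabs x2 + Rabs y1 + Rabs y2 + 2).
  assert (HK : 2 <= K).
  { unfold K. assert (A1 := Rabs_pos x1). assert (A2 := Rabs_pos x2).
    assert (A3 := Rabs_pos y1). assert (A4 := Rabs_pos y2). lra. }
  set (eta := Rmin 1 (e / (4 * (Cmod l + 1)))).
  assert (Heta : 0 < eta) by (apply Rmin_pos; [lra|apply Rdiv_lt_0_compat; lra]).
  assert (Heta1 : eta <= 1) by apply Rmin_l.
  assert (Heta2 : eta * (Cmod l + 1) <= e / 4).
  { apply Rle_trans with (e / (4 * (Cmod l + 1)) * (Cmod l + 1)); [|right; field; lra].
    apply Rmult_le_compat_r; [lra|apply Rmin_r]. }
  destruct (Hf (e / (2 * K))) as [d0 [Hd0 H0]]; [apply Rdiv_lt_0_compat; lra|].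
  destruct (HX eta Heta) as [d1 [Hd1 H1]]. destruct (HY eta Heta) as [d2 [Hd2 H2]].
  exists (Rmin (d0 / (2 * K)) (Rmin d1 d2)). split.
  { repeat apply Rmin_pos; auto. apply Rdiv_lt_0_compat; lra. }
  intros h k Hh Hk.
  assert (Hh0 := Rlt_le_trans _ _ _ Hh (Rmin_l _ _)).
  assert (Hh' := Rlt_le_trans _ _ _ Hh (Rmin_r _ _)).
  assert (Hh1 := Rlt_le_trans _ _ _ Hh' (Rmin_l _ _)).
  assert (Hh2 := Rlt_le_trans _ _ _ Hh' (Rmin_r _ _)).
  assert (Hk0 := Rlt_le_trans _ _ _ Hk (Rmin_l _ _)).
  assert (Hk' := Rlt_le_trans _ _ _ Hk (Rmin_r _ _)).
  assert (Hk1 := Rlt_le_trans _ _ _ Hk' (Rmin_l _ _)).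
  assert (Hk2 := Rlt_le_trans _ _ _ Hk' (Rmin_r _ _)).
  specialize (H1 h k Hh1 Hk1). specialize (H2 h k Hh2 Hk2).
  set (ex := X (x + h) (y + k) - X x y - x1 * h - x2 * k) in *.
  set (ey := Y (x + h) (y + k) - Y x y - y1 * h - y2 * k) in *.
  assert (Q1 := Rabs_pos h). assert (Q2 := Rabs_pos k).
  set (s := Rabs h + Rabs k) in *.
  assert (Hs : 0 <= s) by (unfold s; lra).
  set (w := (X (x + h) (y + k), Y (x + h) (y + k)) : C).
  set (z := (X x y, Y x y) : C) in *.
  assert (Ew : (w - z = (x1, y1) * RtoC h + (x2, y2) * RtoC k + (ex, ey))%C).
  { apply Ceq_ReIm; unfold w, z, ex, ey, Re, Im; simpl; ring. }
  assert (Bx : Rabs (x1 * h + x2 * k) <= (Rabs x1 + Rabs x2) * s).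
  { eapply Rle_trans; [apply Rabs_triang|]. rewrite !Rabs_mult. unfold s.
    assert (A1 := Rabs_pos x1). assert (A2 := Rabs_pos x2). nra. }
  assert (By : Rabs (y1 * h + y2 * k) <= (Rabs y1 + Rabs y2) * s).
  { eapply Rle_trans; [apply Rabs_triang|]. rewrite !Rabs_mult. unfold s.
    assert (A1 := Rabs_pos y1). assert (A2 := Rabs_pos y2). nra. }
  assert (Bw : Cmod (w - z) <= K * s).
  { eapply Rle_trans; [apply Cmod_le_ReIm|].
    replace (Re (w - z)%C) with ((x1 * h + x2 * k) + ex) by (unfold ex, w, z, Re; simpl; ring).
    replace (Im (w - z)%C) with ((y1 * h + y2 * k) + ey) by (unfold ey, w, z, Im; simpl; ring).
    assert (T1 := Rabs_triang (x1 * h + x2 * k) ex).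
    assert (T2 := Rabs_triang (y1 * h + y2 * k) ey).
    unfold K. nra. }
  assert (Bd : Cmod (w - z) < d0).
  { eapply Rle_lt_trans; [exact Bw|].
    assert (s < d0 / K).
    { unfold s. replace (d0 / K) with (d0 / (2 * K) + d0 / (2 * K)) by (field; lra). lra. }
    replace d0 with (K * (d0 / K)) by (field; lra). apply Rmult_lt_compat_l; lra. }
  specialize (H0 w Bd).
  assert (Ee : Cmod (l * (ex, ey)) <= e / 2 * s).
  { rewrite Cmod_mult.
    assert (Cmod (ex, ey) <= 2 * (eta * s)).
    { eapply Rle_trans; [apply Cmod_le_ReIm|]. unfold Re, Im; simpl. lra. }
    assert (Cmod l * Cmod (ex, ey) <= Cmod l * (2 * (eta * s))) by (apply Rmult_le_compat_l; auto).
    nra. }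
  assert (Ef : Cmod (f w - f z - l * (w - z)) <= e / 2 * s).
  { eapply Rle_trans; [exact H0|].
    apply Rle_trans with (e / (2 * K) * (K * s)).
    - apply Rmult_le_compat_l; [left; apply Rdiv_lt_0_compat; lra|exact Bw].
    - right; field; lra. }
  assert (EE : Re (f w) - Re (f z) - Re (l * (x1, y1))%C * h - Re (l * (x2, y2))%C * k
     = Re (f w - f z - l * (w - z))%C + Re (l * (ex, ey))%C).
  { rewrite Ew. unfold Re; simpl. ring. }
  fold w z. rewrite EE.
  eapply Rle_trans; [apply Rabs_triang|].
  assert (T1 := re_le_Cmod (f w - f z - l * (w - z))).
  assert (T2 := re_le_Cmod (l * (ex, ey))).
  lra.
Qed.

Lemma Cder_shift f c z l : Cder f (c + z) l -> Cder (fun w => f (c + w)%C) z l.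
Proof.
  intros H. replace l with (l * 1)%C by ring.
  apply (Cder_comp (fun w => c + w)%C f); [|exact H].
  replace (RtoC 1) with (0 + 1)%C by ring. apply Cder_plus; [apply Cder_const|apply Cder_id].
Qed.

(** In the coordinates c + exp (a + i b) the two partial derivatives are
    l E and i l E: the Cauchy-Riemann equations. *)
Lemma polar_Rdiff2 f c rho th l : Cder f (on_circle c (exp rho) th) l ->
  let E := polar (exp rho) th in
  Rdiff2 (fun a b => Re (f (on_circle c (exp a) b))) rho th (Re (l * E)%C) (Re (l * (Ci * E))%C).
Proof.
  intros H E.
  assert (D := Rdiff2_comp_Re (fun w => f (c + w)%C)
    (fun a b => exp a * cos b) (fun a b => exp a * sin b) rho th l
    (exp rho * cos th) (exp rho * (- sin th)) (exp rho * sin th) (exp rho * cos th)).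
  assert (E1 : (l * (Ci * E))%C = (l * ((exp rho * - sin th)%R, (exp rho * cos th)%R))%C).
  { f_equal. apply Ceq_ReIm; unfold E, polar, Re, Im; simpl; ring. }
  rewrite E1. apply D.
  - apply Rdiff2_prod; [apply derivable_pt_lim_exp|apply derivable_pt_lim_cos].
  - apply Rdiff2_prod; [apply derivable_pt_lim_exp|apply derivable_pt_lim_sin].
  - apply Cder_shift. exact H.
Qed.

Lemma circle_continuous f c r t : 0 < r -> differentiable_at f (on_circle c r t) ->
  continuous (fun t => Re (f (on_circle c r t))) t.
Proof.
  intros Hr [l Hl].
  rewrite <- (exp_ln r Hr) in Hl. apply polar_Rdiff2, Rdiff2_swap, Rdiff2_cont1 in Hl.
  rewrite exp_ln in Hl by exact Hr. exact Hl.
Qed.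

Lemma circle_integrable f c r : 0 < r ->
  (forall t, differentiable_at f (on_circle c r t)) ->
  forall a b, ex_RInt (fun t => Re (f (on_circle c r t))) a b.
Proof.
  intros Hr H a b. apply (ex_RInt_continuous (V := R_CompleteNormedModule)).
  intros t _. now apply circle_continuous.
Qed.

(** Goursat for the form v da + u db, where f = u + i v, on the rectangle
    between ln r1 and ln r2: the sides b = 0 and b = 2 pi cancel by
    periodicity, and the other two are the circular means. *)
Lemma circle_means_equal f c R0 r1 r2 : 0 < r1 -> r1 < r2 -> r2 < R0 ->
  (forall w, 0 < Cmod (w - c) < R0 -> differentiable_at f w) ->
  RInt (fun t => Re (f (on_circle c r1 t))) 0 (2 * PI) =
  RInt (fun t => Re (f (on_circle c r2 t))) 0 (2 * PI).
Proof.
  intros H1 H12 H2 Hf.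
  assert (HPI := PI_RGT_0).
  set (u := fun a b => Re (f (on_circle c (exp a) b))).
  set (v := fun a b => Re (- Ci * f (on_circle c (exp a) b))%C).
  assert (Hln : ln r1 < ln r2) by (apply ln_increasing; lra).
  assert (G : boundary_form v u (ln r1) 0 (ln r2 - ln r1) (2 * PI) = 0).
  { apply Goursat; try lra. intros a b Ha Hb.
    destruct (Hf (on_circle c (exp a) b)) as [l Hl].
    { rewrite on_circle_dist by (left; apply exp_pos). split; [apply exp_pos|].
      apply Rle_lt_trans with r2; [|lra].
      rewrite <- (exp_ln r2) by lra. destruct (Req_dec a (ln r2)) as [->|n]; [lra|].
      left. apply exp_increasing. lra. }
    set (E := polar (exp a) b).
    exists (Re (- Ci * l * E)%C), (Re (l * (Ci * E))%C), (Re (l * E)%C).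
    split.
    - replace (Re (l * E)%C) with (Re (- Ci * l * (Ci * E))%C)
        by (unfold Re; simpl; ring).
      apply (polar_Rdiff2 (fun w => - Ci * f w)%C). now apply Cder_scal.
    - apply polar_Rdiff2. exact Hl. }
  unfold boundary_form in G.
  replace (ln r1 + (ln r2 - ln r1)) with (ln r2) in G by ring.
  rewrite Rplus_0_l in G.
  assert (Ev : forall t, v t (2 * PI) = v t 0).
  { intros t. unfold v, on_circle, polar. now rewrite cos_2PI, sin_2PI, cos_0, sin_0. }
  rewrite (RInt_ext (fun t => v t (2 * PI)) (fun t => v t 0)) in G by (intros; apply Ev).
  unfold u in G. rewrite !exp_ln in G by lra.
  lra.
Qed.

(** The circle is shrunk to its centre, where continuity suffices. This lets
    the mean value property apply to difference quotients at their base point. *)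
Lemma mean_value f c R0 r : 0 < r -> r < R0 -> Ccont f c ->
  (forall w, 0 < Cmod (w - c) < R0 -> differentiable_at f w) ->
  RInt (fun t => Re (f (on_circle c r t))) 0 (2 * PI) = 2 * PI * Re (f c).
Proof.
  intros Hr HrR Hc Hf.
  assert (HPI := PI_RGT_0).
  apply cond_eq. intros e He.
  destruct (Hc (e / (4 * PI))) as [d [Hd H]]; [apply Rdiv_lt_0_compat; lra|].
  set (r1 := Rmin r d / 2).
  assert (M := Rmin_pos _ _ Hr Hd). assert (M1 := Rmin_l r d). assert (M2 := Rmin_r r d).
  assert (Hr1 : 0 < r1) by (unfold r1; lra).
  rewrite <- (circle_means_equal f c R0 r1 r); auto; [|unfold r1; lra].
  assert (D := RInt_diff_le (fun t => Re (f (on_circle c r1 t))) (fun _ => Re (f c)) 0 (2 * PI) 0 (e / (4 * PI)) ltac:(lra)).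
  rewrite Rplus_0_l in D.
  rewrite RInt_const in D. unfold scal in D; simpl in D; unfold mult in D; simpl in D.
  rewrite Rmult_0_l, Rminus_0_r in D. rewrite Rminus_0_r in D.
  eapply Rle_lt_trans; [apply D|].
  - apply circle_integrable; auto. intros t. apply Hf.
    rewrite on_circle_dist by lra. unfold r1; lra.
  - apply ex_RInt_const.
  - intros t _. rewrite Rminus_0_r.
    replace (Re (f (on_circle c r1 t)) - Re (f c)) with (Re (f (on_circle c r1 t) - f c)%C)
      by (unfold Re; simpl; ring).
    eapply Rle_trans; [apply re_le_Cmod|]. left. apply H.
    rewrite on_circle_dist by lra. unfold r1; lra.
  - replace (2 * PI * (e / (4 * PI))) with (e / 2) by (field; lra). lra.
Qed.

(** A peak with a definite gap eta on a single circle already contradicts the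
    mean value property, without any discussion of equality. *)
Lemma no_strict_peak f c R0 r eta : 0 < r -> r < R0 -> 0 < eta -> Ccont f c ->
  (forall w, 0 < Cmod (w - c) < R0 -> differentiable_at f w) ->
  ~ (forall w, Cmod (w - c) = r -> Re (f w) <= Re (f c) - eta).
Proof.
  intros Hr HrR He Hc Hf H.
  assert (HPI := PI_RGT_0).
  assert (M := mean_value f c R0 r Hr HrR Hc Hf).
  assert (L : RInt (fun t => Re (f (on_circle c r t))) 0 (2 * PI)
     <= RInt (fun _ => Re (f c) - eta) 0 (2 * PI)).
  { apply RInt_le; [lra| |apply ex_RInt_const|].
    - apply circle_integrable; auto. intros t. apply Hf. rewrite on_circle_dist; lra.
    - intros t _. apply H. apply on_circle_dist; lra. }
  rewrite M, RInt_const in L. unfold scal in L; simpl in L; unfold mult in L; simpl in L.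
  nra.
Qed.

Lemma Ccont_Re_lt F w M : Ccont F w -> Re (F w) < M ->
  exists del, 0 < del /\ forall w', Cmod (w' - w) < del -> Re (F w') < M.
Proof.
  intros H HM. destruct (H (M - Re (F w))) as [d [Hd Hd']]; [lra|].
  exists d; split; auto. intros w' Hw'. specialize (Hd' w' Hw').
  assert (A := re_le_Cmod (F w' - F w)).
  replace (Re (F w' - F w)%C) with (Re (F w') - Re (F w)) in A by (unfold Re; simpl; ring).
  assert (B := Rle_abs (Re (F w') - Re (F w))). lra.
Qed.

(** The function psi = |Phi|^2 + eps |w|^2 attains its maximum at some c. Now
    |Phi|^2 and |w|^2 are bounded below by their linearizations at c, for |w|^2
    with a gain of r^2 on the circle of radius r, so that the real part of the
    holomorphic function F below would have a strict peak at c. Boundary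
    values enter through the two conditions on the sets where |Phi| >= m, which
    make these sets compact. *)
Lemma maximum_modulus (U : C -> Prop) (Phi : C -> C) (M0 : R) : 0 <= M0 ->
  (forall c, U c -> Ccont Phi c /\ exists R0, 0 < R0 /\
     (forall w, Cmod (w - c) < R0 -> U w) /\
     forall w, 0 < Cmod (w - c) < R0 -> differentiable_at Phi w) ->
  (forall m, M0 < m -> exists B, forall w, U w -> m <= Cmod (Phi w) -> Cmod w <= B) ->
  (forall m w, M0 < m -> ~ (U w /\ m <= Cmod (Phi w)) -> exists del, 0 < del /\
     forall w', Cmod (w' - w) < del -> ~ (U w' /\ m <= Cmod (Phi w'))) ->
  forall w, U w -> Cmod (Phi w) <= M0.
Proof.
  intros HM0 Hhol Hbd Hcl w1 Hw1. apply Rnot_lt_le. intros HM1.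
  set (M1 := Cmod (Phi w1)) in *.
  set (m := (M0 + M1) / 2). assert (Hm : M0 < m < M1) by (unfold m; lra).
  destruct (Hbd m) as [B0 HB0]; [lra|].
  assert (HB00 : 0 <= B0).
  { eapply Rle_trans; [apply Cmod_ge_0|]. apply (HB0 w1 Hw1). fold M1; lra. }
  set (eps := (M1 ^ 2 - m ^ 2) / (2 * (B0 + 1) ^ 2)).
  assert (Hb2 : 0 < (B0 + 1) ^ 2) by nra.
  assert (Heps : 0 < eps) by (apply Rdiv_lt_0_compat; nra).
  assert (Heps2 : eps * (B0 + 1) ^ 2 = (M1 ^ 2 - m ^ 2) / 2) by (unfold eps; field; lra).
  set (S := fun w => U w /\ m <= Cmod (Phi w)).
  set (psi := fun w => Cmod (Phi w) ^ 2 + eps * Cmod w ^ 2).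
  destruct (usc_attains_max S psi B0) as [c [Hc Hmax]].
  - exists w1. split; auto. fold M1; lra.
  - intros w [h1 h2]. now apply HB0.
  - intros w Hw. apply Hcl; [lra|exact Hw].
  - intros w M [h1 h2] HM.
    destruct (Ccont_Re_lt (fun w => Phi w * Cconj (Phi w) + RtoC eps * (w * Cconj w))%C w M)
      as [d [Hd Hd']].
    + destruct (Hhol w h1) as [hc _]. apply Ccont_plus.
      * apply Ccont_mult; auto. apply (Ccont_comp Phi Cconj); auto using Ccont_conj.
      * apply Ccont_mult; [apply Ccont_const|]. apply Ccont_mult; [apply Ccont_id|apply Ccont_conj].
    + rewrite <- !Cmod2_conj. rewrite <- RtoC_mult, <- RtoC_plus. exact HM.
    + exists d; split; auto. intros w' _ Hw'. specialize (Hd' w' Hw').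
      cbv beta in Hd'. rewrite <- !Cmod2_conj, <- RtoC_mult, <- RtoC_plus in Hd'. exact Hd'.
  - destruct Hc as [Uc Hcm]. destruct (Hhol c Uc) as [Cc [R0 [HR0 [HRU HRd]]]].
    assert (Hcb := HB0 c Uc Hcm). assert (Hc0 := Cmod_ge_0 c).
    assert (P1 : M1 ^ 2 <= psi c).
    { apply Rle_trans with (psi w1).
      - unfold psi. fold M1. assert (0 <= Cmod w1 ^ 2) by (apply pow2_ge_0). nra.
      - apply Hmax. split; auto. fold M1; lra. }
    (* the radius is at most 1 so that the circle stays where |w| <= B0 + 1,
       which is what eps was chosen for *)
    set (r := Rmin R0 1 / 2).
    assert (Hr := Rmin_pos R0 1 HR0 ltac:(lra)). assert (Hr1 := Rmin_l R0 1). assert (Hr2 := Rmin_r R0 1).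
    set (F := fun w => (2 * Cconj (Phi c) * Phi w + 2 * RtoC eps * Cconj c * w)%C).
    apply (no_strict_peak F c R0 r (eps * r ^ 2)); try (unfold r; lra).
    + apply Rmult_lt_0_compat; [exact Heps|]. apply pow_lt. unfold r; lra.
    + unfold F. apply Ccont_plus.
      * apply Ccont_mult; [apply Ccont_const|exact Cc].
      * apply Ccont_mult; [apply Ccont_const|apply Ccont_id].
    + intros w Hw. destruct (HRd w Hw) as [l Hl].
      exists (2 * Cconj (Phi c) * l + 2 * RtoC eps * Cconj c * 1)%C.
      apply Cder_plus; [now apply Cder_scal|apply Cder_scal, Cder_id].
    + intros w Hw.
      assert (Uw : U w) by (apply HRU; rewrite Hw; unfold r; lra).
      assert (Hwc : Cmod w <= B0 + 1).
      { assert (A := Cmod_tri_inv w c). rewrite Hw in A. unfold r in A. lra. }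
      assert (Hw0 := Cmod_ge_0 w).
      assert (P2 : psi w <= psi c).
      { destruct (Rle_dec m (Cmod (Phi w))) as [h|h].
        - apply Hmax. split; auto.
        - eapply Rle_trans; [|exact P1]. unfold psi.
          assert (A1 := Cmod_ge_0 (Phi w)).
          assert (Cmod (Phi w) ^ 2 <= m ^ 2) by nra.
          assert (Cmod w ^ 2 <= (B0 + 1) ^ 2) by nra.
          assert (eps * Cmod w ^ 2 <= eps * (B0 + 1) ^ 2) by (apply Rmult_le_compat_l; lra).
          assert (m ^ 2 < M1 ^ 2) by nra.
          lra. }
      unfold psi in P2. rewrite !Cmod2_alt in P2.
      assert (Hw2 : (Re w - Re c) ^ 2 + (Im w - Im c) ^ 2 = r ^ 2).
      { rewrite <- Hw, Cmod2_alt. unfold Re, Im; simpl; ring. }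
      unfold F. unfold Re, Im in *. simpl in *.
      set (a := fst (Phi w)) in *. set (b := snd (Phi w)) in *.
      set (a' := fst (Phi c)) in *. set (b' := snd (Phi c)) in *.
      assert (S1 := pow2_ge_0 (a - a')). assert (S2 := pow2_ge_0 (b - b')).
      assert (E := f_equal (fun t => eps * t) Hw2). simpl in E. nra.
Qed.

(** * Injective holomorphic maps *)

Definition holo (U : C -> Prop) (f : C -> C) : Prop := forall w, U w -> differentiable_at f w.

Definition Copen (U : C -> Prop) : Prop :=
  forall c, U c -> exists r, 0 < r /\ forall w, Cmod (w - c) < r -> U w.

Lemma Cder_C_derive f z : differentiable_at f z -> Cder f z (C_derive f z).
Proof.
  intros [l H]. rewrite (is_C_derive_unique f z l); [exact H|]. now apply is_derive_Cder.
Qed.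

Lemma C_derive_unique f z l : Cder f z l -> C_derive f z = l.
Proof. intros H. apply is_C_derive_unique. now apply is_derive_Cder. Qed.

Lemma differentiable_cont f z : differentiable_at f z -> Ccont f z.
Proof. intros [l H]. now apply (Cder_cont f z l). Qed.

Lemma Ccont_Cmod_lt F w M : Ccont F w -> Cmod (F w) < M ->
  exists del, 0 < del /\ forall w', Cmod (w' - w) < del -> Cmod (F w') < M.
Proof.
  intros H HM. destruct (H (M - Cmod (F w))) as [d [Hd Hd']]; [lra|].
  exists d; split; auto. intros w' Hw'. specialize (Hd' w' Hw').
  assert (A := Cmod_tri_inv (F w') (F w)). lra.
Qed.

Lemma max_disc (Phi : C -> C) (p : C) (r M0 : R) : 0 <= M0 ->
  (forall w, Cmod (w - p) <= r -> Ccont Phi w) ->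
  (forall c, Cmod (c - p) < r -> exists R0, 0 < R0 /\
     forall w, 0 < Cmod (w - c) < R0 -> differentiable_at Phi w) ->
  (forall w, Cmod (w - p) = r -> Cmod (Phi w) <= M0) ->
  forall w, Cmod (w - p) < r -> Cmod (Phi w) <= M0.
Proof.
  intros HM Hc Hd Hb.
  apply (maximum_modulus (fun w => Cmod (w - p) < r)); auto.
  - intros c Hcr. split; [apply Hc; lra|].
    destruct (Hd c Hcr) as [R0 [HR0 HRd]].
    exists (Rmin R0 (r - Cmod (c - p))). split; [apply Rmin_pos; lra|]. split.
    + intros w Hw. assert (Hw' := Rlt_le_trans _ _ _ Hw (Rmin_r _ _)).
      assert (T := Cmod_tri3 w c p). lra.
    + intros w [h1 h2]. apply HRd. split; auto. eapply Rlt_le_trans; [exact h2|apply Rmin_l].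
  - intros m _. exists (r + Cmod p). intros w Hw _.
    assert (T := Cmod_tri_inv w p). lra.
  - intros m w Hm HS. destruct (Rlt_le_dec r (Cmod (w - p))) as [h|h].
    + exists (Cmod (w - p) - r). split; [lra|]. intros w' Hw' [h1 _].
      assert (T := Cmod_tri3 w w' p). rewrite (Cmod_sub_sym w w') in T. lra.
    + assert (Hlt : Cmod (Phi w) < m).
      { destruct (Rle_lt_or_eq_dec _ _ h) as [h'|h'].
        - apply Rnot_le_lt. intros h2. apply HS; auto.
        - specialize (Hb w h'). lra. }
      destruct (Ccont_Cmod_lt Phi w m (Hc w h) Hlt) as [d [Hd0 Hd']].
      exists d; split; auto. intros w' Hw' [_ h2]. specialize (Hd' w' Hw'). lra.
Qed.

Lemma circle_min (F : C -> C) (p : C) (r : R) : 0 < r ->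
  (forall w, Cmod (w - p) = r -> Ccont F w /\ F w <> 0%C) ->
  exists m, 0 < m /\ forall w, Cmod (w - p) = r -> m <= Cmod (F w).
Proof.
  intros Hr HF.
  destruct (usc_attains_max (fun w => Cmod (w - p) = r) (fun w => - Cmod (F w)) (r + Cmod p))
    as [c [Hc Hmax]].
  - exists (p + RtoC r)%C. replace (p + RtoC r - p)%C with (RtoC r) by ring.
    rewrite Cmod_R. apply Rabs_pos_eq; lra.
  - intros w Hw. assert (T := Cmod_tri_inv w p). lra.
  - intros w Hw. exists (Rabs (Cmod (w - p) - r)). split.
    + apply Rabs_pos_lt. lra.
    + intros w' Hw' E. assert (T := Cmod_tri3 w w' p). assert (T' := Cmod_tri3 w' w p).
      rewrite (Cmod_sub_sym w w') in T. rewrite E in *.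
      apply Rlt_not_le in Hw'. apply Hw'. apply Rabs_le_between. lra.
  - intros w M Hw HM. destruct (HF w Hw) as [Hcw _].
    destruct (Hcw (M + Cmod (F w))) as [d [Hd Hd']]; [lra|].
    exists d; split; auto. intros w' _ Hw'. specialize (Hd' w' Hw').
    assert (T := Cmod_tri_inv (F w) (F w')). rewrite Cmod_sub_sym in T. lra.
  - exists (Cmod (F c)). split; [apply Cmod_gt_0; now apply HF|].
    intros w Hw. specialize (Hmax w Hw). lra.
Qed.

Lemma Ccont_sub_const F q w : Ccont F w -> Ccont (fun z => F z - q)%C w.
Proof. intros H. apply (Ccont_plus F (fun _ => - q)%C); [exact H|apply Ccont_const]. Qed.

Lemma Cder_sub_const F q w l : Cder F w l -> Cder (fun z => F z - q)%C w l.
Proof.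
  intros H. replace l with (l + 0)%C by ring.
  apply (Cder_plus F (fun _ => - q)%C); [exact H|apply Cder_const].
Qed.

(** If g omitted a value q close to g (p) near p, then 1 / (g - q) would be
    larger at p than on a small circle around p, where injectivity keeps g away
    from g (p). *)
Lemma open_image U g p r : Copen U -> holo U g -> injective_on U g -> U p -> 0 < r ->
  exists del, 0 < del /\ forall q, Cmod (q - g p) < del ->
    exists w, U w /\ Cmod (w - p) < r /\ g w = q.
Proof.
  intros HU Hg Hi Hp Hr.
  destruct (HU p Hp) as [r0 [Hr0 Hball]].
  set (s := Rmin r r0 / 2).
  assert (M := Rmin_pos _ _ Hr Hr0). assert (M1 := Rmin_l r r0). assert (M2 := Rmin_r r r0).
  assert (Hs : 0 < s) by (unfold s; lra).
  assert (HsU : forall w, Cmod (w - p) <= s -> U w) by (intros; apply Hball; unfold s in *; lra).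
  destruct (circle_min (fun w => g w - g p)%C p s Hs) as [m [Hm Hmin]].
  { intros w Hw. assert (Uw : U w) by (apply HsU; lra). split.
    - apply Ccont_sub_const. now apply differentiable_cont, Hg.
    - intros E. apply Ceq_minus in E. apply Hi in E; auto. subst w.
      rewrite Cmod_sub_diag in Hw. lra. }
  exists (m / 2). split; [lra|]. intros q Hq. apply NNPP. intros N.
  assert (Hnq : forall w, Cmod (w - p) <= s -> (g w - q)%C <> 0%C).
  { intros w Hw E. apply Ceq_minus in E. apply N. exists w. repeat split; auto. unfold s in Hw; lra. }
  assert (Hd : forall w, Cmod (w - p) <= s -> differentiable_at (fun w => / (g w - q))%C w).
  { intros w Hw. destruct (Hg w (HsU w Hw)) as [l Hl]. eexists. apply Cder_inv.
    - apply Cder_sub_const. exact Hl.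
    - now apply Hnq. }
  assert (P : Cmod (/ (g p - q)) <= / (m / 2)).
  { apply (max_disc (fun w => / (g w - q))%C p s).
    - left. apply Rinv_0_lt_compat. lra.
    - intros w Hw. now apply differentiable_cont, Hd.
    - intros c Hc. exists (s - Cmod (c - p)). split; [lra|]. intros w Hw. apply Hd.
      assert (T := Cmod_tri3 w c p). lra.
    - intros w Hw. rewrite Cmod_inv by (apply Hnq; lra).
      apply Rinv_le_contravar; [lra|]. specialize (Hmin w Hw).
      assert (T := Cmod_tri3 (g w) q (g p)). lra.
    - rewrite Cmod_sub_diag. exact Hs. }
  assert (Hp0 : (g p - q)%C <> 0%C) by (apply Hnq; rewrite Cmod_sub_diag; lra).
  rewrite Cmod_inv in P by exact Hp0.
  rewrite Cmod_sub_sym in Hq.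
  assert (0 < Cmod (g p - q)) by now apply Cmod_gt_0.
  assert (Q := Rinv_lt_contravar (Cmod (g p - q)) (m / 2) ltac:(nra) Hq). lra.
Qed.

(** The mean value theorem for a real-linear functional of f; the choice of k
    selects real or imaginary parts, or divides by b - a. *)
Lemma segment_mvt f a b k :
  (forall t, 0 <= t <= 1 -> differentiable_at f (a + RtoC t * (b - a))%C) ->
  exists t, 0 < t < 1 /\
    Re (k * (f b - f a))%C = Re (k * C_derive f (a + RtoC t * (b - a)) * (b - a))%C.
Proof.
  intros H.
  set (z := fun t => (a + RtoC t * (b - a))%C).
  destruct (MVT_cor2 (fun t => Re (k * f (z t))%C)
    (fun t => Re (k * C_derive f (z t) * (b - a))%C) 0 1 ltac:(lra)) as [t [E Ht]].
  - intros t Ht e He.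
    assert (D := Cder_C_derive _ _ (H t Ht)). fold (z t) in D.
    set (l := C_derive f (z t)) in *.
    rewrite Cder_eps in D.
    set (N := Cmod k * Cmod (b - a) + 1).
    assert (N1 := Cmod_ge_0 k). assert (N2 := Cmod_ge_0 (b - a)).
    assert (HN : 1 <= N) by (unfold N; nra).
    destruct (D (e / (2 * N))) as [d [Hd Hd']]; [apply Rdiv_lt_0_compat; lra|].
    assert (Hd2 : 0 < d / (Cmod (b - a) + 1)) by (apply Rdiv_lt_0_compat; lra).
    exists (mkposreal _ Hd2). intros h Hh0 Hh. simpl in Hh.
    assert (Ez : (z (t + h)%R - z t = RtoC h * (b - a))%C).
    { unfold z. rewrite RtoC_plus. ring. }
    assert (Hzd : Cmod (z (t + h)%R - z t) < d).
    { rewrite Ez, Cmod_mult, Cmod_R. apply Rlt_div_r in Hh; [|lra].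
      assert (A := Rabs_pos h). nra. }
    specialize (Hd' _ Hzd).
    assert (Hh1 : 0 < Rabs h) by now apply Rabs_pos_lt.
    replace ((Re (k * f (z (t + h)%R)) - Re (k * f (z t))) / h - Re (k * l * (b - a)))
      with (Re (k * (f (z (t + h)%R) - f (z t) - l * (z (t + h)%R - z t)))%C / h).
    2:{ rewrite Ez. unfold Re; simpl. field. exact Hh0. }
    rewrite Rabs_div by exact Hh0. apply Rlt_div_l; [exact Hh1|].
    eapply Rle_lt_trans; [apply re_le_Cmod|]. rewrite Cmod_mult.
    rewrite Ez, Cmod_mult, Cmod_R in Hd'. rewrite Ez.
    apply Rle_lt_trans with (Cmod k * (e / (2 * N) * (Rabs h * Cmod (b - a)))).
    { apply Rmult_le_compat_l; auto. }
    replace (Cmod k * (e / (2 * N) * (Rabs h * Cmod (b - a))))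
      with ((Cmod k * Cmod (b - a)) * (e / (2 * N)) * Rabs h) by ring.
    apply Rmult_lt_compat_r; [exact Hh1|].
    apply Rle_lt_trans with (N * (e / (2 * N))).
    + apply Rmult_le_compat_r; [left; apply Rdiv_lt_0_compat; lra|unfold N; lra].
    + replace (N * (e / (2 * N))) with (e / 2) by (field; lra). lra.
  - exists t. split; [exact Ht|].
    fold (z t). rewrite Rminus_0_r, Rmult_1_r in E. rewrite <- E.
    replace (z 1) with b by (unfold z; ring).
    replace (z 0) with a by (unfold z; ring).
    unfold Re; simpl; ring.
Qed.

Lemma constant_of_zero_derivative f p r :
  (forall w, Cmod (w - p) < r -> Cder f w 0) ->
  forall w, Cmod (w - p) < r -> f w = f p.
Proof.
  intros H w Hw.
  assert (Hseg : forall t, 0 <= t <= 1 -> Cmod (p + RtoC t * (w - p) - p) < r).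
  { intros t Ht. replace (p + RtoC t * (w - p) - p)%C with (RtoC t * (w - p))%C by ring.
    rewrite Cmod_mult, Cmod_R, Rabs_pos_eq by lra.
    assert (A := Cmod_ge_0 (w - p)). nra. }
  assert (K : forall k, Re (k * (f w - f p))%C = 0).
  { intros k. destruct (segment_mvt f p w k) as [t [Ht E]].
    - intros t Ht. exists 0%C. now apply H, Hseg.
    - rewrite E, (C_derive_unique _ _ _ (H _ (Hseg t ltac:(lra)))).
      unfold Re; simpl; ring. }
  assert (K1 := K 1%C). assert (K2 := K Ci).
  apply Ceq_ReIm; unfold Re, Im in *; simpl in *; lra.
Qed.

(** Suppose g' (p) = 0. For z near p with g' (z) <> 0 the quotient
    (w - z) / (g w - g z) is continuous and holomorphic in w off z, so the
    maximum principle bounds it at w = p by its values on a fixed circle,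
    uniformly in z. But at w = p it is large when z is close to p. Hence g'
    vanishes near p and g is constant there, against injectivity. *)
Lemma injective_derivative_nonzero U g p : Copen U -> holo U g -> injective_on U g -> U p ->
  C_derive g p <> 0%C.
Proof.
  intros HU Hg Hi Hp E0.
  assert (D0 := Cder_C_derive _ _ (Hg p Hp)). rewrite E0 in D0.
  destruct (HU p Hp) as [r0 [Hr0 Hball]].
  set (s := r0 / 2).
  assert (Hs : 0 < s) by (unfold s; lra).
  assert (HsU : forall w, Cmod (w - p) <= s -> U w) by (intros; apply Hball; unfold s in *; lra).
  destruct (circle_min (fun w => g w - g p)%C p s Hs) as [m [Hm Hmin]].
  { intros w Hw. assert (Uw : U w) by (apply HsU; lra). split.
    - apply Ccont_sub_const. now apply differentiable_cont, Hg.
    - intros E. apply Ceq_minus in E. apply Hi in E; auto. subst w.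
      rewrite Cmod_sub_diag in Hw. lra. }
  set (M0 := 4 * s / m).
  assert (HM0 : 0 < M0) by (apply Rdiv_lt_0_compat; lra).
  assert (D0' := proj1 (Cder_eps _ _ _) D0).
  destruct (D0' (/ (2 * M0))) as [d1 [Hd1 H1]]; [apply Rinv_0_lt_compat; lra|].
  destruct (Cder_cont _ _ _ D0 (m / 2)) as [d2 [Hd2 H2]]; [lra|].
  set (d := Rmin s (Rmin d1 d2)).
  assert (Hd : 0 < d) by (unfold d; repeat apply Rmin_pos; auto).
  assert (Hz : forall z, Cmod (z - p) < d -> Cder g z 0).
  { intros z Hz. destruct (Ceq_dec z p) as [->|n]; [exact D0|].
    assert (Hzs := Rlt_le_trans _ _ _ Hz (Rmin_l _ _)).
    assert (Hz' := Rlt_le_trans _ _ _ Hz (Rmin_r _ _)).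
    assert (Hz1 := Rlt_le_trans _ _ _ Hz' (Rmin_l _ _)).
    assert (Hz2 := Rlt_le_trans _ _ _ Hz' (Rmin_r _ _)).
    specialize (H1 z Hz1). specialize (H2 z Hz2).
    assert (Uz : U z) by (apply HsU; lra).
    assert (Dz := Cder_C_derive _ _ (Hg z Uz)).
    destruct (Ceq_dec (C_derive g z) 0) as [e|nz]; [now rewrite e in Dz|exfalso].
    destruct Dz as [q [Hq [Eq Hgq]]]. rewrite <- Eq in nz.
    (* q w is the difference quotient (g w - g z) / (w - z), nowhere zero
       because g is injective *)
    assert (Hqnz : forall w, U w -> q w <> 0%C).
    { intros w Uw Ew. destruct (Ceq_dec w z) as [->|nw]; [now apply nz|].
      apply nw. apply Hi; auto. rewrite (Hgq w), Ew. ring. }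
    assert (Hqd : forall w, U w -> w <> z -> differentiable_at q w).
    { intros w Uw nw. destruct (Hg w Uw) as [l Hl].
      eexists.
      apply (Cder_ext_loc (fun w => (g w - g z) * / (w - z))%C q w _ (Cmod (w - z))).
      - now apply Cmod_sub_pos.
      - intros w' Hw'. rewrite (Hgq w'). field.
        apply Cminus_eq_contra. intros ->. rewrite Cmod_sub_sym in Hw'. lra.
      - apply Cder_mult; [apply Cder_sub_const; exact Hl|].
        apply Cder_inv; [apply Cder_sub_const, Cder_id|].
        now apply Cminus_eq_contra. }
    assert (P : Cmod (/ q p) <= M0).
    { apply (max_disc (fun w => / q w)%C p s).
      - lra.
      - intros w Hw. apply Ccont_inv; [|now apply Hqnz, HsU].
        destruct (Ceq_dec w z) as [->|nw]; [exact Hq|].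
        apply differentiable_cont, Hqd; auto.
      - intros c Hc.
        destruct (Ceq_dec c z) as [->|nc].
        + exists (s - Cmod (z - p)). split; [lra|]. intros w [h1 h2].
          assert (T := Cmod_tri3 w z p).
          assert (Uw : U w) by (apply HsU; lra).
          assert (nw : w <> z) by (intros ->; rewrite Cmod_sub_diag in h1; lra).
          destruct (Hqd w Uw nw) as [l Hl]. eexists. apply Cder_inv; [exact Hl|auto].
        + assert (Hcz := Cmod_sub_pos _ _ nc).
          exists (Rmin (s - Cmod (c - p)) (Cmod (c - z))). split; [apply Rmin_pos; lra|].
          intros w [h1 h2].
          assert (h3 := Rlt_le_trans _ _ _ h2 (Rmin_l _ _)).
          assert (h4 := Rlt_le_trans _ _ _ h2 (Rmin_r _ _)).
          assert (T := Cmod_tri3 w c p).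
          assert (Uw : U w) by (apply HsU; lra).
          assert (nw : w <> z) by (intros ->; rewrite Cmod_sub_sym in h4; lra).
          destruct (Hqd w Uw nw) as [l Hl]. eexists. apply Cder_inv; [exact Hl|auto].
      - intros w Hw. assert (Uw : U w) by (apply HsU; lra).
        rewrite Cmod_inv by auto.
        assert (nw : w <> z) by (intros ->; lra).
        assert (Hwz := Cmod_sub_pos _ _ nw).
        assert (A : Cmod (g w - g z) = Cmod (q w) * Cmod (w - z)).
        { rewrite <- Cmod_mult. f_equal. rewrite (Hgq w). ring. }
        specialize (Hmin w Hw). assert (T := Cmod_tri3 (g w) (g z) (g p)).
        assert (T' := Cmod_tri3 w p z). rewrite (Cmod_sub_sym p z) in T'.
        assert (Hqw : 0 < Cmod (q w)) by (apply Cmod_gt_0; auto).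
        assert (m / 2 <= Cmod (q w) * (2 * s)) by nra.
        unfold M0. apply Rle_div_r; [lra|].
        apply Rmult_le_reg_l with (Cmod (q w)); [lra|].
        rewrite <- Rmult_assoc, Rinv_r by lra. nra.
      - rewrite Cmod_sub_diag. exact Hs. }
    assert (Up : q p <> 0%C) by (apply Hqnz; exact Hp).
    rewrite Cmod_inv in P by exact Up.
    assert (A : Cmod (g z - g p - 0 * (z - p)) = Cmod (q p) * Cmod (z - p)).
    { rewrite (Cmod_sub_sym z p), <- Cmod_mult.
      replace (g z - g p - 0 * (z - p))%C with (- (g p - g z))%C by ring.
      rewrite Cmod_opp. f_equal. rewrite (Hgq p). ring. }
    rewrite A in H1. assert (Hzp := Cmod_sub_pos _ _ n).
    apply Rmult_le_reg_r in H1; [|exact Hzp].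
    assert (Hqp : 0 < Cmod (q p)) by (apply Cmod_gt_0; auto).
    assert (Q1 : 1 <= M0 * Cmod (q p)).
    { replace 1 with (/ Cmod (q p) * Cmod (q p)) by (field; lra).
      apply Rmult_le_compat_r; lra. }
    assert (Q2 : M0 * Cmod (q p) <= M0 * / (2 * M0)) by (apply Rmult_le_compat_l; lra).
    replace (M0 * / (2 * M0)) with (/ 2) in Q2 by (field; lra). lra. }
  assert (Hconst := constant_of_zero_derivative g p d Hz).
  set (w := (p + RtoC (d / 2))%C).
  assert (Hw : Cmod (w - p) = d / 2).
  { unfold w. replace (p + RtoC (d / 2) - p)%C with (RtoC (d / 2)) by ring.
    rewrite Cmod_R. apply Rabs_pos_eq; lra. }
  assert (Hds : d <= s) by apply Rmin_l.
  assert (Ewp : w = p).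
  { apply Hi; [apply HsU; lra|exact Hp|apply Hconst; lra]. }
  rewrite Ewp, Cmod_sub_diag in Hw. lra.
Qed.

Lemma holomorphic_inverse U g : Copen U -> holo U g -> injective_on U g ->
  exists psi : C -> C, (forall w, U w -> psi (g w) = w) /\
    forall w, U w -> Cder psi (g w) (/ C_derive g w).
Proof.
  intros HU Hg Hi.
  set (psi := fun q => epsilon (inhabits (RtoC 0)) (fun w => U w /\ g w = q)).
  assert (Hpsi : forall w, U w -> psi (g w) = w).
  { intros w Uw. assert (E := epsilon_spec (inhabits (RtoC 0)) (fun w' => U w' /\ g w' = g w)).
    destruct E as [E1 E2]; [now exists w|]. apply Hi; auto. }
  exists psi. split; [exact Hpsi|]. intros w Uw.
  destruct (open_image U g w 1 HU Hg Hi Uw ltac:(lra)) as [del [Hdel Hop]].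
  apply (Cder_inverse g psi (g w) _ del Hdel).
  - intros q Hq. destruct (Hop q Hq) as [w' [Uw' [_ <-]]]. now rewrite Hpsi.
  - intros e He. destruct (open_image U g w e HU Hg Hi Uw He) as [d [Hd Hd']].
    exists d; split; auto. intros q Hq. destruct (Hd' q Hq) as [w' [Uw' [Hw' <-]]].
    rewrite !Hpsi by auto. exact Hw'.
  - rewrite Hpsi by exact Uw. now apply Cder_C_derive, Hg.
  - now apply (injective_derivative_nonzero U).
Qed.

(** * Reflection in a horizontal line, and necessity *)

Definition RHP (w : C) : Prop := 0 < Re w.

(** Stability of the image under upward translations, expressed by lifting. *)
Definition upward (g : C -> C) : Prop := forall w t, RHP w -> 0 <= t ->
  exists w', RHP w' /\ g w' = (g w + Ci * RtoC t)%C.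

(** What the condition on the limit superior at sigma becomes when sigma is
    sent to infinity. *)
Definition high_near_infinity (g : C -> C) : Prop := forall r M,
  exists b, RHP b /\ r < Cmod b /\ M < Im (g b).

Lemma Re_minus (z w : C) : Re (z - w) = Re z - Re w.
Proof. unfold Re; simpl; ring. Qed.

Lemma Im_minus (z w : C) : Im (z - w) = Im z - Im w.
Proof. unfold Im; simpl; ring. Qed.

Lemma RHP_open : Copen RHP.
Proof.
  intros c Hc. exists (Re c). split; [exact Hc|]. intros w Hw. unfold RHP.
  assert (A := re_le_Cmod (w - c)). rewrite Re_minus in A.
  assert (B : Rabs (Re w - Re c) < Re c) by lra.
  apply Rabs_lt_between in B. lra.
Qed.

(** The point - conj b is the mirror image of b in the boundary, and
    |w - b| / |w + conj b| the pseudo-hyperbolic distance from w to b. It is a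
    function of |w - b|^2 / (Re w * Re b). *)
Lemma Cmod_mirror (w b : C) : Cmod (w + Cconj b) ^ 2 = Cmod (w - b) ^ 2 + 4 * Re w * Re b.
Proof. rewrite !Cmod2_alt. unfold Re, Im; simpl; ring. Qed.

Lemma Cmod_mirror_le (w b : C) : 0 <= Re w -> 0 <= Re b -> Cmod (w - b) <= Cmod (w + Cconj b).
Proof.
  intros Hw Hb. assert (E := Cmod_mirror w b).
  assert (A := Cmod_ge_0 (w - b)). assert (B := Cmod_ge_0 (w + Cconj b)).
  assert (0 <= Re w * Re b) by nra. nra.
Qed.

Lemma RHP_add_nonzero (z w : C) : RHP z -> RHP w -> (z + w)%C <> 0%C.
Proof.
  unfold RHP. intros Hz Hw E. assert (A := f_equal Re E). rewrite re_plus in A.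
  rewrite re_RtoC in A. lra.
Qed.

(** For w with Im (g w) < c let rho w be the point over the mirror image of
    g w in the line Im = c, which exists because the image of g is stable
    under upward translations. The modulus of Phi w is the quotient of the
    pseudo-hyperbolic distances of rho w and of w to b; the conjugate chi w of
    rho w is used to make Phi holomorphic. This modulus is 1 on the line, where
    rho w = w, and at most |w + conj b| / |w - b| elsewhere, which tends to 1
    at the boundary of the half-plane and at infinity. So |Phi| <= 1, and
    rho a = a' for c half-way between the heights of g a and g a'. *)
Lemma reflection g a b a' s : holo RHP g -> injective_on RHP g -> upward g ->
  RHP a -> RHP b -> RHP a' -> 0 < s -> g a' = (g a + Ci * RtoC s)%C ->
  Im (g a) + s / 2 < Im (g b) ->
  Cmod (a' - b) ^ 2 * Re a <= Cmod (a - b) ^ 2 * Re a'.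
Proof.
  intros Hg Hi Hup Ha Hb Ha' Hs Ega' Hlt.
  destruct (holomorphic_inverse RHP g RHP_open Hg Hi) as [psi [Hpsi Dpsi]].
  set (c := Im (g a) + s / 2) in *.
  (* chi w is the conjugate of the point over the mirror image of g w in Im = c *)
  set (chi := fun w => Cconj (psi (Cconj (g w) + Ci * RtoC (2 * c)))%C).
  assert (Hchi : forall w, RHP w -> Im (g w) <= c -> exists p, RHP p /\
     g p = (Cconj (g w) + Ci * RtoC (2 * c))%C /\ chi w = Cconj p).
  { intros w Hw Hc. destruct (Hup w (2 * (c - Im (g w))) Hw ltac:(lra)) as [p [Hp Ep]].
    assert (Ep' : g p = (Cconj (g w) + Ci * RtoC (2 * c))%C).
    { rewrite Ep. apply Ceq_ReIm; unfold Re, Im; simpl; ring. }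
    exists p. split; [exact Hp|split; [exact Ep'|]].
    unfold chi. rewrite <- Ep', Hpsi; auto. }
  assert (Hchid : forall w, RHP w -> Im (g w) <= c -> differentiable_at chi w).
  { intros w Hw Hc. destruct (Hchi w Hw Hc) as [p [Hp [Ep _]]].
    destruct (Hg w Hw) as [l Hl].
    assert (D := Dpsi p Hp). rewrite Ep in D.
    eexists. apply (Cder_comp g (fun q => Cconj (psi (Cconj q + Ci * RtoC (2 * c)))%C) w); [exact Hl|].
    apply (Cder_conj_conj (fun q => psi (q + Ci * RtoC (2 * c))%C)).
    apply (Cder_comp (fun q => q + Ci * RtoC (2 * c))%C psi); [|exact D].
    apply Cder_plus; [apply Cder_id|apply Cder_const]. }
  assert (HchiR : forall w, RHP w -> Im (g w) <= c -> RHP (chi w)).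
  { intros w Hw Hc. destruct (Hchi w Hw Hc) as [p [Hp [_ ->]]]. unfold RHP. now rewrite re_conj. }
  assert (Hwb : forall w, RHP w -> Im (g w) <= c -> w <> b) by (intros w _ Hc ->; lra).
  set (Phi := fun w => ((w + Cconj b) * (chi w - Cconj b) * / ((w - b) * (chi w + b)))%C).
  assert (Hden : forall w, RHP w -> Im (g w) <= c -> ((w - b) * (chi w + b))%C <> 0%C).
  { intros w Hw Hc. apply Cmult_neq_0.
    - apply Cminus_eq_contra. now apply Hwb.
    - apply RHP_add_nonzero; auto. }
  assert (HPd : forall w, RHP w -> Im (g w) <= c -> differentiable_at Phi w).
  { intros w Hw Hc. destruct (Hchid w Hw Hc) as [l Hl]. eexists. unfold Phi.
    apply Cder_mult.
    - apply Cder_mult.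
      + apply Cder_plus; [apply Cder_id|apply Cder_const].
      + apply Cder_sub_const. exact Hl.
    - apply Cder_inv; [|now apply Hden]. apply Cder_mult.
      + apply Cder_sub_const, Cder_id.
      + apply Cder_plus; [exact Hl|apply Cder_const]. }
  assert (HPm : forall w, RHP w -> Im (g w) <= c ->
     Cmod (Phi w) * (Cmod (w - b) * Cmod (chi w + b)) = Cmod (w + Cconj b) * Cmod (chi w - Cconj b)).
  { intros w Hw Hc. unfold Phi. rewrite Cmod_mult, Cmod_inv by now apply Hden.
    rewrite <- (Cmod_mult (w - b)), <- (Cmod_mult (w + Cconj b)). field.
    apply Rgt_not_eq. apply Cmod_gt_0. now apply Hden. }
  assert (Hchib : forall w, RHP w -> Im (g w) <= c -> Cmod (chi w - Cconj b) <= Cmod (chi w + b)).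
  { intros w Hw Hc. rewrite <- (Cconj_conj b) at 2. apply Cmod_mirror_le.
    - left. now apply HchiR.
    - rewrite re_conj. now left. }
  assert (HPle : forall w, RHP w -> Im (g w) <= c -> Cmod (Phi w) * Cmod (w - b) <= Cmod (w + Cconj b)).
  { intros w Hw Hc. assert (E := HPm w Hw Hc). assert (L := Hchib w Hw Hc).
    assert (P : 0 < Cmod (chi w + b)) by (apply Cmod_gt_0, RHP_add_nonzero; auto).
    apply Rmult_le_reg_r with (Cmod (chi w + b)); [exact P|].
    rewrite Rmult_assoc, E. apply Rmult_le_compat_l; [apply Cmod_ge_0|exact L]. }
  assert (Hedge : forall w, RHP w -> Im (g w) = c -> Cmod (Phi w) = 1).
  { intros w Hw Hc. destruct (Hchi w Hw ltac:(lra)) as [p [Hp [Ep Epc]]].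
    assert (Epw : p = w).
    { apply Hi; auto. rewrite Ep, <- Hc. apply Ceq_ReIm; unfold Re, Im; simpl; ring. }
    subst p. assert (E := HPm w Hw ltac:(lra)). rewrite Epc in E.
    rewrite <- (Cmod_conj (Cconj w + b)), <- (Cmod_conj (Cconj w - Cconj b)) in E.
    rewrite Cplus_conj, Cminus_conj, !Cconj_conj in E.
    assert (P : 0 < Cmod (w - b)) by (apply Cmod_sub_pos, Hwb; lra || auto).
    assert (P2 : 0 < Cmod (w + Cconj b)).
    { apply Cmod_gt_0, RHP_add_nonzero; [exact Hw|]. unfold RHP. now rewrite re_conj. }
    apply Rmult_eq_reg_r with (Cmod (w - b) * Cmod (w + Cconj b)); [|apply Rgt_not_eq; nra].
    rewrite E. ring. }
  assert (Hm : Cmod (Phi a) <= 1).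
  { apply (maximum_modulus (fun w => RHP w /\ Im (g w) < c)); [lra| | | |].
    - intros w [Hw Hc]. split; [apply differentiable_cont, HPd; lra || auto|].
      destruct (RHP_open w Hw) as [r1 [Hr1 H1]].
      destruct (Ccont_Re_lt (fun w => - Ci * g w)%C w c) as [r2 [Hr2 H2]].
      { apply Ccont_mult; [apply Ccont_const|]. apply differentiable_cont, Hg, Hw. }
      { unfold Re, Im in *; simpl in *; lra. }
      assert (HU : forall w', Cmod (w' - w) < Rmin r1 r2 -> RHP w' /\ Im (g w') < c).
      { intros w' Hw'. split.
        - apply H1. eapply Rlt_le_trans; [exact Hw'|apply Rmin_l].
        - specialize (H2 w' (Rlt_le_trans _ _ _ Hw' (Rmin_r _ _))).
          unfold Re, Im in *; simpl in *; lra. }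
      exists (Rmin r1 r2). split; [now apply Rmin_pos|]. split; [exact HU|].
      intros w' [_ h]. destruct (HU w' h) as [h1 h2]. apply HPd; lra || auto.
    - intros m Hm. exists (2 * Re b / (m - 1) + Cmod b). intros w [Hw Hc] HP.
      assert (L := HPle w Hw ltac:(lra)).
      assert (T : Cmod (w + Cconj b) <= Cmod (w - b) + 2 * Re b).
      { replace (w + Cconj b)%C with ((w - b) + RtoC (2 * Re b))%C
          by (apply Ceq_ReIm; unfold Re, Im; simpl; ring).
        eapply Rle_trans; [apply Cmod_triangle|]. rewrite Cmod_R, Rabs_pos_eq; [lra|].
        unfold RHP in Hb. lra. }
      assert (Q := Cmod_ge_0 (w - b)).
      assert (Cmod (w - b) <= 2 * Re b / (m - 1)).
      { apply Rle_div_r; [lra|]. nra. }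
      assert (T2 := Cmod_tri_inv w b). lra.
    - intros m w Hm HS.
      destruct (Rlt_le_dec 0 (Re w)) as [Hw|Hw].
      + destruct (Rlt_le_dec c (Im (g w))) as [Hc|Hc].
        * destruct (Ccont_Re_lt (fun w => Ci * g w)%C w (- c)) as [r2 [Hr2 H2]].
          { apply Ccont_mult; [apply Ccont_const|]. apply differentiable_cont, Hg, Hw. }
          { unfold Re, Im in *; simpl in *; lra. }
          exists r2. split; auto. intros w' Hw' [[_ h] _]. specialize (H2 w' Hw').
          unfold Re, Im in *; simpl in *; lra.
        * assert (Hlt1 : Cmod (Phi w) < m).
          { destruct (Rle_lt_or_eq_dec _ _ Hc) as [h|h].
            - apply Rnot_le_lt. intros h2. apply HS. repeat split; auto.
            - rewrite (Hedge w Hw h). exact Hm. }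
          destruct (Ccont_Cmod_lt Phi w m) as [d [Hd Hd']]; auto.
          { apply differentiable_cont. now apply HPd. }
          exists d. split; auto. intros w' Hw' [_ h]. specialize (Hd' w' Hw'). lra.
      + assert (Hwnb : w <> b) by (intros ->; unfold RHP in Hb; lra).
        assert (P := Cmod_sub_pos _ _ Hwnb).
        assert (L0 : Cmod (w + Cconj b) <= Cmod (w - b)).
        { assert (E := Cmod_mirror w b). assert (A := Cmod_ge_0 (w + Cconj b)).
          unfold RHP in Hb. assert (Re w * Re b <= 0) by nra. nra. }
        (* within this radius |w' + conj b| < m |w' - b| persists *)
        exists ((m - 1) * Cmod (w - b) / (2 * (m + 1))).
        split; [apply Rdiv_lt_0_compat; nra|].
        intros w' Hw' [[h1 h2] h3].
        assert (L := HPle w' h1 ltac:(lra)).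
        assert (T1 := Cmod_tri3 w w' b). rewrite (Cmod_sub_sym w w') in T1.
        assert (T2 : Cmod (w' + Cconj b) <= Cmod (w' - w) + Cmod (w + Cconj b)).
        { replace (w' + Cconj b)%C with ((w' - w) + (w + Cconj b))%C by ring. apply Cmod_triangle. }
        set (d := Cmod (w' - w)) in *. set (D := Cmod (w - b)) in *.
        assert (Q := Cmod_ge_0 (w' - b)).
        apply Rlt_div_r in Hw'; [|lra].
        assert (m * (D - d) <= D + d) by nra. nra.
    - split; [exact Ha|]. unfold c; lra. }
  destruct (Hchi a Ha) as [p [Hp [Ep Epc]]]; [unfold c; lra|].
  assert (Epa : p = a').
  { apply Hi; auto. rewrite Ep, Ega'. unfold c.
    apply Ceq_ReIm; unfold Re, Im; simpl; field. }
  subst p.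
  assert (E := HPm a Ha ltac:(unfold c; lra)). rewrite Epc in E.
  rewrite <- (Cmod_conj (Cconj a' + b)), <- (Cmod_conj (Cconj a' - Cconj b)) in E.
  rewrite Cplus_conj, Cminus_conj, !Cconj_conj in E.
  assert (L : Cmod (a + Cconj b) * Cmod (a' - b) <= Cmod (a - b) * Cmod (a' + Cconj b)).
  { rewrite <- E. rewrite <- (Rmult_1_l (Cmod (a - b) * Cmod (a' + Cconj b))) at 2.
    apply Rmult_le_compat_r; [|exact Hm]. apply Rmult_le_pos; apply Cmod_ge_0. }
  assert (L2 : (Cmod (a + Cconj b) * Cmod (a' - b)) ^ 2 <= (Cmod (a - b) * Cmod (a' + Cconj b)) ^ 2).
  { apply pow_incr. split; [apply Rmult_le_pos; apply Cmod_ge_0|exact L]. }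
  rewrite !Rpow_mult_distr, !Cmod_mirror in L2.
  unfold RHP in *. nra.
Qed.

(** The limiting case, where the line passes through g b, comes from raising
    g b slightly. *)
Lemma reflection_le g a b a' s : holo RHP g -> injective_on RHP g -> upward g ->
  RHP a -> RHP b -> RHP a' -> 0 < s -> g a' = (g a + Ci * RtoC s)%C ->
  Im (g a) + s / 2 <= Im (g b) ->
  Cmod (a' - b) ^ 2 * Re a <= Cmod (a - b) ^ 2 * Re a'.
Proof.
  intros Hg Hi Hup Ha Hb Ha' Hs Ega' Hle. apply Rnot_lt_le. intros N.
  destruct (holomorphic_inverse RHP g RHP_open Hg Hi) as [psi [Hpsi Dpsi]].
  assert (Cpsi := Cder_cont _ _ _ (Dpsi b Hb)).
  set (F := fun w => ((w - a) * Cconj (w - a) * RtoC (Re a') - (w - a') * Cconj (w - a') * RtoC (Re a))%C).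
  assert (HF : forall w, Re (F w) = Cmod (a - w) ^ 2 * Re a' - Cmod (a' - w) ^ 2 * Re a).
  { intros w. rewrite !Cmod2_alt. unfold F, Re, Im; simpl; ring. }
  assert (CF : Ccont F b).
  { assert (CC : forall z : C, Ccont (fun w => (w - z) * Cconj (w - z))%C b).
    { intros z. assert (A := Ccont_sub_const (fun w => w) z b (Ccont_id b)).
      apply Ccont_mult; [exact A|]. apply (Ccont_comp (fun w => w - z)%C Cconj); auto using Ccont_conj. }
    unfold F. apply (Ccont_ext_loc (fun w => ((w - a) * Cconj (w - a) * RtoC (Re a') +
      (- RtoC (Re a)) * ((w - a') * Cconj (w - a')))%C) _ b 1); [lra|intros; ring|].
    apply Ccont_plus; apply Ccont_mult; auto using Ccont_const. }
  assert (CFp : Ccont (fun q => F (psi q)) (g b)).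
  { apply (Ccont_comp psi F); [exact Cpsi|]. now rewrite Hpsi. }
  destruct (Ccont_Re_lt _ _ 0 CFp) as [d [Hd Hd']].
  { rewrite Hpsi by auto. rewrite HF. lra. }
  destruct (Hup b (d / 2) Hb ltac:(lra)) as [b' [Hb' Eb']].
  assert (R : Cmod (a' - b') ^ 2 * Re a <= Cmod (a - b') ^ 2 * Re a').
  { apply (reflection g a b' a' s); auto. rewrite Eb'.
    rewrite im_plus. replace (Im (Ci * RtoC (d/2))) with (d/2) by (unfold Im; simpl; ring). lra. }
  specialize (Hd' (g b')). cbv beta in Hd'. rewrite Hpsi, HF in Hd' by auto.
  assert (H : Cmod (g b' - g b) < d).
  { rewrite Eb'. replace (g b + Ci * RtoC (d/2) - g b)%C with (Ci * RtoC (d/2))%C by ring.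
    rewrite Cmod_mult, Cmod_Ci, Cmod_R, Rabs_pos_eq; lra. }
  specialize (Hd' H). lra.
Qed.

(** In the reflection inequality b tends to infinity: the two squared
    distances become equivalent, which leaves Re a <= Re a'. *)
Lemma lift_moves_right g a a' s : holo RHP g -> injective_on RHP g -> upward g ->
  high_near_infinity g ->
  RHP a -> RHP a' -> 0 < s -> g a' = (g a + Ci * RtoC s)%C -> Re a <= Re a'.
Proof.
  intros Hg Hi Hup Hfar Ha Ha' Hs E. apply Rnot_lt_le. intros N.
  set (D := Cmod (a - a')).
  assert (HD : 0 <= D) by apply Cmod_ge_0.
  destruct (Hfar (Cmod a + 2 * D * Re a / (Re a - Re a')) (Im (g a) + s / 2)) as [b [Hb [Hb1 Hb2]]].
  assert (L := reflection g a b a' s Hg Hi Hup Ha Hb Ha' Hs E Hb2).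
  assert (T1 := Cmod_tri_inv b a). rewrite Cmod_sub_sym in T1.
  assert (HX : 2 * D * Re a / (Re a - Re a') < Cmod (a - b)) by lra.
  apply Rlt_div_l in HX; [|lra].
  set (X := Cmod (a - b)) in *.
  assert (T2 := Cmod_tri3 a a' b). fold X D in T2.
  set (Y := Cmod (a' - b)) in *.
  assert (HY : 0 <= Y) by apply Cmod_ge_0.
  unfold RHP in *.
  assert (HX0 : 0 <= X) by apply Cmod_ge_0.
  assert (HXp : 0 < X).
  { assert (0 <= 2 * D * Re a) by nra. nra. }
  assert (Q : X ^ 2 - 2 * X * D <= Y ^ 2).
  { destruct (Rle_dec D X); [|nra]. assert ((X - D) ^ 2 <= Y ^ 2) by (apply pow_incr; lra). nra. }
  assert ((X ^ 2 - 2 * X * D) * Re a <= X ^ 2 * Re a') by nra.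
  assert (X * (X * (Re a - Re a')) <= X * (2 * D * Re a)) by nra.
  apply Rmult_le_reg_l in H0; lra.
Qed.

(** With k = 1 / g' (a), the point over g a + i s is a + i k s up to o (s). It
    lies to the right of a, so Re (i k) >= 0, which is Im k <= 0. *)
Lemma starlike_derivative g : holo RHP g -> injective_on RHP g -> upward g ->
  high_near_infinity g ->
  forall a, RHP a -> 0 <= Im (C_derive g a).
Proof.
  intros Hg Hi Hup Hfar a Ha.
  destruct (holomorphic_inverse RHP g RHP_open Hg Hi) as [psi [Hpsi Dpsi]].
  assert (D := Dpsi a Ha).
  assert (Hnz := injective_derivative_nonzero RHP g a RHP_open Hg Hi Ha).
  set (l := C_derive g a) in *. set (k := (/ l)%C) in *.
  assert (Hk : Im k <= 0).
  { apply Rnot_lt_le. intros N.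
    destruct (proj1 (Cder_eps _ _ _) D (Im k / 2)) as [d [Hd Hd']]; [lra|].
    destruct (Hup a (d / 2) Ha ltac:(lra)) as [a' [Ha' E]].
    assert (M := lift_moves_right g a a' (d/2) Hg Hi Hup Hfar Ha Ha' ltac:(lra) E).
    assert (Ed : (g a' - g a)%C = (Ci * RtoC (d/2))%C) by (rewrite E; ring).
    specialize (Hd' (g a')). rewrite Ed, !Hpsi in Hd' by auto.
    assert (Em : Cmod (Ci * RtoC (d/2)) = d/2) by (rewrite Cmod_mult, Cmod_Ci, Cmod_R, Rabs_pos_eq; lra).
    rewrite Em in Hd'. specialize (Hd' ltac:(lra)).
    assert (A := re_le_Cmod (a' - a - k * (Ci * RtoC (d/2)))).
    replace (Re (a' - a - k * (Ci * RtoC (d/2)))%C) with (Re a' - Re a + Im k * (d/2)) in A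
      by (unfold Re, Im; simpl; ring).
    assert (B := Rle_abs (Re a' - Re a + Im k * (d/2))). nra. }
  assert (E : (k * l)%C = 1%C) by (unfold k; field; auto).
  assert (E1 : Re k * Re l - Im k * Im l = 1) by now rewrite <- re_mult, E.
  assert (E2 : Re k * Im l + Im k * Re l = 0) by now rewrite <- im_mult, E.
  assert (F1 : Im l * (Re k * Re l - Im k * Im l) = Im l) by (rewrite E1; ring).
  assert (F2 : Re l * (Re k * Im l + Im k * Re l) = 0) by (rewrite E2; ring).
  assert (F3 : Im l = - Im k * (Re l ^ 2 + Im l ^ 2)) by lra.
  rewrite F3. apply Rmult_le_pos; [lra|]. apply Rplus_le_le_0_compat; apply pow2_ge_0.
Qed.

(** * Positive imaginary part of the derivative, and sufficiency *)

Lemma RHP_segment a b t : RHP a -> RHP b -> 0 <= t <= 1 -> RHP (a + RtoC t * (b - a))%C.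
Proof.
  unfold RHP. intros Ha Hb Ht. rewrite re_plus, re_scal_l, Re_minus. nra.
Qed.

(** The Noshiro-Warschawski principle: on a convex domain difference quotients
    inherit the sign of Im g'. *)
Lemma quotient_mvt g a b : holo RHP g -> RHP a -> RHP b -> a <> b ->
  exists xi, RHP xi /\ Im ((g b - g a) / (b - a))%C = Im (C_derive g xi).
Proof.
  intros Hg Ha Hb n.
  assert (Hba : (b - a)%C <> 0%C) by (apply Cminus_eq_contra; auto).
  destruct (segment_mvt g a b (- Ci / (b - a))%C) as [t [Ht E]].
  - intros t Ht. apply Hg. now apply RHP_segment.
  - exists (a + RtoC t * (b - a))%C. split; [apply RHP_segment; auto; lra|].
    set (l := C_derive g (a + RtoC t * (b - a))%C) in *.
    replace (- Ci / (b - a) * (g b - g a))%C with (- Ci * ((g b - g a) / (b - a)))%C in E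
      by (field; auto).
    replace (- Ci / (b - a) * l * (b - a))%C with (- Ci * l)%C in E by (field; auto).
    set (X := ((g b - g a) / (b - a))%C) in *.
    unfold Re, Im in *; simpl in *. lra.
Qed.

Lemma quotient_expands (x y : C) m : y <> 0%C -> m <= Im (x / y)%C -> m * Cmod y <= Cmod x.
Proof.
  intros Hy Hm.
  assert (E : Cmod x = Cmod (x / y) * Cmod y).
  { rewrite <- Cmod_mult. f_equal. field. exact Hy. }
  rewrite E. apply Rmult_le_compat_r; [apply Cmod_ge_0|].
  eapply Rle_trans; [exact Hm|]. eapply Rle_trans; [apply Rle_abs|apply im_le_Cmod].
Qed.

(** A quotient A = i t / y with Im A > 0 has y = i t / A, whose real part is
    t Im A / |A|^2. *)
Lemma quotient_right (y : C) t : y <> 0%C -> 0 <= t -> 0 < Im (Ci * RtoC t / y)%C -> 0 <= Re y.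
Proof.
  intros Hy Ht H.
  set (A := (Ci * RtoC t / y)%C) in *.
  assert (E : (A * y)%C = (Ci * RtoC t)%C) by (unfold A; field; exact Hy).
  assert (E1 : Re A * Re y - Im A * Im y = 0).
  { rewrite <- re_mult, E. unfold Re; simpl; ring. }
  assert (E2 : Re A * Im y + Im A * Re y = t).
  { rewrite <- im_mult, E. unfold Im; simpl; ring. }
  assert (F : Im A * t = (Re A ^ 2 + Im A ^ 2) * Re y).
  { rewrite <- E2. assert (G : Re A * (Re A * Re y - Im A * Im y) = 0) by (rewrite E1; ring). lra. }
  assert (0 <= Im A * t) by nra.
  assert (0 < Re A ^ 2 + Im A ^ 2) by nra.
  apply Rnot_lt_le. intros N. nra.
Qed.

(** A value approximated on a compact part of the half-plane is attained there.
    It closes both continuity arguments: along a vertical ray and as eps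
    tends to 0. *)
Lemma compact_attain g q x0 w0 Bd : holo RHP g -> 0 < x0 ->
  (forall eta, 0 < eta -> exists w, x0 <= Re w /\ Cmod (w - w0) <= Bd /\ Cmod (g w - q) <= eta) ->
  exists w, x0 <= Re w /\ Cmod (w - w0) <= Bd /\ g w = q.
Proof.
  intros Hg Hx H.
  destruct (usc_attains_max (fun w => x0 <= Re w /\ Cmod (w - w0) <= Bd)
     (fun w => - Cmod (g w - q)) (Bd + Cmod w0)) as [c [[Hc1 Hc2] Hmax]].
  - destruct (H 1 ltac:(lra)) as [w [h1 [h2 _]]]. now exists w.
  - intros w [_ h]. assert (T := Cmod_tri_inv w w0). lra.
  - intros w Hw. destruct (Rlt_le_dec (Re w) x0) as [h|h].
    + exists (x0 - Re w). split; [lra|]. intros w' Hw' [h1 _].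
      assert (A := re_le_Cmod (w' - w)). rewrite Re_minus in A.
      assert (A' := Rle_abs (Re w' - Re w)). lra.
    + destruct (Rlt_le_dec Bd (Cmod (w - w0))) as [h'|h'].
      * exists (Cmod (w - w0) - Bd). split; [lra|]. intros w' Hw' [_ h2].
        assert (T := Cmod_tri3 w w' w0). rewrite (Cmod_sub_sym w w') in T. lra.
      * exfalso. apply Hw. auto.
  - intros w M [h1 h2] HM.
    assert (Cg : Ccont g w) by (apply differentiable_cont, Hg; unfold RHP; lra).
    destruct (Cg (M + Cmod (g w - q))) as [d [Hd Hd']]; [lra|].
    exists d. split; auto. intros w' _ Hw'. specialize (Hd' w' Hw').
    assert (T := Cmod_tri3 (g w) (g w') q). rewrite (Cmod_sub_sym (g w) (g w')) in T. lra.
  - exists c. repeat split; auto. apply Cmod_eq0_sub.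
    apply Rle_antisym; [|apply Cmod_ge_0]. apply Rnot_lt_le. intros N.
    destruct (H (Cmod (g c - q) / 2)) as [w [h1 [h2 h3]]]; [lra|].
    specialize (Hmax w (conj h1 h2)). lra.
Qed.

Lemma Im_vertical (z : C) t : Im (z + Ci * RtoC t)%C = Im z + t.
Proof. unfold Im; simpl; ring. Qed.

Lemma Cmod_vertical t : Cmod (Ci * RtoC t) = Rabs t.
Proof. now rewrite Cmod_mult, Cmod_Ci, Cmod_R, Rmult_1_l. Qed.

Lemma positive_injective g : holo RHP g -> (forall w, RHP w -> 0 < Im (C_derive g w)) ->
  injective_on RHP g.
Proof.
  intros Hg Hp a b Ha Hb E. apply NNPP. intros n.
  destruct (quotient_mvt g a b Hg Ha Hb n) as [xi [Hxi Ex]].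
  specialize (Hp xi Hxi). rewrite <- Ex, E in Hp.
  replace ((g b - g b) / (b - a))%C with (RtoC 0) in Hp.
  - rewrite im_RtoC in Hp. apply (Rlt_irrefl 0 Hp).
  - field. apply Cminus_eq_contra; auto.
Qed.

Lemma positive_flow_right g a a' t : holo RHP g -> (forall w, RHP w -> 0 < Im (C_derive g w)) ->
  RHP a -> RHP a' -> 0 <= t -> g a' = (g a + Ci * RtoC t)%C -> Re a <= Re a'.
Proof.
  intros Hg Hp Ha Ha' Ht E.
  destruct (Ceq_dec a a') as [->|n]; [lra|].
  destruct (quotient_mvt g a a' Hg Ha Ha' n) as [xi [Hxi Ex]].
  specialize (Hp xi Hxi). rewrite <- Ex, E in Hp.
  replace (g a + Ci * RtoC t - g a)%C with (Ci * RtoC t)%C in Hp by ring.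
  apply quotient_right in Hp; [|apply Cminus_eq_contra; auto|exact Ht].
  rewrite Re_minus in Hp. lra.
Qed.

(** The set of heights that can be reached is open by [open_image] and closed
    because g expands distances by at least m, which confines lifts to a
    bounded set; they stay off the boundary since they move to the right. *)
Lemma lift_of_lower_bound g m : holo RHP g -> 0 < m ->
  (forall w, RHP w -> m <= Im (C_derive g w)) ->
  forall w0 T, RHP w0 -> 0 <= T -> exists w, RHP w /\ Re w0 <= Re w /\ g w = (g w0 + Ci * RtoC T)%C.
Proof.
  intros Hg Hm Hp w0 T Hw0 HT.
  assert (Hpos : forall w, RHP w -> 0 < Im (C_derive g w)).
  { intros w Hw. specialize (Hp w Hw). lra. }
  assert (Hi := positive_injective g Hg Hpos).
  assert (Hexp : forall w, RHP w -> m * Cmod (w - w0) <= Cmod (g w - g w0)).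
  { intros w Hw. destruct (Ceq_dec w0 w) as [->|n].
    - rewrite !Cmod_sub_diag. lra.
    - apply quotient_expands; [apply Cminus_eq_contra; auto|].
      destruct (quotient_mvt g w0 w Hg Hw0 Hw n) as [xi [Hxi ->]]. auto. }
  set (L := fun t w => RHP w /\ Re w0 <= Re w /\ g w = (g w0 + Ci * RtoC t)%C).
  set (E := fun t => 0 <= t <= T /\ exists w, L t w).
  destruct (completeness E) as [s [Hs1 Hs2]].
  { exists T. intros t [[_ h] _]. exact h. }
  { exists 0. split; [lra|]. exists w0. repeat split; auto; try lra. ring. }
  assert (Hs0 : 0 <= s).
  { apply Hs1. split; [lra|]. exists w0. repeat split; auto; try lra. ring. }
  assert (HsT : s <= T) by (apply Hs2; intros t [[_ h] _]; exact h).
  assert (Ls : exists w, L s w).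
  { destruct (compact_attain g (g w0 + Ci * RtoC s)%C (Re w0) w0 (T / m) Hg Hw0) as [w [h1 [h2 h3]]].
    - intros eta Heta.
      assert (Hex : exists t, E t /\ s - eta < t).
      { apply NNPP. intros N. assert (s <= s - eta); [|lra]. apply Hs2. intros t Et.
        apply Rnot_lt_le. intros h. apply N. now exists t. }
      destruct Hex as [t [[Ht [w [h1 [h2 h3]]]] Hts]].
      assert (Hts' : t <= s) by (apply Hs1; split; [exact Ht|exists w; repeat split; auto]).
      exists w. split; [exact h2|split].
      + apply Rle_div_r; [exact Hm|]. rewrite Rmult_comm.
        eapply Rle_trans; [apply Hexp; exact h1|]. rewrite h3.
        replace (g w0 + Ci * RtoC t - g w0)%C with (Ci * RtoC t)%C by ring.
        rewrite Cmod_vertical, Rabs_pos_eq; lra.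
      + rewrite h3.
        replace (g w0 + Ci * RtoC t - (g w0 + Ci * RtoC s))%C with (Ci * RtoC (t - s))%C
          by (rewrite RtoC_minus; ring).
        rewrite Cmod_vertical. apply Rabs_le_between. lra.
    - exists w. repeat split; auto. unfold RHP in *. lra. }
  destruct Ls as [w [Hw1 [Hw2 Hw3]]].
  destruct (Rle_lt_or_eq_dec _ _ HsT) as [Hlt|Heq]; [|exists w; subst s; auto].
  exfalso.
  destruct (open_image RHP g w 1 RHP_open Hg Hi Hw1 ltac:(lra)) as [del [Hdel Hop]].
  set (d := Rmin del (T - s) / 2).
  assert (M := Rmin_pos del (T - s) Hdel ltac:(lra)).
  assert (M1 := Rmin_l del (T - s)). assert (M2 := Rmin_r del (T - s)).
  destruct (Hop (g w + Ci * RtoC d)%C) as [w1 [Hw1' [_ Ew1]]].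
  { replace (g w + Ci * RtoC d - g w)%C with (Ci * RtoC d)%C by ring.
    rewrite Cmod_vertical, Rabs_pos_eq; unfold d; lra. }
  assert (Hr : Re w <= Re w1).
  { apply (positive_flow_right g w w1 d); auto. unfold d; lra. }
  assert (s + d <= s).
  { apply Hs1. split; [unfold d; lra|]. exists w1. repeat split; auto; [lra|].
    rewrite Ew1, Hw3, RtoC_plus. ring. }
  unfold d in *; lra.
Qed.

(** The mirror image of g (w j) in the horizontal line through g (w (S j)) is
    g (w (S (S j))): the hyperbolic length of steps does not increase, and the
    quantity |w (S j) - w j|^2 / (Re (w j) * Re (w (S j))) measures it. *)
Lemma orbit_steps g (w : nat -> C) del r : holo RHP g -> injective_on RHP g -> upward g ->
  0 < del -> (forall j, RHP (w j)) ->
  (forall j, g (w (S j)) = (g (w j) + Ci * RtoC del)%C) ->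
  (forall j, Re (w j) <= Re (w (S j))) ->
  Cmod (w 1%nat - w 0%nat) <= r ->
  forall j, Cmod (w (S j) - w j) ^ 2 <= r ^ 2 / Re (w 0%nat) ^ 2 * (Re (w j) * Re (w (S j))).
Proof.
  intros Hg Hi Hup Hdel HR Hst Hmono Hr.
  assert (H0 := HR 0%nat). unfold RHP in HR.
  set (x0 := Re (w 0%nat)) in *. unfold RHP in H0. fold x0 in H0.
  induction j as [|j IH].
  - fold x0. assert (Hx1 := Hmono 0%nat). fold x0 in Hx1.
    assert (A := Cmod_ge_0 (w 1%nat - w 0%nat)).
    assert (B1 : Cmod (w 1%nat - w 0%nat) ^ 2 <= r ^ 2) by (apply pow_incr; lra).
    apply Rle_trans with (r ^ 2); [exact B1|].
    replace (r ^ 2) with (r ^ 2 / x0 ^ 2 * (x0 * x0)) at 1 by (field; lra).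
    apply Rmult_le_compat_l.
    + apply Rdiv_le_0_compat; [apply pow2_ge_0|]. apply pow_lt; lra.
    + apply Rmult_le_compat_l; lra.
  - assert (P1 := HR j). assert (P2 := HR (S j)). assert (P3 := HR (S (S j))).
    assert (L := reflection_le g (w j) (w (S j)) (w (S (S j))) (2 * del) Hg Hi Hup P1 P2 P3 ltac:(lra)).
    assert (L' : Cmod (w (S (S j)) - w (S j)) ^ 2 * Re (w j) <= Cmod (w j - w (S j)) ^ 2 * Re (w (S (S j)))).
    { apply L.
      - rewrite !Hst, RtoC_mult. ring.
      - rewrite Hst, Im_vertical. lra. }
    rewrite (Cmod_sub_sym (w j)) in L'.
    apply Rmult_le_reg_r with (Re (w j)); [exact P1|].
    eapply Rle_trans; [exact L'|].
    eapply Rle_trans; [apply Rmult_le_compat_r; [lra|exact IH]|].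
    right; ring.
Qed.

(** Steps of bounded hyperbolic length multiply the real part by at most
    K + 2 and move the point by at most K + 2 times its real part. *)
Lemma orbit_bounded (w : nat -> C) K : 0 <= K -> (forall j, 0 < Re (w j)) ->
  (forall j, Re (w j) <= Re (w (S j))) ->
  (forall j, Cmod (w (S j) - w j) ^ 2 <= K * (Re (w j) * Re (w (S j)))) ->
  forall n, Re (w n) <= (K + 2) ^ n * Re (w 0%nat) /\
    Cmod (w n - w 0%nat) <= INR n * (K + 2) ^ n * Re (w 0%nat).
Proof.
  intros HK HR Hmono Hst.
  assert (Hs : forall j, Re (w (S j)) <= (K + 2) * Re (w j) /\ Cmod (w (S j) - w j) <= (K + 2) * Re (w j)).
  { intros j. specialize (HR j). specialize (Hmono j). specialize (Hst j).
    assert (A := re_le_Cmod (w (S j) - w j)). rewrite Re_minus, Rabs_pos_eq in A by lra.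
    set (d := Re (w (S j)) - Re (w j)) in *. set (x := Re (w j)) in *.
    assert (Hx : Re (w (S j)) = x + d) by (unfold d; ring). rewrite Hx in *.
    assert (A2 : d ^ 2 <= K * (x * (x + d))).
    { eapply Rle_trans; [|exact Hst]. apply pow_incr. lra. }
    assert (Hd0 : 0 <= d) by lra.
    assert (Hd : d <= (K + 1) * x).
    { apply Rnot_lt_le. intros N.
      assert (0 < d) by nra.
      assert (d * d > (K + 1) * x * d) by (apply Rmult_gt_compat_r; lra).
      assert (K * x * x > x * d) by nra.
      assert (x * (K * x - d) > 0) by nra.
      assert (K * x - d > 0) by nra. nra. }
    split; [lra|].
    assert (B := Cmod_ge_0 (w (S j) - w j)).
    assert (C1 : K * (x * (x + d)) <= ((K + 2) * x) ^ 2).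
    { assert (x + d <= (K + 2) * x) by lra.
      assert (x * (x + d) <= x * ((K + 2) * x)) by (apply Rmult_le_compat_l; lra).
      assert (0 <= x * ((K + 2) * x)) by (apply Rmult_le_pos; [lra|]; apply Rmult_le_pos; lra).
      assert (K * (x * (x + d)) <= K * (x * ((K + 2) * x))) by (apply Rmult_le_compat_l; lra).
      nra. }
    assert (0 < (K + 2) * x) by (apply Rmult_lt_0_compat; lra).
    apply Rnot_lt_le. intros N. nra. }
  induction n as [|n [IH1 IH2]].
  - simpl. rewrite Cmod_sub_diag. lra.
  - destruct (Hs n) as [S1 S2].
    assert (P : 0 < (K + 2) ^ n) by (apply pow_lt; lra).
    assert (HR0 := HR 0%nat).
    assert (Q : (K + 2) * Re (w n) <= (K + 2) ^ S n * Re (w 0%nat)).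
    { simpl. rewrite Rmult_assoc. apply Rmult_le_compat_l; lra. }
    split; [lra|].
    assert (T := Cmod_tri3 (w (S n)) (w n) (w 0%nat)).
    rewrite S_INR.
    assert (INR n * (K + 2) ^ n * Re (w 0%nat) <= INR n * (K + 2) ^ S n * Re (w 0%nat)).
    { rewrite !Rmult_assoc. apply Rmult_le_compat_l; [apply pos_INR|].
      apply Rmult_le_compat_r; [lra|]. simpl.
      assert ((K + 2) ^ n * 1 <= (K + 2) ^ n * (K + 2)) by (apply Rmult_le_compat_l; lra). lra. }
    lra.
Qed.

Lemma holo_tilt g eps : holo RHP g -> holo RHP (fun w => g w + RtoC eps * Ci * w)%C /\
  forall w, RHP w -> C_derive (fun w => g w + RtoC eps * Ci * w)%C w = (C_derive g w + RtoC eps * Ci)%C.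
Proof.
  intros Hg.
  assert (D : forall w, RHP w -> Cder (fun w => g w + RtoC eps * Ci * w)%C w (C_derive g w + RtoC eps * Ci)%C).
  { intros w Hw. apply Cder_plus; [now apply Cder_C_derive, Hg|].
    assert (D := Cder_scal (RtoC eps * Ci)%C (fun w => w) w 1%C (Cder_id w)).
    now rewrite Cmult_1_r in D. }
  split.
  - intros w Hw. eexists. now apply D.
  - intros w Hw. apply C_derive_unique. now apply D.
Qed.

(** The bound is uniform in eps. Along the ray from w0 through w the imaginary
    part of the quotient of the increment of g + i eps w by the direction is
    non-decreasing, and it is already at least k at distance r, because the
    derivative of g at w0 has positive imaginary part. *)
Lemma first_step_bound g w0 : holo RHP g -> (forall w, RHP w -> 0 < Im (C_derive g w)) -> RHP w0 ->
  exists r k, 0 < r /\ 0 < k /\ forall eps, 0 <= eps -> forall w, RHP w ->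
    Cmod (g w + RtoC eps * Ci * w - (g w0 + RtoC eps * Ci * w0)) < k -> Cmod (w - w0) <= r.
Proof.
  intros Hg Hp Hw0.
  assert (Hp0 := Hp w0 Hw0). set (m := Im (C_derive g w0)) in *.
  destruct (proj1 (Cder_eps _ _ _) (Cder_C_derive _ _ (Hg w0 Hw0)) (m / 2)) as [d [Hd Hd']]; [lra|].
  set (r := Rmin d (Re w0) / 2).
  assert (M := Rmin_pos d (Re w0) Hd Hw0). assert (M1 := Rmin_l d (Re w0)). assert (M2 := Rmin_r d (Re w0)).
  assert (Hr : 0 < r) by (unfold r; lra).
  exists r, (m / 2 * r). split; [exact Hr|split; [nra|]].
  intros eps Heps w Hw HG. apply Rnot_lt_le. intros N.
  set (G := fun w => (g w + RtoC eps * Ci * w)%C).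
  change (Cmod (G w - G w0) < m / 2 * r) in HG.
  destruct (holo_tilt g eps Hg) as [HG1 HG2]. fold G in HG1, HG2.
  set (rho := Cmod (w - w0)) in *.
  set (e := ((w - w0) / RtoC rho)%C).
  assert (Hrho : RtoC rho <> 0%C) by (intros E; apply RtoC_inj in E; lra).
  assert (Hww : (w - w0 = RtoC rho * e)%C) by (unfold e; field; exact Hrho).
  assert (He : Cmod e = 1).
  { unfold e. rewrite Cmod_div, Cmod_R by exact Hrho. fold rho.
    rewrite Rabs_pos_eq by lra. field; lra. }
  assert (Hen : e <> 0%C) by (apply Cmod_gt_0; lra).
  set (w1 := (w0 + RtoC r * e)%C).
  assert (Hw10 : (w1 - w0 = RtoC r * e)%C) by (unfold w1; ring).
  assert (Hm10 : Cmod (w1 - w0) = r).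
  { rewrite Hw10, Cmod_mult, Cmod_R, He, Rabs_pos_eq; lra. }
  assert (Hw1 : RHP w1).
  { assert (A := re_le_Cmod (w1 - w0)). rewrite Re_minus, Hm10 in A.
    apply Rabs_le_between in A. unfold RHP in *. unfold r in *. lra. }
  assert (Hww1 : (w - w1 = RtoC (rho - r) * e)%C).
  { replace (w - w1)%C with ((w - w0) - (w1 - w0))%C by ring. rewrite Hww, Hw10, RtoC_minus. ring. }
  assert (Q1 : m / 2 * r <= Im ((G w1 - G w0) / e)%C).
  { assert (E : ((G w1 - G w0) / e = (g w1 - g w0) / e + RtoC (eps * r) * Ci)%C).
    { unfold G. rewrite RtoC_mult. replace (g w1 + RtoC eps * Ci * w1 - (g w0 + RtoC eps * Ci * w0))%C
        with ((g w1 - g w0) + RtoC eps * Ci * (w1 - w0))%C by ring.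
      rewrite Hw10. field. exact Hen. }
    rewrite E, im_plus.
    replace (Im (RtoC (eps * r) * Ci)%C) with (eps * r) by (unfold Im; simpl; ring).
    specialize (Hd' w1). rewrite Hm10 in Hd'. specialize (Hd' ltac:(unfold r; lra)).
    set (Y := ((g w1 - g w0) / e)%C).
    set (l := C_derive g w0) in *.
    assert (E2 : Cmod (g w1 - g w0 - l * (w1 - w0)) = Cmod (Y - RtoC r * l)).
    { replace (g w1 - g w0 - l * (w1 - w0))%C with ((Y - RtoC r * l) * e)%C.
      - rewrite Cmod_mult, He. ring.
      - rewrite Hw10. unfold Y. field. exact Hen. }
    rewrite E2 in Hd'.
    assert (A := im_le_Cmod (Y - RtoC r * l)).
    rewrite Im_minus, im_scal_l in A. fold m in A.
    assert (A' : Rabs (Im Y - r * m) <= m / 2 * r) by lra.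
    apply Rabs_le_between in A'. assert (0 <= eps * r) by nra. lra. }
  assert (Q2 : 0 <= Im ((G w - G w1) / e)%C).
  { assert (n : w1 <> w).
    { intros E. rewrite E in Hm10. fold rho in Hm10. lra. }
    destruct (quotient_mvt G w1 w HG1 Hw1 Hw n) as [xi [Hxi E]].
    rewrite HG2, im_plus in E by exact Hxi.
    replace (Im (RtoC eps * Ci)%C) with eps in E by (unfold Im; simpl; ring).
    specialize (Hp xi Hxi).
    assert (Hrr : RtoC (rho - r) <> 0%C) by (intros E0; apply RtoC_inj in E0; lra).
    replace ((G w - G w1) / e)%C with (RtoC (rho - r) * ((G w - G w1) / (w - w1)))%C.
    2:{ rewrite Hww1. field. split; auto. }
    rewrite im_scal_l. apply Rmult_le_pos; lra. }
  assert (Q3 : m / 2 * r <= Im ((G w - G w0) / e)%C).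
  { replace ((G w - G w0) / e)%C with ((G w1 - G w0) / e + (G w - G w1) / e)%C by (field; exact Hen).
    rewrite im_plus. lra. }
  apply quotient_expands in Q3; [|exact Hen]. rewrite He in Q3. lra.
Qed.

(** The time T is cut into n steps short enough for [first_step_bound]. For
    g + i eps w, whose orbits exist for all times, the steps are controlled by
    the first one, so that the end points of the orbits stay in a compact set
    which does not depend on eps. *)
Lemma positive_upward g : holo RHP g -> (forall w, RHP w -> 0 < Im (C_derive g w)) -> upward g.
Proof.
  intros Hg Hp w0 T Hw0 HT.
  destruct (first_step_bound g w0 Hg Hp Hw0) as [r [k [Hr [Hk Hstep]]]].
  assert (Hn : exists n : nat, (0 < n)%nat /\ T < k * INR n).
  { destruct (INR_archimed k T Hk) as [n Hn]. exists (S n). split; [lia|].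
    rewrite S_INR. nra. }
  destruct Hn as [n [Hn0 Hn]].
  assert (HnR : 0 < INR n) by now apply lt_0_INR.
  destruct (Req_dec T 0) as [->|HT0].
  { exists w0. split; auto. ring. }
  set (del := T / INR n).
  assert (Hdel : 0 < del) by (apply Rdiv_lt_0_compat; lra).
  assert (Hdelk : del < k) by (apply Rlt_div_l; lra).
  set (x0 := Re w0). assert (Hx0 : 0 < x0) by exact Hw0.
  (* orbits start at w0 and move right, so the first step has squared
     hyperbolic length at most K *)
  set (K := r ^ 2 / x0 ^ 2).
  assert (HK : 0 <= K).
  { apply Rdiv_le_0_compat; [apply pow2_ge_0|apply pow_lt; lra]. }
  set (Bd := INR n * (K + 2) ^ n * x0).
  assert (Hb : forall eps, 0 < eps -> exists w, x0 <= Re w /\ Cmod (w - w0) <= Bd /\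
     (g w + RtoC eps * Ci * w)%C = (g w0 + RtoC eps * Ci * w0 + Ci * RtoC T)%C).
  { intros eps Heps.
    set (G := fun w => (g w + RtoC eps * Ci * w)%C).
    destruct (holo_tilt g eps Hg) as [HG1 HG2]. fold G in HG1, HG2.
    assert (HGm : forall w, RHP w -> eps <= Im (C_derive G w)).
    { intros w Hw. rewrite HG2, im_plus by exact Hw. specialize (Hp w Hw).
      replace (Im (RtoC eps * Ci)%C) with eps by (unfold Im; simpl; ring). lra. }
    assert (HGp : forall w, RHP w -> 0 < Im (C_derive G w)).
    { intros w Hw. specialize (HGm w Hw). lra. }
    assert (HGi := positive_injective G HG1 HGp).
    assert (Hlift := lift_of_lower_bound G eps HG1 Heps HGm).
    assert (HGup : upward G).
    { intros a t Ha Ht. destruct (Hlift a t Ha Ht) as [a' [h1 [_ h2]]]. now exists a'. }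
    assert (Hch : forall j : nat, exists w, RHP w /\ G w = (G w0 + Ci * RtoC (INR j * del))%C).
    { intros j. destruct (Hlift w0 (INR j * del) Hw0) as [a' [h1 [_ h2]]].
      - apply Rmult_le_pos; [apply pos_INR|lra].
      - now exists a'. }
    set (w := fun j => proj1_sig (constructive_indefinite_description _ (Hch j))).
    assert (Hw : forall j, RHP (w j) /\ G (w j) = (G w0 + Ci * RtoC (INR j * del))%C).
    { intros j. unfold w. exact (proj2_sig (constructive_indefinite_description _ (Hch j))). }
    assert (Ew0 : w 0%nat = w0).
    { apply HGi; [apply Hw|exact Hw0|]. rewrite (proj2 (Hw 0%nat)). simpl INR.
      rewrite Rmult_0_l. ring. }
    assert (Hst : forall j, G (w (S j)) = (G (w j) + Ci * RtoC del)%C).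
    { intros j. rewrite (proj2 (Hw (S j))), (proj2 (Hw j)), S_INR.
      rewrite Rmult_plus_distr_r, Rmult_1_l, RtoC_plus. ring. }
    assert (Hmono : forall j, Re (w j) <= Re (w (S j))).
    { intros j. apply (positive_flow_right G (w j) (w (S j)) del); auto; try apply Hw. lra. }
    assert (H1 : Cmod (w 1%nat - w 0%nat) <= r).
    { rewrite Ew0. apply (Hstep eps); [lra|apply Hw|].
      change (Cmod (G (w 1%nat) - G w0) < k). rewrite <- Ew0 at 1. rewrite Hst.
      replace (G (w 0%nat) + Ci * RtoC del - G (w 0%nat))%C with (Ci * RtoC del)%C by ring.
      rewrite Cmod_vertical, Rabs_pos_eq; lra. }
    assert (Hsteps := orbit_steps G w del r HG1 HGi HGup Hdel (fun j => proj1 (Hw j)) Hst Hmono H1).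
    rewrite Ew0 in Hsteps. fold x0 in Hsteps. fold K in Hsteps.
    destruct (orbit_bounded w K HK (fun j => proj1 (Hw j)) Hmono Hsteps n) as [_ Hbn].
    rewrite Ew0 in Hbn. fold x0 in Hbn. fold Bd in Hbn.
    exists (w n). split; [|split; [exact Hbn|]].
    - apply (positive_flow_right G w0 (w n) (INR n * del)); auto; try apply Hw.
      apply Rmult_le_pos; lra.
    - change (G (w n) = (G w0 + Ci * RtoC T)%C). rewrite (proj2 (Hw n)).
      do 3 f_equal. unfold del. field. lra. }
  destruct (compact_attain g (g w0 + Ci * RtoC T)%C x0 w0 Bd Hg Hx0) as [w [h1 [_ h3]]].
  - intros eta Heta.
    assert (HB0 : 0 <= Bd).
    { unfold Bd. apply Rmult_le_pos; [apply Rmult_le_pos; [lra|apply pow_le; lra]|lra]. }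
    destruct (Hb (eta / (Bd + 1))) as [w [h1 [h2 h3]]]; [apply Rdiv_lt_0_compat; lra|].
    exists w. split; [exact h1|split; [exact h2|]].
    set (eps := eta / (Bd + 1)) in *.
    assert (Heps : 0 < eps) by (apply Rdiv_lt_0_compat; lra).
    replace (g w - (g w0 + Ci * RtoC T))%C with (- (RtoC eps * Ci) * (w - w0))%C.
    + rewrite Cmod_mult, Cmod_opp, Cmod_mult, Cmod_R, Cmod_Ci, Rabs_pos_eq by lra.
      assert (eps * (Bd + 1) = eta) by (unfold eps; field; lra). nra.
    + replace (g w) with (g w + RtoC eps * Ci * w - RtoC eps * Ci * w)%C by ring.
      rewrite h3. ring.
  - exists w. split; [unfold RHP; lra|exact h3].
Qed.

(** The orbit of 1 climbs to every height and stays in Re w >= 1; were it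
    bounded, g would be unbounded on a compact set. *)
Lemma positive_far g : holo RHP g -> (forall w, RHP w -> 0 < Im (C_derive g w)) ->
  high_near_infinity g.
Proof.
  intros Hg Hp Rb M. apply NNPP. intros N.
  assert (Hup := positive_upward g Hg Hp).
  assert (H1 : RHP 1%C) by (unfold RHP; rewrite re_RtoC; lra).
  destruct (usc_attains_max (fun w => 1 <= Re w /\ Cmod w <= Rmax Rb 1) (fun w => Im (g w)) (Rmax Rb 1))
    as [c [_ Hmax]].
  - exists 1%C. rewrite re_RtoC, Cmod_1. split; [lra|apply Rmax_r].
  - intros w [_ h]. exact h.
  - intros w Hw. destruct (Rlt_le_dec (Re w) 1) as [h|h].
    + exists (1 - Re w). split; [lra|]. intros w' Hw' [h1 _].
      assert (A := re_le_Cmod (w' - w)). rewrite Re_minus in A.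
      assert (A' := Rle_abs (Re w' - Re w)). lra.
    + destruct (Rlt_le_dec (Rmax Rb 1) (Cmod w)) as [h'|h'].
      * exists (Cmod w - Rmax Rb 1). split; [lra|]. intros w' Hw' [_ h2].
        assert (T := Cmod_tri_inv w w'). rewrite (Cmod_sub_sym w w') in T. lra.
      * exfalso. apply Hw. auto.
  - intros w M' [h1 _] HM.
    destruct (Ccont_Re_lt (fun w => - Ci * g w)%C w M') as [d [Hd Hd']].
    { apply Ccont_mult; [apply Ccont_const|]. apply differentiable_cont, Hg. unfold RHP; lra. }
    { unfold Re, Im in *; simpl in *; lra. }
    exists d. split; auto. intros w' _ Hw'. specialize (Hd' w' Hw').
    unfold Re, Im in *; simpl in *; lra.
  - set (T := Rmax 0 (Rmax M (Im (g c)) - Im (g 1%C) + 1)).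
    destruct (Hup 1%C T H1 (Rmax_l _ _)) as [b [Hb Eb]].
    assert (HR := positive_flow_right g 1%C b T Hg Hp H1 Hb (Rmax_l _ _) Eb).
    rewrite re_RtoC in HR.
    assert (HI : Im (g b) = Im (g 1%C) + T) by (rewrite Eb; apply Im_vertical).
    assert (HT := Rmax_r 0 (Rmax M (Im (g c)) - Im (g 1%C) + 1)). fold T in HT.
    assert (A1 := Rmax_l M (Im (g c))). assert (A2 := Rmax_r M (Im (g c))).
    destruct (Rlt_le_dec (Rmax Rb 1) (Cmod b)) as [h|h].
    + apply N. exists b. repeat split; auto; [|lra]. assert (A3 := Rmax_l Rb 1). lra.
    + specialize (Hmax b (conj HR h)). lra.
Qed.

(** * The equality case *)

Lemma RInt_zero_nonneg (f : R -> R) a b : (forall t, continuous f t) -> (forall t, 0 <= f t) ->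
  RInt f a b = 0 -> forall t, a < t < b -> f t = 0.
Proof.
  intros Hc Hp H0 t Ht.
  apply Rle_antisym; [|apply Hp]. apply Rnot_lt_le. intros N.
  assert (I : forall x y, ex_RInt f x y).
  { intros x y. apply (ex_RInt_continuous (V := R_CompleteNormedModule)). auto. }
  destruct (proj1 (filterlim_locally f (f t)) (Hc t) (mkposreal _ N)) as [d Hd].
  set (e := Rmin d (Rmin (t - a) (b - t)) / 2).
  assert (Hd0 := cond_pos d).
  assert (M1 := Rmin_l d (Rmin (t - a) (b - t))). assert (M2 := Rmin_r d (Rmin (t - a) (b - t))).
  assert (M3 := Rmin_l (t - a) (b - t)). assert (M4 := Rmin_r (t - a) (b - t)).
  assert (M : 0 < Rmin d (Rmin (t - a) (b - t))) by (repeat apply Rmin_pos; lra).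
  assert (P : 0 < RInt f (t - e) (t + e)).
  { apply RInt_gt_0; [unfold e; lra| |auto]. intros x Hx.
    assert (B : ball t d x).
    { change (Rabs (x - t) < d). apply Rabs_lt_between. unfold e in Hx. lra. }
    specialize (Hd x B). change (Rabs (f x - f t) < f t) in Hd.
    apply Rabs_lt_between in Hd. lra. }
  rewrite <- (RInt_Chasles (V := R_CompleteNormedModule) f a (t - e) b) in H0; auto.
  rewrite <- (RInt_Chasles (V := R_CompleteNormedModule) f (t - e) (t + e) b) in H0; auto.
  assert (Q1 : 0 <= RInt f a (t - e)) by (apply RInt_ge_0; auto; unfold e; lra).
  assert (Q2 : 0 <= RInt f (t + e) b) by (apply RInt_ge_0; auto; unfold e; lra).
  unfold plus in H0; simpl in H0. lra.
Qed.

Lemma Im_monotone g a b : holo RHP g -> (forall w, RHP w -> 0 <= Im (C_derive g w)) ->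
  RHP a -> RHP b -> Im a = Im b -> Re a <= Re b -> Im (g a) <= Im (g b).
Proof.
  intros Hg Hp Ha Hb HI HR.
  destruct (Ceq_dec a b) as [->|n]; [lra|].
  destruct (quotient_mvt g a b Hg Ha Hb n) as [xi [Hxi E]].
  specialize (Hp xi Hxi). rewrite <- E in Hp.
  assert (Eba : (b - a)%C = RtoC (Re b - Re a)).
  { apply Ceq_ReIm; unfold Re, Im in *; simpl; lra. }
  assert (Hlt : Re a <> Re b) by (intros E'; apply n; now apply Ceq_ReIm).
  assert (Hnz : RtoC (Re b - Re a) <> 0%C) by (intros E'; apply RtoC_inj in E'; lra).
  assert (F : (g b - g a)%C = (RtoC (Re b - Re a) * ((g b - g a) / (b - a)))%C).
  { rewrite Eba. field. exact Hnz. }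
  apply (f_equal Im) in F. rewrite im_scal_l, Im_minus in F.
  assert (0 <= (Re b - Re a) * Im ((g b - g a) / (b - a))%C) by (apply Rmult_le_pos; lra).
  lra.
Qed.

(** Let rf be the mirror in the vertical line through c. The function
    G w = g w + conj (g (rf w)) is holomorphic, and Im (G w) is the increment of
    Im g from rf w to w. The mean value property for (G w - G c) / (w - c) and
    for (w - c) (G w - G c) yields that these increments, weighted by cos t on
    the circle, have mean value proportional to Im g' (c) = 0. The weight has
    the sign of the increment, since Im g is non-decreasing along horizontal
    lines. So each increment vanishes. *)
Lemma critical_symmetry g c r X Y : holo RHP g -> (forall w, RHP w -> 0 <= Im (C_derive g w)) ->
  RHP c -> Im (C_derive g c) = 0 -> 0 < r -> r < Re c -> 0 < X -> X ^ 2 + Y ^ 2 = r ^ 2 ->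
  Im (g (c + (X, Y))%C) = Im (g (c + (- X, Y)%R)%C).
Proof.
  intros Hg Hp Hc Hc0 Hr HrR HX HXY.
  set (rf := fun w : C => (RtoC (2 * Re c) + - (1) * Cconj w)%C).
  set (G := fun w => (g w + Cconj (g (rf w)))%C).
  assert (Hnear : forall w, Cmod (w - c) < Re c -> RHP w /\ RHP (rf w)).
  { intros w Hw. assert (A := re_le_Cmod (w - c)). rewrite Re_minus in A.
    assert (A' : Rabs (Re w - Re c) < Re c) by lra. apply Rabs_lt_between in A'.
    split; [unfold RHP; lra|]. unfold RHP, rf, Re in *; simpl; lra. }
  assert (HG : forall w, Cmod (w - c) < Re c -> Cder G w (C_derive g w + Cconj (C_derive g (rf w) * (0 + - (1) * 1)))%C).
  { intros w Hw. destruct (Hnear w Hw) as [h1 h2].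
    apply Cder_plus; [now apply Cder_C_derive, Hg|].
    apply (Cder_conj_conj (fun w => g (RtoC (2 * Re c) + - (1) * w)%C)).
    apply (Cder_comp (fun w => RtoC (2 * Re c) + - (1) * w)%C g).
    - apply Cder_plus; [apply Cder_const|apply Cder_scal, Cder_id].
    - now apply Cder_C_derive, Hg. }
  assert (Hcc : Cmod (c - c) < Re c) by (rewrite Cmod_sub_diag; exact Hc).
  assert (Erf : rf c = c) by (apply Ceq_ReIm; unfold rf, Re, Im; simpl; ring).
  assert (Dc := HG c Hcc). rewrite Erf in Dc.
  assert (CG := Cder_cont _ _ _ Dc).
  destruct Dc as [q [Hq [Eq HGq]]].
  assert (EqI : Im (q c) = 0).
  { rewrite Eq. replace (0 + - (1) * 1)%C with (RtoC (-1)).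
    - rewrite im_plus, im_conj, im_scal_r, Hc0. ring.
    - apply Ceq_ReIm; unfold Re, Im; simpl; ring. }
  assert (Hqd : forall w, 0 < Cmod (w - c) < Re c -> differentiable_at q w).
  { intros w [h1 h2].
    assert (nw : w <> c) by (intros ->; rewrite Cmod_sub_diag in h1; lra).
    eexists.
    apply (Cder_ext_loc (fun w => (G w - G c) * / (w - c))%C q w _ (Cmod (w - c)) h1).
    - intros w' Hw'. rewrite (HGq w'). field.
      apply Cminus_eq_contra. intros ->. rewrite Cmod_sub_sym in Hw'. lra.
    - apply Cder_mult; [apply Cder_sub_const, HG; exact h2|].
      apply Cder_inv; [apply Cder_sub_const, Cder_id|]. now apply Cminus_eq_contra. }
  (* on the circle w - c = r exp (i t) the bracket is
     (2 cos t / r) (G w - G c) *)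
  set (F := fun w => (- Ci * (q w + (w - c) * (G w - G c) * RtoC (/ r ^ 2)))%C).
  assert (HFd : forall w, 0 < Cmod (w - c) < Re c -> differentiable_at F w).
  { intros w Hw. destruct (Hqd w Hw) as [l Hl]. eexists. unfold F.
    apply Cder_scal, Cder_plus; [exact Hl|].
    apply Cder_mult; [|apply Cder_const].
    apply Cder_mult; [apply Cder_sub_const, Cder_id|apply Cder_sub_const, HG, Hw]. }
  assert (HF : RInt (fun t => Re (F (on_circle c r t))) 0 (2 * PI) = 0).
  { rewrite (mean_value F c (Re c) r Hr HrR); [| |exact HFd].
    - replace (Re (F c)) with (Im (q c)); [rewrite EqI; apply Rmult_0_r|].
      unfold F. replace (c - c)%C with (RtoC 0) by ring. unfold Re, Im; simpl; ring.
    - unfold F. apply Ccont_mult; [apply Ccont_const|]. apply Ccont_plus; [exact Hq|].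
      apply Ccont_mult; [|apply Ccont_const].
      apply Ccont_mult; [apply Ccont_sub_const, Ccont_id|now apply Ccont_sub_const]. }
  assert (Hdist : forall t, Cmod (on_circle c r t - c) = r) by (intros; apply on_circle_dist; lra).
  assert (HFv : forall t, Re (F (on_circle c r t)) =
     2 / r * cos t * (Im (g (on_circle c r t)) - Im (g (rf (on_circle c r t))))).
  { intros t. set (w := on_circle c r t).
    assert (Ew : (w - c = polar r t)%C) by (unfold w, on_circle; ring).
    assert (EG : (G w - G c = q w * polar r t)%C) by (rewrite (HGq w), Ew; ring).
    assert (EI : Im (g w) - Im (g (rf w)) = Im (q w * polar r t)%C).
    { rewrite <- EG. unfold G. rewrite Erf. unfold Im; simpl; ring. }
    rewrite EI. unfold F. rewrite EG, Ew.
    assert (S := sin2_cos2 t). unfold Rsqr in S.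
    unfold polar, Re, Im; simpl.
    set (q1 := fst (q w)). set (q2 := snd (q w)).
    set (co := cos t) in *. set (si := sin t) in *.
    apply Rminus_diag_uniq. transitivity (q2 * (1 - (si * si + co * co))).
    - field. lra.
    - rewrite S. ring. }
  assert (Hin : forall t, RHP (on_circle c r t) /\ RHP (rf (on_circle c r t))).
  { intros t. apply Hnear. rewrite Hdist. lra. }
  assert (HFp : forall t, 0 <= Re (F (on_circle c r t))).
  { intros t. rewrite HFv. destruct (Hin t) as [h1 h2].
    assert (E : Im (on_circle c r t) = Im (rf (on_circle c r t))) by (unfold rf, Im; simpl; ring).
    assert (E2 : Re (on_circle c r t) - Re (rf (on_circle c r t)) = 2 * (r * cos t))
      by (unfold rf, on_circle, polar, Re; simpl; ring).
    assert (H2r : 0 < 2 / r) by (apply Rdiv_lt_0_compat; lra).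
    destruct (Rle_lt_dec 0 (cos t)) as [h|h].
    - assert (L := Im_monotone g _ _ Hg Hp h2 h1 (eq_sym E) ltac:(nra)).
      apply Rmult_le_pos; [apply Rmult_le_pos; lra|lra].
    - assert (L := Im_monotone g _ _ Hg Hp h1 h2 E ltac:(nra)).
      rewrite Rmult_assoc. apply Rmult_le_pos; [lra|]. nra. }
  assert (HFc : forall t, continuous (fun t => Re (F (on_circle c r t))) t).
  { intros t. apply circle_continuous; [exact Hr|]. apply HFd. rewrite Hdist. lra. }
  (* the angle of (-X, Y) lies strictly inside (0, 2 PI) *)
  set (tau := asin (Y / r)).
  assert (HYr : -1 <= Y / r <= 1).
  { assert (-r <= Y <= r) by nra.
    split; [apply Rle_div_r|apply Rle_div_l]; lra. }
  assert (Btau := asin_bound (Y / r)). fold tau in Btau.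
  assert (HPI := PI_RGT_0).
  assert (Hz := RInt_zero_nonneg _ 0 (2 * PI) HFc HFp HF (PI - tau) ltac:(lra)).
  cbv beta in Hz. rewrite HFv in Hz.
  assert (Esin : sin (PI - tau) = Y / r).
  { rewrite sin_PI_x. unfold tau. now apply sin_asin. }
  assert (Ecos : cos (PI - tau) = - (X / r)).
  { rewrite Rtrigo_facts.cos_pi_minus. unfold tau. rewrite cos_asin by exact HYr. f_equal.
    replace (1 - (Y / r)²) with ((X / r)²).
    - apply sqrt_Rsqr. left. apply Rdiv_lt_0_compat; lra.
    - unfold Rsqr. replace 1 with (r ^ 2 / r ^ 2) by (field; lra). rewrite <- HXY at 1. field. lra. }
  assert (Ep : on_circle c r (PI - tau) = (c + (- X, Y)%R)%C).
  { unfold on_circle. f_equal. unfold polar. rewrite Esin, Ecos.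
    apply Ceq_ReIm; unfold Re, Im; simpl; field; lra. }
  assert (Ep2 : rf (on_circle c r (PI - tau)) = (c + (X, Y))%C).
  { rewrite Ep. apply Ceq_ReIm; unfold rf, Re, Im; simpl; ring. }
  rewrite Ep2, Ep, Ecos in Hz.
  assert (HXr : 0 < X / r) by (apply Rdiv_lt_0_compat; lra).
  assert (H2r : 0 < 2 / r) by (apply Rdiv_lt_0_compat; lra).
  apply Rmult_integral in Hz. destruct Hz as [Hz|Hz]; [|lra].
  assert (0 < 2 / r * (X / r)) by (apply Rmult_lt_0_compat; lra). lra.
Qed.

(** By [critical_symmetry] the monotone function Im g takes the same value at
    both ends of a horizontal chord, hence is constant on it. *)
Lemma critical_ball g c w : holo RHP g -> (forall w, RHP w -> 0 <= Im (C_derive g w)) ->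
  RHP c -> Im (C_derive g c) = 0 -> Cmod (w - c) < Re c -> Im (C_derive g w) = 0.
Proof.
  intros Hg Hp Hc Hc0 Hw.
  set (r := (Cmod (w - c) + Re c) / 2).
  assert (A0 := Cmod_ge_0 (w - c)).
  assert (Hr : Cmod (w - c) < r < Re c) by (unfold r; lra).
  set (u := Re (w - c)). set (Y := Im (w - c)).
  assert (E2 : u ^ 2 + Y ^ 2 = Cmod (w - c) ^ 2) by (unfold u, Y; now rewrite Cmod2_alt).
  assert (Hpos : 0 < r ^ 2 - Y ^ 2) by nra.
  set (X := sqrt (r ^ 2 - Y ^ 2)).
  assert (HX : 0 < X) by now apply sqrt_lt_R0.
  assert (HX2 : X ^ 2 = r ^ 2 - Y ^ 2) by (unfold X; rewrite pow2_sqrt; lra).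
  assert (Hu : - X < u < X) by (split; nra).
  assert (S := critical_symmetry g c r X Y Hg Hp Hc Hc0 ltac:(lra) ltac:(lra) HX ltac:(lra)).
  assert (HXr : X <= r) by nra.
  set (a := (c + (- X, Y)%R)%C) in *. set (b := (c + (X, Y))%C) in *.
  assert (Ha : RHP a) by (unfold RHP, a, Re in *; simpl; lra).
  assert (Hb : RHP b) by (unfold RHP, b, Re in *; simpl; lra).
  (* Im g is constant on the horizontal chord through w *)
  assert (Hch : forall z : C, Im z = Im w -> Re a <= Re z <= Re b -> Im (g z) = Im (g a)).
  { intros z Hz HzR.
    assert (EI : Im w = Im c + Y) by (unfold Y; rewrite Im_minus; ring).
    assert (Hzp : RHP z) by (unfold RHP in *; lra).
    assert (L1 := Im_monotone g a z Hg Hp Ha Hzp). assert (L2 := Im_monotone g z b Hg Hp Hzp Hb).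
    assert (EA : Im a = Im c + Y) by (unfold a, Im; simpl; ring).
    assert (EB : Im b = Im c + Y) by (unfold b, Im; simpl; ring).
    specialize (L1 ltac:(lra) ltac:(lra)). specialize (L2 ltac:(lra) ltac:(lra)). lra. }
  assert (Ew : Re w = Re c + u) by (unfold u; rewrite Re_minus; ring).
  assert (ERa : Re a = Re c - X) by (unfold a, Re; simpl; ring).
  assert (ERb : Re b = Re c + X) by (unfold b, Re; simpl; ring).
  assert (Hwp : RHP w) by (unfold RHP in *; lra).
  assert (D := Cder_C_derive _ _ (Hg w Hwp)). set (l := C_derive g w) in *.
  specialize (Hp w Hwp). fold l in Hp.
  apply Rle_antisym; [|exact Hp]. apply Rnot_lt_le. intros N.
  destruct (proj1 (Cder_eps _ _ _) D (Im l / 2)) as [d [Hd Hd']]; [lra|].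
  set (h := Rmin d (X - u) / 2).
  assert (M := Rmin_pos d (X - u) Hd ltac:(lra)).
  assert (M1 := Rmin_l d (X - u)). assert (M2 := Rmin_r d (X - u)).
  assert (Hh : 0 < h) by (unfold h; lra).
  specialize (Hd' (w + RtoC h)%C).
  replace (w + RtoC h - w)%C with (RtoC h) in Hd' by ring.
  rewrite Cmod_R, Rabs_pos_eq in Hd' by lra. specialize (Hd' ltac:(unfold h; lra)).
  assert (A := im_le_Cmod (g (w + RtoC h)%C - g w - l * RtoC h)).
  rewrite !Im_minus, im_scal_r in A.
  rewrite (Hch (w + RtoC h)%C), (Hch w) in A; try lra.
  - replace (Im (g a) - Im (g a) - Im l * h) with (- (Im l * h)) in A by ring.
    rewrite Rabs_Ropp, Rabs_pos_eq in A by nra. nra.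
  - rewrite im_plus, im_RtoC. ring.
  - rewrite re_plus, re_RtoC. unfold h. lra.
Qed.

(** The balls that touch the boundary, with centres on the horizontal line
    through c at real parts (3/2)^n Re c, exhaust the half-plane. *)
Lemma critical_everywhere g c : holo RHP g -> (forall w, RHP w -> 0 <= Im (C_derive g w)) ->
  RHP c -> Im (C_derive g c) = 0 -> forall w, RHP w -> Im (C_derive g w) = 0.
Proof.
  intros Hg Hp Hc Hc0 w Hw.
  (* each centre lies in the previous ball, at half its radius *)
  set (z := fun n => (Re c * (3 / 2) ^ n, Im c) : C).
  assert (Hz : forall n, RHP (z n) /\ Im (C_derive g (z n)) = 0).
  { induction n as [|n [IH1 IH2]].
    - unfold z. simpl. rewrite Rmult_1_r. rewrite <- surjective_pairing. auto.
    - assert (P : 0 < (3 / 2) ^ n) by (apply pow_lt; lra).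
      assert (Q : 0 < Re c * (3 / 2) ^ n) by (apply Rmult_lt_0_compat; auto).
      split; [apply Rmult_lt_0_compat; [exact Hc|apply pow_lt; lra]|].
      apply (critical_ball g (z n)); auto.
      replace (z (S n) - z n)%C with (RtoC (Re c * (3 / 2) ^ n / 2)).
      + rewrite Cmod_R, Rabs_pos_eq by lra. unfold z, Re at 2; simpl. lra.
      + apply Ceq_ReIm; unfold z, Re, Im; simpl; field. }
  unfold RHP in Hc, Hw.
  set (B := (Re w ^ 2 + (Im w - Im c) ^ 2) / (2 * Re w) / Re c).
  destruct (Pow_x_infinity (3 / 2)) with (b := Rabs B + 1) as [n Hn].
  { rewrite Rabs_pos_eq; lra. }
  specialize (Hn n (le_n n)).
  assert (P : 0 < (3 / 2) ^ n) by (apply pow_lt; lra).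
  rewrite Rabs_pos_eq in Hn by lra.
  assert (HB := Rle_abs B). assert (HBn : B < (3 / 2) ^ n) by lra.
  unfold B in HBn. apply (proj1 (Rlt_div_l _ _ _ Hc)) in HBn.
  assert (H2w : 0 < 2 * Re w) by lra.
  apply (proj1 (Rlt_div_l _ _ _ H2w)) in HBn.
  destruct (Hz n) as [h1 h2].
  apply (critical_ball g (z n)); auto.
  set (X := Re c * (3 / 2) ^ n) in *.
  assert (EX : Re (z n) = X) by reflexivity. rewrite EX.
  assert (A := Cmod_ge_0 (w - z n)).
  assert (E : Cmod (w - z n) ^ 2 = (Re w - X) ^ 2 + (Im w - Im c) ^ 2).
  { rewrite Cmod2_alt, Re_minus, Im_minus, EX. reflexivity. }
  assert (HX : 0 < X) by (unfold RHP in h1; lra).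
  apply Rnot_le_lt. intros N.
  assert (N2 : X ^ 2 <= Cmod (w - z n) ^ 2) by (apply pow_incr; lra).
  assert (HBX : Re w ^ 2 + (Im w - Im c) ^ 2 < X * (2 * Re w)) by (unfold X; lra).
  rewrite E in N2. lra.
Qed.

(** All difference quotients are real. For three points that are not collinear
    this makes the three quotients equal, so all quotients equal the one
    between 1 and 1 + i; points on the line through these two are compared
    through the point 2. *)
Lemma affine_of_real_derivative g : holo RHP g -> (forall w, RHP w -> Im (C_derive g w) = 0) ->
  exists (a : R) (b : C), forall w, RHP w -> g w = (RtoC a * w + b)%C.
Proof.
  intros Hg H0.
  assert (Q : forall z w, RHP z -> RHP w -> exists k : R, (g w - g z = RtoC k * (w - z))%C).
  { intros z w Hz Hw. destruct (Ceq_dec z w) as [->|n].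
    - exists 0. ring.
    - destruct (quotient_mvt g z w Hg Hz Hw n) as [xi [Hxi E]]. rewrite (H0 xi Hxi) in E.
      exists (Re ((g w - g z) / (w - z))%C).
      replace (RtoC (Re ((g w - g z) / (w - z))%C)) with ((g w - g z) / (w - z))%C.
      + field. apply Cminus_eq_contra; auto.
      + apply Ceq_ReIm; [now rewrite re_RtoC|rewrite im_RtoC; exact E]. }
  set (d := (1, 1) : C).
  assert (H1 : RHP 1%C) by (unfold RHP; rewrite re_RtoC; lra).
  assert (Hd : RHP d) by (unfold RHP, d, Re; simpl; lra).
  destruct (Q 1%C d H1 Hd) as [k Hk].
  (* off the vertical line through 1 and 1 + i *)
  assert (Hoff : forall w, RHP w -> Re w <> 1 -> (g w - g 1%C = RtoC k * (w - 1))%C).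
  { intros w Hw e.
    destruct (Q 1%C w H1 Hw) as [m Hm]. destruct (Q d w Hd Hw) as [n Hn].
    assert (E : (RtoC m * (w - 1) = RtoC n * (w - d) + RtoC k * (d - 1))%C).
    { rewrite <- Hm, <- Hn, <- Hk. ring. }
    assert (E1 := f_equal Re E). assert (E2 := f_equal Im E).
    unfold d, Re, Im in *; simpl in *.
    assert (m = n) by (apply (Rmult_eq_reg_r (fst w - 1)); lra). subst n.
    assert (k = m) by lra. now subst m. }
  assert (H2 : RHP 2%C) by (unfold RHP; rewrite re_RtoC; lra).
  assert (Hk2 := Hoff 2%C H2 ltac:(rewrite re_RtoC; lra)).
  exists k, (g 1%C - RtoC k)%C. intros w Hw.
  cut ((g w - g 1%C = RtoC k * (w - 1))%C).
  { intros E. replace (g w) with (g w - g 1%C + g 1%C)%C by ring. rewrite E. ring. }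
  destruct (Req_dec (Re w) 1) as [e|e]; [|now apply Hoff].
  destruct (Q 1%C w H1 Hw) as [m Hm]. destruct (Q 2%C w H2 Hw) as [n Hn].
  assert (E : (RtoC m * (w - 1) = RtoC n * (w - 2) + RtoC k * (2 - 1))%C).
  { rewrite <- Hm, <- Hn, <- Hk2. ring. }
  assert (E1 := f_equal Re E). assert (E2 := f_equal Im E).
  rewrite Hm. unfold Re, Im in *; simpl in *. rewrite e in *.
  assert (n = k) by lra. subst n.
  apply Ceq_ReIm; unfold Re, Im; simpl; rewrite ?e; lra.
Qed.

(** * Domains, limits superior, and the passage from the disk to the half-plane *)

Lemma open_Copen (U : C -> Prop) : open U <-> Copen U.
Proof.
  split.
  - intros H c Hc. destruct (H c Hc) as [e He]. exists e. split; [apply cond_pos|].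
    intros w Hw. apply He.
    assert (A1 := re_le_Cmod (w - c)). assert (A2 := im_le_Cmod (w - c)).
    rewrite Re_minus in A1. rewrite Im_minus in A2.
    split.
    + change (Rabs (Re w - Re c) < e). lra.
    + change (Rabs (Im w - Im c) < e). lra.
  - intros H c Hc. destruct (H c Hc) as [r [Hr Hr']].
    assert (Hr2 : 0 < r / 2) by lra.
    exists (mkposreal _ Hr2). intros w [h1 h2].
    change (Rabs (Re w - Re c) < r / 2) in h1. change (Rabs (Im w - Im c) < r / 2) in h2.
    apply Hr'. eapply Rle_lt_trans; [apply Cmod_le_ReIm|]. rewrite Re_minus, Im_minus. lra.
Qed.

Lemma unit_disk_open : Copen unit_disk.
Proof.
  intros c Hc. unfold unit_disk in *. exists (1 - Cmod c). split; [lra|].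
  intros w Hw. assert (T := Cmod_tri_inv w c). lra.
Qed.

Lemma unit_disk_segment a b t : unit_disk a -> unit_disk b -> 0 <= t <= 1 ->
  unit_disk (a + RtoC t * (b - a))%C.
Proof.
  unfold unit_disk. intros Ha Hb Ht.
  replace (a + RtoC t * (b - a))%C with (RtoC (1 - t) * a + RtoC t * b)%C
    by (rewrite RtoC_minus; ring).
  eapply Rle_lt_trans; [apply Cmod_triangle|]. rewrite !Cmod_mult, !Cmod_R, !Rabs_pos_eq by lra.
  destruct (Req_dec t 0) as [->|n]; nra.
Qed.

(** A separation of the image would separate the image of a segment of the
    disk; the supremum of the parameters that land in one of the two open sets
    can belong to neither. *)
Lemma image_is_domain h : holo unit_disk h -> injective_on unit_disk h ->
  is_domain (image h unit_disk).
Proof.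
  intros Hh Hi. split; [|split].
  - exists (h 0%C), 0%C. split; [|reflexivity]. unfold unit_disk. rewrite Cmod_0; lra.
  - apply open_Copen. intros w [z [Hz <-]].
    destruct (open_image unit_disk h z 1 unit_disk_open Hh Hi Hz ltac:(lra)) as [d [Hd Hd']].
    exists d. split; auto. intros q Hq. destruct (Hd' q Hq) as [z' [Hz' [_ E]]]. now exists z'.
  - intros U V HU HV Hcov [u [[a [Ha Ea]] Hu]] [v [[b [Hb Eb]] Hv]].
    subst u v. apply NNPP. intros N.
    assert (Hdisj : forall z, unit_disk z -> U (h z) -> V (h z) -> False).
    { intros z Hz h1 h2. apply N. exists (h z). repeat split; auto. now exists z. }
    set (p := fun t => (a + RtoC t * (b - a))%C).
    assert (Hp : forall t, 0 <= t <= 1 -> unit_disk (p t)) by (intros; now apply unit_disk_segment).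
    assert (Hpd : forall s t, Cmod (p t - p s) = Rabs (t - s) * Cmod (b - a)).
    { intros s t. replace (p t - p s)%C with (RtoC (t - s) * (b - a))%C
        by (unfold p; rewrite RtoC_minus; ring). now rewrite Cmod_mult, Cmod_R. }
    assert (Hloc : forall W, open W -> forall s, 0 <= s <= 1 -> W (h (p s)) ->
       exists d, 0 < d /\ forall t, Rabs (t - s) < d -> W (h (p t))).
    { intros W HW s Hs Hws. apply open_Copen in HW. destruct (HW _ Hws) as [e [He He']].
      destruct (differentiable_cont h (p s) (Hh _ (Hp s Hs)) e He) as [d [Hd Hd']].
      assert (A := Cmod_ge_0 (b - a)).
      exists (d / (Cmod (b - a) + 1)). split; [apply Rdiv_lt_0_compat; lra|].
      intros t Ht. apply He', Hd'. rewrite Hpd. apply Rlt_div_r in Ht; [|lra].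
      assert (B := Rabs_pos (t - s)). nra. }
    destruct (completeness (fun t => 0 <= t <= 1 /\ U (h (p t)))) as [s [Hs1 Hs2]].
    { exists 1. intros t [[_ ht] _]. exact ht. }
    { exists 0. split; [lra|]. replace (p 0) with a by (unfold p; ring). exact Hu. }
    assert (Hs : 0 <= s <= 1).
    { split.
      - apply Hs1. split; [lra|]. replace (p 0) with a by (unfold p; ring). exact Hu.
      - apply Hs2. intros t [[_ ht] _]. exact ht. }
    destruct (Hcov (h (p s))) as [Us|Vs].
    { exists (p s). split; auto. }
    + destruct (Hloc U HU s Hs Us) as [d [Hd Hd']].
      destruct (Rle_lt_or_eq_dec s 1 ltac:(lra)) as [h1|h1].
      * set (t := s + Rmin d (1 - s) / 2).
        assert (M := Rmin_pos d (1 - s) Hd ltac:(lra)).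
        assert (M1 := Rmin_l d (1 - s)). assert (M2 := Rmin_r d (1 - s)).
        assert (t <= s); [|unfold t in *; lra]. apply Hs1. split; [unfold t; lra|].
        apply Hd'. rewrite Rabs_pos_eq; unfold t; lra.
      * subst s. replace (p 1) with b in Us by (unfold p; ring). now apply (Hdisj b).
    + destruct (Hloc V HV s Hs Vs) as [d [Hd Hd']].
      assert (s <= s - d); [|lra]. apply Hs2. intros t [Ht Ut].
      apply Rnot_lt_le. intros h1.
      apply (Hdisj (p t)); auto. apply Hd'.
      assert (t <= s) by (apply Hs1; auto). apply Rabs_lt_between. lra.
Qed.

(** The infimum is infinite exactly when all the suprema over neighbourhoods
    are, that is, when u is unbounded above near s. *)
Lemma LimSup_within_p_infty (D : C -> Prop) (u : C -> R) (s : C) :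
  LimSup_within D u s = p_infty <->
  forall r M, 0 < r -> exists z, D z /\ Cmod (z - s) < r /\ M < u z.
Proof.
  set (E := fun r y => exists z : C, D z /\ Cmod (z - s)%C < r /\ y = u z).
  set (F := fun l => exists r : posreal, l = Lub_Rbar (E r)).
  change (LimSup_within D u s) with (Rbar_glb F).
  assert (G : Rbar_is_glb F (Rbar_glb F)) by exact (proj2_sig (Rbar_ex_glb F)).
  split.
  - intros H r M Hr. rewrite H in G. destruct G as [G _].
    specialize (G (Lub_Rbar (E r)) (ex_intro _ (mkposreal r Hr) eq_refl)).
    destruct (Lub_Rbar_correct (E r)) as [_ L]. apply NNPP. intros N.
    assert (B : Rbar_le (Lub_Rbar (E r)) M).
    { apply L. intros y [z [h1 [h2 ->]]]. simpl. apply Rnot_lt_le. intros h3.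
      apply N. now exists z. }
    assert (X := Rbar_le_trans _ _ _ G B). exact X.
  - intros H. assert (B : Rbar_le p_infty (Rbar_glb F)).
    { apply G. intros l [r ->]. destruct (Lub_Rbar_correct (E r)) as [L _].
      destruct (Lub_Rbar (E r)) as [x| |] eqn:EL; simpl.
      - destruct (H r x (cond_pos r)) as [z [h1 [h2 h3]]].
        specialize (L (u z)). simpl in L. assert (u z <= x) by (apply L; now exists z). lra.
      - exact I.
      - destruct (H r 0 (cond_pos r)) as [z [h1 [h2 h3]]].
        specialize (L (u z)). simpl in L. apply L. now exists z. }
    destruct (Rbar_glb F); simpl in B; [contradiction|reflexivity|contradiction].
Qed.

Definition to_disk (sigma w : C) : C := (sigma * (w - 1) / (w + 1))%C.

Definition to_RHP (sigma z : C) : C := ((sigma + z) / (sigma - z))%C.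

Lemma RHP_plus_1_nonzero w : RHP w -> (w + 1)%C <> 0%C.
Proof. intros Hw. apply RHP_add_nonzero; [exact Hw|]. unfold RHP. rewrite re_RtoC. lra. Qed.

Lemma Cmod_plus_1 w : Cmod (w + 1) ^ 2 = Cmod (w - 1) ^ 2 + 4 * Re w.
Proof. rewrite !Cmod2_alt. unfold Re, Im; simpl; ring. Qed.

Lemma boundary_sub_nonzero sigma z : Cmod sigma = 1 -> unit_disk z -> (sigma - z)%C <> 0%C.
Proof. intros Hs Hz E. apply Ceq_minus in E. subst z. unfold unit_disk in Hz. lra. Qed.

Lemma to_disk_in_disk sigma w : Cmod sigma = 1 -> RHP w -> unit_disk (to_disk sigma w).
Proof.
  intros Hs Hw. unfold unit_disk, to_disk.
  rewrite Cmod_div, Cmod_mult, Hs, Rmult_1_l by now apply RHP_plus_1_nonzero.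
  assert (P : 0 < Cmod (w + 1)) by now apply Cmod_gt_0, RHP_plus_1_nonzero.
  apply Rlt_div_l; [exact P|].
  assert (E := Cmod_plus_1 w). assert (A := Cmod_ge_0 (w - 1)). unfold RHP in Hw. nra.
Qed.

Lemma to_RHP_plus_1_nonzero sigma z : Cmod sigma = 1 -> unit_disk z ->
  (to_RHP sigma z + 1)%C <> 0%C.
Proof.
  intros Hs Hz. assert (D := boundary_sub_nonzero sigma z Hs Hz).
  replace (to_RHP sigma z + 1)%C with (2 * sigma / (sigma - z))%C
    by (unfold to_RHP; field; exact D).
  apply Cmult_neq_0; [apply Cmult_neq_0|].
  - intros E. apply RtoC_inj in E. lra.
  - apply Cmod_gt_0. lra.
  - intros E. apply (f_equal (fun u => (u * (sigma - z))%C)) in E.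
    rewrite Cinv_l in E by exact D. rewrite Cmult_0_l in E.
    apply RtoC_inj in E. lra.
Qed.

Lemma to_disk_to_RHP sigma z : Cmod sigma = 1 -> unit_disk z ->
  to_disk sigma (to_RHP sigma z) = z.
Proof.
  intros Hs Hz. assert (Hnz : sigma <> 0%C) by (apply Cmod_gt_0; lra).
  unfold to_disk, to_RHP. field. split; [now apply boundary_sub_nonzero|].
  intros E. apply Hnz. replace sigma with ((sigma + z + (sigma - z)) / 2)%C.
  - rewrite E. field.
  - field.
Qed.

Lemma to_RHP_in_RHP sigma z : Cmod sigma = 1 -> unit_disk z -> RHP (to_RHP sigma z).
Proof.
  intros Hs Hz. unfold RHP.
  assert (N := to_RHP_plus_1_nonzero sigma z Hs Hz).
  assert (P : 0 < Cmod (to_RHP sigma z + 1)) by now apply Cmod_gt_0.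
  assert (E : Cmod (to_disk sigma (to_RHP sigma z)) * Cmod (to_RHP sigma z + 1)
              = Cmod (to_RHP sigma z - 1)).
  { unfold to_disk. rewrite Cmod_div, Cmod_mult, Hs by exact N. field. lra. }
  rewrite to_disk_to_RHP in E by auto. unfold unit_disk in Hz.
  assert (Q := Cmod_plus_1 (to_RHP sigma z)). assert (A := Cmod_ge_0 (to_RHP sigma z - 1)).
  assert (L : Cmod (to_RHP sigma z - 1) < Cmod (to_RHP sigma z + 1)) by (rewrite <- E; nra).
  nra.
Qed.

Lemma to_RHP_to_disk sigma w : Cmod sigma = 1 -> RHP w -> to_RHP sigma (to_disk sigma w) = w.
Proof.
  intros Hs Hw. assert (Hnz : sigma <> 0%C) by (apply Cmod_gt_0; lra).
  assert (N1 := RHP_plus_1_nonzero w Hw). unfold to_RHP, to_disk.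
  assert (E : (sigma - sigma * (w - 1) / (w + 1) = 2 * sigma / (w + 1))%C) by (field; exact N1).
  rewrite E. field. split; auto.
Qed.

Lemma to_disk_distance sigma w : Cmod sigma = 1 -> RHP w ->
  Cmod (to_disk sigma w - sigma) = 2 / Cmod (w + 1).
Proof.
  intros Hs Hw. assert (N := RHP_plus_1_nonzero w Hw).
  replace (to_disk sigma w - sigma)%C with (- (2 * sigma / (w + 1)))%C
    by (unfold to_disk; field; exact N).
  rewrite Cmod_opp, Cmod_div, Cmod_mult, Hs, Cmod_R, Rabs_pos_eq by (exact N || lra).
  field. apply Rgt_not_eq. now apply Cmod_gt_0.
Qed.

Lemma Cder_to_disk sigma w : RHP w ->
  Cder (to_disk sigma) w (2 * sigma / ((w + 1) * (w + 1)))%C.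
Proof.
  intros Hw. assert (N := RHP_plus_1_nonzero w Hw).
  replace (2 * sigma / ((w + 1) * (w + 1)))%C
    with (sigma * 1 * (/ (w + 1)) + sigma * (w - 1) * (- (1 + 0) / ((w + 1) * (w + 1))))%C
    by (field; exact N).
  unfold to_disk, Cdiv at 1.
  apply (Cder_mult (fun w => sigma * (w - 1))%C (fun w => / (w + 1))%C).
  - apply (Cder_scal sigma (fun w => w - 1)%C), (Cder_sub_const (fun w => w) 1%C), Cder_id.
  - apply (Cder_inv (fun w => w + 1)%C w (1 + 0)%C); [|exact N].
    apply Cder_plus; [apply Cder_id|apply Cder_const].
Qed.

Definition half_plane_model (h : C -> C) (sigma w : C) : C := h (to_disk sigma w).

Lemma half_plane_model_to_RHP h sigma z : Cmod sigma = 1 -> unit_disk z ->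
  half_plane_model h sigma (to_RHP sigma z) = h z.
Proof. intros Hs Hz. unfold half_plane_model. now rewrite to_disk_to_RHP. Qed.

Lemma Cder_half_plane_model h sigma w : Cmod sigma = 1 -> holo unit_disk h -> RHP w ->
  Cder (half_plane_model h sigma) w
    (C_derive h (to_disk sigma w) * (2 * sigma / ((w + 1) * (w + 1))))%C.
Proof.
  intros Hs Hh Hw. apply (Cder_comp (to_disk sigma) h); [now apply Cder_to_disk|].
  apply Cder_C_derive, Hh. now apply to_disk_in_disk.
Qed.

Lemma holo_half_plane_model h sigma : Cmod sigma = 1 -> holo unit_disk h ->
  holo RHP (half_plane_model h sigma).
Proof. intros Hs Hh w Hw. eexists. now apply Cder_half_plane_model. Qed.

(** Here sigma - z = 2 sigma / (w + 1) and dz/dw = 2 sigma / (w + 1)^2, so that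
    conj sigma * (sigma - z)^2 = 2 (sigma * conj sigma) dz/dw = 2 dz/dw. *)
Lemma condition_half_plane h sigma z : Cmod sigma = 1 -> holo unit_disk h -> unit_disk z ->
  Im (Cconj sigma * (sigma - z) ^ 2 * C_derive h z)%C
  = 2 * Im (C_derive (half_plane_model h sigma) (to_RHP sigma z)).
Proof.
  intros Hs Hh Hz.
  assert (Hw := to_RHP_in_RHP sigma z Hs Hz).
  assert (Ez := to_disk_to_RHP sigma z Hs Hz).
  set (w := to_RHP sigma z) in *.
  rewrite (C_derive_unique _ _ _ (Cder_half_plane_model h sigma w Hs Hh Hw)), Ez, <- im_scal_l.
  f_equal. assert (N := RHP_plus_1_nonzero w Hw).
  replace (sigma - z)%C with (2 * sigma / (w + 1))%C
    by (rewrite <- Ez; unfold to_disk; field; exact N).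
  assert (S : (sigma * Cconj sigma = 1)%C).
  { rewrite <- Cmod2_conj, Hs. f_equal. ring. }
  set (l := C_derive h z).
  replace (Cconj sigma * (2 * sigma / (w + 1)) ^ 2 * l)%C
    with (2 * l * (2 * ((sigma * Cconj sigma) * sigma) / ((w + 1) * (w + 1))))%C
    by (field; exact N).
  rewrite S. field. exact N.
Qed.

Lemma condition_half_plane_all h sigma : Cmod sigma = 1 -> holo unit_disk h ->
  (forall z : C, unit_disk z -> Im (Cconj sigma * (sigma - z) ^ 2 * C_derive h z)%C >= 0) <->
  forall w, RHP w -> 0 <= Im (C_derive (half_plane_model h sigma) w).
Proof.
  intros Hs Hh. split.
  - intros H w Hw. specialize (H (to_disk sigma w) (to_disk_in_disk sigma w Hs Hw)).
    rewrite condition_half_plane, to_RHP_to_disk in H by auto using to_disk_in_disk. lra.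
  - intros H z Hz. rewrite condition_half_plane by auto.
    specialize (H _ (to_RHP_in_RHP sigma z Hs Hz)). lra.
Qed.

Definition starlike_on_RHP (g : C -> C) : Prop :=
  injective_on RHP g /\ upward g /\ high_near_infinity g.

Lemma starlike_half_plane h sigma : Cmod sigma = 1 -> holo unit_disk h ->
  starlike_at_infinity_wrt h sigma <-> starlike_on_RHP (half_plane_model h sigma).
Proof.
  intros Hs Hh. assert (Hto := to_RHP_in_RHP sigma). assert (Hin := to_disk_in_disk sigma).
  set (g := half_plane_model h sigma).
  split.
  - intros [[_ Hi] [Hl [_ Hst]]]. split; [|split].
    + intros a b Ha Hb E. apply Hi in E; auto.
      now rewrite <- (to_RHP_to_disk sigma a), <- (to_RHP_to_disk sigma b), E by auto.
    + intros w t Hw Ht.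
      destruct (Hst t Ht (g w)) as [z [Hz E]]; [exists (to_disk sigma w); auto|].
      exists (to_RHP sigma z). split; [now apply Hto|].
      unfold g at 1. rewrite half_plane_model_to_RHP; auto.
    + intros r M. rewrite LimSup_within_p_infty in Hl.
      assert (A := Rabs_pos r).
      destruct (Hl (2 / (Rabs r + 2)) M) as [z [Hz [h1 h2]]]; [apply Rdiv_lt_0_compat; lra|].
      exists (to_RHP sigma z). split; [now apply Hto|].
      unfold g. rewrite half_plane_model_to_RHP by auto. split; [|exact h2].
      rewrite <- (to_disk_to_RHP sigma z Hs Hz), to_disk_distance in h1 by auto.
      assert (P : 0 < Cmod (to_RHP sigma z + 1)) by now apply Cmod_gt_0, to_RHP_plus_1_nonzero.
      assert (B : Rabs r + 2 < Cmod (to_RHP sigma z + 1)).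
      { apply Rnot_le_lt. intros L. apply Rinv_le_contravar in L; [|exact P].
        unfold Rdiv in h1. lra. }
      assert (T := Cmod_triangle (to_RHP sigma z) 1). rewrite Cmod_1 in T.
      assert (B2 := Rle_abs r). lra.
  - intros [Hi [Hup Hfar]].
    assert (Hih : injective_on unit_disk h).
    { intros z w Hz Hw E.
      rewrite <- (half_plane_model_to_RHP h sigma z), <- (half_plane_model_to_RHP h sigma w) in E
        by auto.
      apply Hi in E; auto.
      now rewrite <- (to_disk_to_RHP sigma z), <- (to_disk_to_RHP sigma w), E by auto. }
    split; [split|split].
    + intros z Hz. destruct (Hh z Hz) as [l Hl]. exists l. now apply is_derive_Cder.
    + exact Hih.
    + apply LimSup_within_p_infty. intros r M Hr.
      destruct (Hfar (2 / r + 1) M) as [b [Hb [h1 h2]]].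
      exists (to_disk sigma b). split; [now apply Hin|]. split; [|exact h2].
      rewrite to_disk_distance by auto.
      assert (T := Cmod_tri_inv b (- (1))). rewrite Cmod_opp, Cmod_1 in T.
      replace (b - - (1))%C with (b + 1)%C in T by ring.
      assert (Q : 0 < 2 / r) by (apply Rdiv_lt_0_compat; lra).
      apply Rlt_div_l; [lra|]. assert (h3 : 2 / r < Cmod (b + 1)) by lra.
      apply Rlt_div_l in h3; lra.
    + split; [now apply image_is_domain|].
      intros t Ht w [z [Hz <-]].
      destruct (Hup (to_RHP sigma z) t (Hto z Hs Hz) Ht) as [w' [Hw' E]].
      exists (to_disk sigma w'). split; [now apply Hin|].
      change (h (to_disk sigma w')) with (g w').
      rewrite E. unfold g. now rewrite half_plane_model_to_RHP.
Qed.

(** For real a <> 0 translations by i t of the image are translations of the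
    half-plane parallel to its boundary, in either direction. *)
Lemma affine_starlike g (a : R) (b : C) : a <> 0 -> (forall w, RHP w -> g w = (RtoC a * w + b)%C) ->
  starlike_on_RHP g.
Proof.
  intros Ha Hab.
  assert (HaC : RtoC a <> 0%C) by (intros E; now apply RtoC_inj in E).
  split; [|split].
  - intros z w Hz Hw E. rewrite !Hab in E by auto.
    replace z with ((RtoC a * z + b - b) / RtoC a)%C by (field; exact HaC).
    rewrite E. field. exact HaC.
  - intros w t Hw _. exists (w + Ci * RtoC (t / a))%C.
    assert (H : RHP (w + Ci * RtoC (t / a))%C).
    { unfold RHP in *. rewrite re_plus. replace (Re (Ci * RtoC (t / a))%C) with 0
        by (unfold Re; simpl; ring). lra. }
    split; [exact H|]. rewrite !Hab by auto. rewrite RtoC_div by exact Ha. field. exact HaC.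
  - intros r M.
    set (s := (Rabs r + 1 + (Rabs (M - Im b) + 1) / Rabs a)).
    assert (Ap : 0 < Rabs a) by now apply Rabs_pos_lt.
    assert (A1 := Rabs_pos r). assert (A2 := Rabs_pos (M - Im b)).
    assert (A3 : 0 < (Rabs (M - Im b) + 1) / Rabs a) by (apply Rdiv_lt_0_compat; lra).
    assert (Hs : 0 < s) by (unfold s; lra).
    (* up the line Re w = 1 when a is positive, down when it is negative *)
    set (y := s * (Rabs a / a)).
    assert (Hy : a * y = Rabs a * s) by (unfold y; field; exact Ha).
    assert (Hyabs : Rabs y = s).
    { unfold y. rewrite Rabs_mult, Rabs_div, Rabs_Rabsolu, (Rabs_pos_eq s) by (auto; lra).
      field. lra. }
    exists (1, y). assert (H1 : RHP (1, y)) by (unfold RHP, Re; simpl; lra).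
    split; [exact H1|]. split.
    + assert (L := im_le_Cmod (1, y)). unfold Im in L; simpl in L. rewrite Hyabs in L.
      assert (L2 := Rle_abs r). unfold s in L. lra.
    + rewrite Hab by exact H1. rewrite im_plus, im_scal_l.
      change (Im (1, y)) with y. rewrite Hy.
      assert (E : Rabs a * s = Rabs a * (Rabs r + 1) + (Rabs (M - Im b) + 1))
        by (unfold s; field; lra).
      assert (L := Rle_abs (M - Im b)). assert (0 <= Rabs a * (Rabs r + 1)) by nra. lra.
Qed.

Lemma equality_case h sigma w0 : Cmod sigma = 1 -> holo unit_disk h ->
  ~ constant_on unit_disk h ->
  (forall w, RHP w -> 0 <= Im (C_derive (half_plane_model h sigma) w)) ->
  RHP w0 -> Im (C_derive (half_plane_model h sigma) w0) = 0 ->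
  exists (a : R) (b : C), a <> 0 /\
    forall w, RHP w -> half_plane_model h sigma w = (RtoC a * w + b)%C.
Proof.
  intros Hs Hh Hnc Hp Hw0 H0.
  assert (Hg := holo_half_plane_model h sigma Hs Hh).
  destruct (affine_of_real_derivative _ Hg (critical_everywhere _ w0 Hg Hp Hw0 H0))
    as [a [b Hab]].
  exists a, b. split; [|exact Hab]. intros ->. apply Hnc. exists b. intros z Hz.
  rewrite <- (half_plane_model_to_RHP h sigma z), Hab by auto using to_RHP_in_RHP. ring.
Qed.

Lemma starlike_on_RHP_iff h sigma : Cmod sigma = 1 -> holo unit_disk h ->
  ~ constant_on unit_disk h ->
  starlike_on_RHP (half_plane_model h sigma) <->
  forall w, RHP w -> 0 <= Im (C_derive (half_plane_model h sigma) w).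
Proof.
  intros Hs Hh Hnc. assert (Hg := holo_half_plane_model h sigma Hs Hh).
  split.
  - intros [Hi [Hup Hfar]]. now apply starlike_derivative.
  - intros Hp.
    destruct (classic (exists w, RHP w /\ Im (C_derive (half_plane_model h sigma) w) = 0))
      as [[w [Hw H0]]|N].
    + destruct (equality_case h sigma w Hs Hh Hnc Hp Hw H0) as [a [b [Ha Hab]]].
      now apply (affine_starlike _ a b).
    + assert (Hpos : forall w, RHP w -> 0 < Im (C_derive (half_plane_model h sigma) w)).
      { intros w Hw. destruct (Rle_lt_or_eq_dec _ _ (Hp w Hw)) as [l|e]; [exact l|].
        exfalso. apply N. now exists w. }
      split; [now apply positive_injective|split].
      * now apply positive_upward.
      * now apply positive_far.
Qed.

Theorem theorem4p7 (h : C -> C) (sigma : C)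
  (h_holo : holomorphic_on unit_disk h)
  (h_nonconst : ~ constant_on unit_disk h)
  (sigma_bd : Cmod sigma = 1) :
  (starlike_at_infinity_wrt h sigma <->
     (forall z : C, unit_disk z ->
        Im (Cconj sigma * (sigma - z) ^ 2 * C_derive h z)%C >= 0))
  /\
  ((forall z : C, unit_disk z ->
      Im (Cconj sigma * (sigma - z) ^ 2 * C_derive h z)%C >= 0) ->
   ((exists z : C, unit_disk z /\
       Im (Cconj sigma * (sigma - z) ^ 2 * C_derive h z)%C = 0) ->
    (forall z : C, unit_disk z ->
       Im (Cconj sigma * (sigma - z) ^ 2 * C_derive h z)%C = 0))
   /\
   ((exists z : C, unit_disk z /\
       Im (Cconj sigma * (sigma - z) ^ 2 * C_derive h z)%C = 0) <->
    (exists (a : R) (c : C), a <> 0 /\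
       forall z : C, unit_disk z ->
         h z = (RtoC a * ((sigma + z) / (sigma - z)) + c)%C))).
Proof.
  assert (Hh : holo unit_disk h).
  { intros z Hz. exists (C_derive h z). now apply ex_derive_Cder, h_holo. }
  assert (Hg := holo_half_plane_model h sigma sigma_bd Hh).
  rewrite starlike_half_plane, condition_half_plane_all by assumption.
  split; [now apply starlike_on_RHP_iff|]. intros Hp. split; [|split].
  - intros [z0 [Hz0 H0]] z Hz. rewrite condition_half_plane in H0 |- * by assumption.
    rewrite (critical_everywhere _ (to_RHP sigma z0) Hg Hp); auto using to_RHP_in_RHP; lra.
  - intros [z0 [Hz0 H0]]. rewrite condition_half_plane in H0 by assumption.
    destruct (equality_case h sigma (to_RHP sigma z0) sigma_bd Hh h_nonconst Hp)
      as [a [b [Ha Hab]]]; [now apply to_RHP_in_RHP|lra|].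
    exists a, b. split; [exact Ha|]. intros z Hz.
    rewrite <- (half_plane_model_to_RHP h sigma z) by assumption.
    now rewrite Hab by now apply to_RHP_in_RHP.
  - intros [a [b [Ha Hab]]].
    assert (H0 : unit_disk 0%C) by (unfold unit_disk; rewrite Cmod_0; lra).
    exists 0%C. split; [exact H0|]. rewrite condition_half_plane by assumption.
    assert (Hw := to_RHP_in_RHP sigma 0%C sigma_bd H0).
    assert (D : Cder (half_plane_model h sigma) (to_RHP sigma 0%C) (RtoC a * 1 + 0)%C).
    { destruct (RHP_open _ Hw) as [r [Hr Hr']].
      apply (Cder_ext_loc (fun w => RtoC a * w + b)%C _ _ _ r Hr).
      - intros w Hwr. specialize (Hr' w Hwr). unfold half_plane_model.
        rewrite Hab by now apply to_disk_in_disk.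
        fold (to_RHP sigma (to_disk sigma w)). now rewrite to_RHP_to_disk.
      - apply Cder_plus; [apply Cder_scal, Cder_id|apply Cder_const]. }
    rewrite (C_derive_unique _ _ _ D). unfold Im; simpl; ring.
Qed.
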